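(* Let $X$ be a nonnegative integer-valued random variable whose PGF $X(z)$ has radius of convergence $r>1$, mean $\mu=X'(1)>0$ and variance $\sigma^2=X''(1)-X'(1)^2+X'(1)>0$, such that $|X(z)|<X(r_1)$ whenever $|z|=r_1$, $z\ne r_1$, $r_1\in(0,r)$. For positive integers $n,s$ let $A(z)=X(z)^n$, $\mu_A=n\mu<s$, with degree of $X(z)$ larger than $s/n$. Let $z_1,\dots,z_{s-1}$ be the zeros of $z^s-A(z)$ in $|z|<1$ and $Z_0$ its zero of minimal modulus in $1<|z|<r$. Suppose $\frac{n\mu}{s}=1-\frac{\gamma}{\sqrt s}$ with $\gamma$ bounded away from $0$ and $\infty$; let $a_0=\sqrt{2\mu}/\sigma$, $b_0=\frac{\gamma\sqrt\mu}{\sigma\sqrt2}$, and for integers $k$ let $Z_k$ be the zero of $z^s-A(z)$ in $1<|z|<r$ with $Z_k=1+\frac{a_0}{\sqrt s}\big(b_0+\sqrt{b_0^2-2\pi ik}\big)+O(s^{-1})$. Let $Q$ have the stationary distribution of the Markov chain $Q_{k+1}=\max\{Q_k+A_k-s,0\}$ ($A_k$ i.i.d. with PGF $A(z)$), with PGF $Q(z)=\frac{(s-\mu_A)(z-1)}{z^s-A(z)}\prod_{j=1}^{s-1}\frac{z-z_j}{1-z_j}$, and $c_k=\operatorname{Res}_{z=Z_k}Q(z)$. Then, as $N\to\infty$, there is the asymptotic series $$\mathbb{P}(Q>N)\sim\operatorname{Re}\Big[\frac{c_0}{(1-Z_0)Z_0^{N+1}}+2\sum_{k=1}^{\infty}\frac{c_k}{(1-Z_k)Z_k^{N+1}}\Big],$$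 where the ratio of the terms in the series with index $M$ and $M-1$ is $O(|Z_{M-1}/Z_M|^N)$; here, for the terms considered, $s$ is taken so large that $|Z_0|<|Z_1|<\dots<|Z_M|$. *)

(* Defs.v *)
From Stdlib Require Import Reals ZArith Lra.
From Coquelicot Require Import Coquelicot.
Open Scope R_scope.

Definition pgf (p : nat -> R) (z : C) : C :=
  (Series (fun k => p k * Re (Cpow z k)), Series (fun k => p k * Im (Cpow z k))).

Definition is_pmf (p : nat -> R) : Prop :=
  (forall k, 0 <= p k) /\ is_series p 1.

Definition pgf_mean (p : nat -> R) : R := Series (fun k => INR k * p k).
Definition pgf_fact2 (p : nat -> R) : R := Series (fun k => INR k * (INR k - 1) * p k).
Definition pgf_var (p : nat -> R) : R :=
  pgf_fact2 p - pgf_mean p ^ 2 + pgf_mean p.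

(** Convolution and n-fold convolution power: the pmf of A = sum of n i.i.d.
    copies of X, whose PGF is X(z)^n. *)
Definition conv (p q : nat -> R) (m : nat) : R :=
  sum_n (fun i => p i * q (m - i)%nat) m.
Fixpoint convpow (p : nat -> R) (n : nat) : nat -> R :=
  match n with
  | O => fun m => if Nat.eqb m 0 then 1 else 0
  | S n' => conv p (convpow p n')
  end.

(** Transition probability of Q_{k+1} = max(Q_k + A_k - s, 0) with A_k ~ a. *)
Definition step (a : nat -> R) (s i j : nat) : R :=
  if Nat.eqb j 0 then
    (if Nat.leb i s then sum_n a (s - i)%nat else 0)
  else
    (if Nat.leb i (j + s) then a (j + s - i)%nat else 0).

Definition stationary (a : nat -> R) (s : nat) (pi : nat -> R) : Prop :=
  is_pmf pi /\ forall j, is_series (fun i => pi i * step a s i j) (pi j).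

Definition tailP (pi : nat -> R) (N : nat) : R := Series (fun m => pi (N + 1 + m)%nat).

Definition charf (p : nat -> R) (n s : nat) (z : C) : C :=
  (Cpow z s - Cpow (pgf p z) n)%C.

Definition cexpi (t : R) : C := (cos t, sin t).

Definition is_residue (f : C -> C) (Z c : C) : Prop :=
  exists eps0 : R, 0 < eps0 /\
    forall eps : R, 0 < eps < eps0 ->
      @is_RInt C_R_NormedModule
        (fun t => (f (Z + RtoC eps * cexpi t) * (RtoC eps * Ci * cexpi t))%C)
        0 (2 * PI) (2 * PI * Ci * c)%C.

Definition csqrt (w : C) : C :=
  (sqrt ((Cmod w + Re w) / 2),
   (if Rlt_dec (Im w) 0 then -1 else 1) * sqrt ((Cmod w - Re w) / 2)).

Definition term (c Z : C) (N : nat) : C :=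
  (c / ((1 - Z) * Cpow Z (N + 1)))%C.

Fixpoint partial (c Z : nat -> C) (m N : nat) : C :=
  match m with
  | O => 0%C
  | S m' => (partial c Z m' N + (if Nat.eqb m' 0 then 1 else 2) * term (c m') (Z m') N)%C
  end.

(* Main.v *)
Require Import Defs.
From Stdlib Require Import Reals ZArith Lra Lia Psatz List Classical.
From Coquelicot Require Import Coquelicot.
Open Scope R_scope.

(** Stationarity gives Q(z) (z^s - A(z)) = P(z) with P(z) = sum_{l<s} w_l (z^s - z^l), w_l >= 0 not all zero,
    so P has no zero in |z| > 1 and every simple zero of z^s - A(z) there is a simple pole of Q with nonzero
    residue; subtracting the polar parts leaves a function holomorphic in a larger disc, whose Taylor
    coefficients are bounded by Cauchy's estimate.

    The zeros are located by rescaling z = 1 + a0 eta / sqrt s. Taking moduli, a zero with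
    1 < |z| <= 1 + O(1 / sqrt s) satisfies z - 1 = O(1 / sqrt s). There s log z - n log X(z), which is
    2 pi i k at a zero, equals 2 b0 eta - eta^2 up to an error with Lipschitz constant O(1 / sqrt s) in eta.
    Hence eta is close to b0 + sqrt(b0^2 - 2 pi i k) or to b0 - sqrt(b0^2 - 2 pi i k); the second root would
    give |z| <= 1, and near the first one the zero is unique and simple. The real part of the first root increases
    with |k|, which orders the moduli. *)

(** * Complex differentiability *)

(** The claim with [m] terms has error |Z_m|^-N, so all poles of index at most m are subtracted, in
    a disc whose radius [R0] exceeds |Z_m|; the term of index m is afterwards returned to the error.
    The obstacle is that this disc must contain no further zero, while the zeros are only given
    asymptotically, one index at a time. Hence every zero in the disc is attached to an integer, its
    level k, and a level is shown to hold at most one zero. This is why the error of the quadratic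
    model is controlled in Lipschitz form: applied to a zero and the point 1 it locates the zero,
    applied to two zeros of one level it makes them equal. Uniqueness also makes Z_0 real, and
    conjugation maps level k to level -k, which produces the real part and the factor 2. The
    identity Q(z) (z^s - A(z)) = P(z) is proved on the interval (-1,1), where real power series are
    multiplied, and continued to the disc without the zeros. The large parameter is h = sqrt s; its
    threshold depends on the law of X, the bounds on gamma, M and the constants of the given
    asymptotics, never on the single model. *)

Lemma im_le_Cmod (c : C) : Rabs (Im c) <= Cmod c.
Proof.
  eapply Rle_trans; [apply Rmax_r | apply Rmax_Cmod].
Qed.

Lemma Cmod_le_Re_Im (c : C) : Cmod c <= Rabs (Re c) + Rabs (Im c).
Proof.
  pose proof (Rabs_pos (Re c)); pose proof (Rabs_pos (Im c)).
  apply Rsqr_incr_0_var; [|lra].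
  rewrite Rsqr_pow2, Cmod2_alt, Rsqr_pow2.
  rewrite <- (pow2_abs (Re c)), <- (pow2_abs (Im c)). nra.
Qed.

Lemma Cmod_minus_sym (a b : C) : Cmod (a - b) = Cmod (b - a).
Proof. rewrite <- Cmod_opp. f_equal. ring. Qed.

Lemma Cmod_minus_0_eq (a b : C) : Cmod (a - b) = 0 -> a = b.
Proof.
  intros H. apply Cmod_eq_0 in H.
  replace a with ((a - b) + b)%C by ring. rewrite H. ring.
Qed.

Lemma Cminus_neq_0 (a b : C) : a <> b -> (a - b)%C <> 0%C.
Proof.
  intros H E. apply H. replace a with ((a - b) + b)%C by ring. rewrite E. ring.
Qed.

Lemma Cmod_triangle_minus (a b : C) : Cmod (a - b) <= Cmod a + Cmod b.
Proof. unfold Cminus. rewrite <- (Cmod_opp b). apply Cmod_triangle. Qed.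

Lemma Cmod_triangle_via (b a c : C) : Cmod (a - c) <= Cmod (a - b) + Cmod (b - c).
Proof. replace (a - c)%C with ((a - b) + (b - c))%C by ring. apply Cmod_triangle. Qed.

Lemma Cmod_minus_ge (a b : C) : Cmod a - Cmod b <= Cmod (a - b).
Proof.
  pose proof (Cmod_triangle (a - b) b) as H.
  replace (a - b + b)%C with a in H by ring. lra.
Qed.

Definition Ccont (f : C -> C) (z : C) : Prop :=
  forall eps, 0 < eps -> exists d, 0 < d /\ forall u, Cmod (u - z) < d -> Cmod (f u - f z) < eps.

Lemma Ccont_const (c z : C) : Ccont (fun _ => c) z.
Proof.
  intros eps He. exists 1. split; [lra|]. intros u _.
  replace (c - c)%C with (RtoC 0) by (simpl; ring). rewrite Cmod_0. exact He.
Qed.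

Lemma Ccont_id (z : C) : Ccont (fun u => u) z.
Proof. intros eps He. exists eps. auto. Qed.

Lemma Ccont_plus (f g : C -> C) (z : C) :
  Ccont f z -> Ccont g z -> Ccont (fun u => f u + g u)%C z.
Proof.
  intros Hf Hg eps He.
  destruct (Hf (eps / 2)) as [d1 [D1 H1]]; [lra|].
  destruct (Hg (eps / 2)) as [d2 [D2 H2]]; [lra|].
  exists (Rmin d1 d2). split; [apply Rmin_pos; auto|]. intros u Hu.
  pose proof (Rmin_l d1 d2). pose proof (Rmin_r d1 d2).
  replace (f u + g u - (f z + g z))%C with ((f u - f z) + (g u - g z))%C by ring.
  eapply Rle_lt_trans; [apply Cmod_triangle|].
  specialize (H1 u ltac:(lra)). specialize (H2 u ltac:(lra)). lra.
Qed.

Lemma Ccont_mult (f g : C -> C) (z : C) :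
  Ccont f z -> Ccont g z -> Ccont (fun u => f u * g u)%C z.
Proof.
  intros Hf Hg eps He.
  pose proof (Cmod_ge_0 (f z)) as Fz. pose proof (Cmod_ge_0 (g z)) as Gz.
  set (B := 1 + Cmod (f z) + Cmod (g z)).
  assert (HB : 0 < eps / (2 * B)) by (apply Rdiv_lt_0_compat; unfold B; lra).
  destruct (Hf (Rmin 1 (eps / (2 * B)))) as [d1 [D1 H1]]; [apply Rmin_pos; lra|].
  destruct (Hg (eps / (2 * B))) as [d2 [D2 H2]]; [lra|].
  exists (Rmin d1 d2). split; [apply Rmin_pos; auto|]. intros u Hu.
  pose proof (Rmin_l d1 d2). pose proof (Rmin_r d1 d2).
  pose proof (Rmin_l 1 (eps / (2 * B))). pose proof (Rmin_r 1 (eps / (2 * B))).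
  specialize (H1 u ltac:(lra)). specialize (H2 u ltac:(lra)).
  replace (f u * g u - f z * g z)%C
    with ((f u - f z) * (g u - g z) + ((f u - f z) * g z + f z * (g u - g z)))%C by ring.
  pose proof (Cmod_ge_0 (f u - f z)). pose proof (Cmod_ge_0 (g u - g z)).
  eapply Rle_lt_trans; [apply Cmod_triangle|].
  eapply Rle_lt_trans; [apply Rplus_le_compat_l, Cmod_triangle|].
  rewrite !Cmod_mult.
  assert (E : eps = eps / (2 * B) * B + eps / (2 * B) * B) by (field; unfold B; lra).
  set (e := eps / (2 * B)) in *. unfold B in E. nra.
Qed.

Lemma Ccont_inv (f : C -> C) (z : C) :
  Ccont f z -> f z <> 0%C -> Ccont (fun u => / f u)%C z.
Proof.
  intros Hf Hn eps He.
  assert (Fz : 0 < Cmod (f z)) by (apply Cmod_gt_0; auto).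
  set (m := Cmod (f z)) in *.
  assert (Hd : 0 < Rmin (m / 2) (eps * m * m / 2)).
  { apply Rmin_pos; [lra|]. pose proof (Rmult_lt_0_compat _ _ He Fz). nra. }
  destruct (Hf _ Hd) as [d [D H]].
  exists d. split; auto. intros u Hu. specialize (H u Hu).
  pose proof (Rmin_l (m / 2) (eps * m * m / 2)). pose proof (Rmin_r (m / 2) (eps * m * m / 2)).
  assert (Fu : m / 2 < Cmod (f u)).
  { pose proof (Cmod_minus_ge (f z) (f u)). rewrite Cmod_minus_sym in H2. fold m in H2. lra. }
  assert (Hun : f u <> 0%C) by (apply Cmod_gt_0; lra).
  replace (/ f u - / f z)%C with (- (f u - f z) / (f u * f z))%C by (field; auto).
  rewrite Cmod_div, Cmod_opp, Cmod_mult by (apply Cmult_neq_0; auto).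
  fold m. apply Rmult_lt_reg_r with (Cmod (f u) * m); [nra|].
  replace (Cmod (f u - f z) / (Cmod (f u) * m) * (Cmod (f u) * m)) with (Cmod (f u - f z))
    by (field; split; lra).
  assert (eps * (m / 2 * m) < eps * (Cmod (f u) * m)) by (apply Rmult_lt_compat_l; nra).
  nra.
Qed.

Lemma Ccont_comp (f g : C -> C) (z : C) :
  Ccont g z -> Ccont f (g z) -> Ccont (fun u => f (g u)) z.
Proof.
  intros Hg Hf eps He. destruct (Hf eps He) as [d [D H]].
  destruct (Hg d D) as [d' [D' H']]. exists d'. split; auto.
Qed.

Lemma Ccont_ext_loc (f g : C -> C) (z : C) (d : R) :
  0 < d -> (forall u, Cmod (u - z) < d -> f u = g u) -> Ccont f z -> Ccont g z.
Proof.
  intros Hd E Hf eps He. destruct (Hf eps He) as [d' [D' H']].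
  exists (Rmin d d'). split; [apply Rmin_pos; auto|]. intros u Hu.
  pose proof (Rmin_l d d'). pose proof (Rmin_r d d').
  rewrite <- !E; [apply H'; lra| |lra].
  replace (z - z)%C with (RtoC 0) by (simpl; ring). rewrite Cmod_0. auto.
Qed.

(* Caratheodory's form of complex differentiability. *)
Definition Cder (f : C -> C) (z l : C) : Prop :=
  exists phi, Ccont phi z /\ phi z = l /\ forall u, f u = (f z + phi u * (u - z))%C.

Definition Cdiff (f : C -> C) (z : C) : Prop := exists l, Cder f z l.

(** The difference quotient with [l] filled in at the centre: continuous there exactly when [l] is
    the derivative. It is the function to which Cauchy's theorem is applied in [cauchy_kern], and it
    divides out simple zeros in [quotient_pole]. *)
Definition Cslope (f : C -> C) (z l u : C) : C :=
  if Ceq_dec u z then l else ((f u - f z) / (u - z))%C.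

Lemma Cslope_eq (f : C -> C) (z l : C) : Cslope f z l z = l.
Proof. unfold Cslope. destruct (Ceq_dec z z); tauto. Qed.

Lemma Cslope_neq (f : C -> C) (z l u : C) : u <> z -> Cslope f z l u = ((f u - f z) / (u - z))%C.
Proof. unfold Cslope. destruct (Ceq_dec u z); tauto. Qed.

Lemma Cslope_spec (f : C -> C) (z l u : C) : f u = (f z + Cslope f z l u * (u - z))%C.
Proof.
  destruct (Ceq_dec u z) as [->|H].
  - ring.
  - rewrite Cslope_neq by auto. field. apply Cminus_neq_0; auto.
Qed.

Lemma Cder_Cslope (f : C -> C) (z l : C) : Cder f z l <-> Ccont (Cslope f z l) z.
Proof.
  split.
  - intros [phi [Hc [E H]]]. eapply Ccont_ext_loc with (d := 1); [lra| |exact Hc].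
    intros u _. destruct (Ceq_dec u z) as [->|N].
    + rewrite Cslope_eq. auto.
    + rewrite Cslope_neq, H by auto. field. apply Cminus_neq_0; auto.
  - intros H. exists (Cslope f z l). split; auto. split; [apply Cslope_eq|].
    intros u. apply Cslope_spec.
Qed.

Lemma Cder_bound (f : C -> C) (z l : C) :
  Cder f z l <-> (forall eps, 0 < eps -> exists d, 0 < d /\ forall u, Cmod (u - z) < d ->
     Cmod (f u - f z - l * (u - z)) <= eps * Cmod (u - z)).
Proof.
  split.
  - intros [phi [Hc [E H]]] eps He. destruct (Hc eps He) as [d [D Hd]].
    exists d. split; auto. intros u Hu. rewrite (H u), <- E.
    replace (f z + phi u * (u - z) - f z - phi z * (u - z))%C with ((phi u - phi z) * (u - z))%C by ring.
    rewrite Cmod_mult. apply Rmult_le_compat_r; [apply Cmod_ge_0|]. left. auto.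
  - intros H. apply Cder_Cslope. intros eps He. destruct (H (eps / 2)) as [d [D Hd]]; [lra|].
    exists d. split; auto. intros u Hu. rewrite Cslope_eq.
    destruct (Ceq_dec u z) as [->|N].
    + rewrite Cslope_eq. replace (l - l)%C with (RtoC 0) by (simpl; ring). rewrite Cmod_0; auto.
    + rewrite Cslope_neq by auto. pose proof (Cminus_neq_0 _ _ N) as Nz.
      replace ((f u - f z) / (u - z) - l)%C with ((f u - f z - l * (u - z)) / (u - z))%C by (field; auto).
      rewrite Cmod_div by auto. specialize (Hd u Hu).
      assert (0 < Cmod (u - z)) by (apply Cmod_gt_0; auto).
      apply Rle_lt_trans with (eps / 2); [|lra].
      apply Rmult_le_reg_r with (Cmod (u - z)); auto.
      unfold Rdiv at 1. rewrite Rmult_assoc, Rinv_l by lra. lra.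
Qed.

(** The bridge from the differentiability assumed of the continued generating function to the form
    used here; the norm of the module is [Cmod] up to conversion. *)
Lemma is_derive_Cder (f : C -> C) (z l : C) :
  @is_derive C_AbsRing C_NormedModule f z l -> Cder f z l.
Proof.
  intros [_ H]. apply Cder_bound. intros eps He.
  specialize (H z (fun P HP => HP) (mkposreal eps He)).
  destruct H as [d Hd]. exists d. split; [apply cond_pos|]. intros u Hu.
  specialize (Hd u Hu). simpl in Hd.
  match type of Hd with ?a <= _ * ?b =>
    change b with (Cmod (u - z)) in Hd;
    replace (Cmod (f u - f z - l * (u - z))) with a end; [exact Hd|].
  change (Cmod (f u + - f z + - ((u + - z) * l)) = Cmod (f u - f z - l * (u - z))).
  f_equal. ring.
Qed.

Lemma ex_derive_Cdiff (f : C -> C) (z : C) :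
  @ex_derive C_AbsRing C_NormedModule f z -> Cdiff f z.
Proof. intros [l H]. exists l. apply is_derive_Cder. exact H. Qed.

Lemma Cder_cont (f : C -> C) (z l : C) : Cder f z l -> Ccont f z.
Proof.
  intros [phi [Hc [E H]]].
  apply Ccont_ext_loc with (f := fun u => (f z + phi u * (u + - z))%C) (d := 1); [lra| |].
  - intros u _. rewrite (H u). ring.
  - apply Ccont_plus; [apply Ccont_const|]. apply Ccont_mult; auto.
    apply Ccont_plus; [apply Ccont_id | apply Ccont_const].
Qed.

Lemma Cdiff_cont (f : C -> C) (z : C) : Cdiff f z -> Ccont f z.
Proof. intros [l H]. eapply Cder_cont; eauto. Qed.

Lemma Cder_ext_loc (f g : C -> C) (z l : C) (d : R) :
  0 < d -> (forall u, Cmod (u - z) < d -> f u = g u) -> Cder f z l -> Cder g z l.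
Proof.
  intros Hd E H. apply Cder_Cslope. apply Cder_Cslope in H.
  eapply Ccont_ext_loc with (d := d); [auto| |exact H]. intros u Hu.
  unfold Cslope. destruct (Ceq_dec u z); auto. rewrite !E; auto.
  replace (z - z)%C with (RtoC 0) by (simpl; ring). rewrite Cmod_0. auto.
Qed.

Lemma Cdiff_ext_loc (f g : C -> C) (z : C) (d : R) :
  0 < d -> (forall u, Cmod (u - z) < d -> f u = g u) -> Cdiff f z -> Cdiff g z.
Proof. intros Hd E [l H]. exists l. eapply Cder_ext_loc; eauto. Qed.

Lemma Cder_const (c z : C) : Cder (fun _ => c) z 0%C.
Proof. exists (fun _ => 0%C). split; [apply Ccont_const|]. split; auto. intros u. ring. Qed.

Lemma Cder_id (z : C) : Cder (fun u => u) z 1%C.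
Proof. exists (fun _ => 1%C). split; [apply Ccont_const|]. split; auto. intros u. ring. Qed.

Lemma Cder_plus (f g : C -> C) (z l m : C) :
  Cder f z l -> Cder g z m -> Cder (fun u => f u + g u)%C z (l + m)%C.
Proof.
  intros [p [Cp [Ep Hp]]] [q [Cq [Eq Hq]]]. exists (fun u => p u + q u)%C.
  split; [apply Ccont_plus; auto|]. split; [rewrite Ep, Eq; auto|].
  intros u. rewrite (Hp u), (Hq u). ring.
Qed.

Lemma Cder_mult (f g : C -> C) (z l m : C) :
  Cder f z l -> Cder g z m -> Cder (fun u => f u * g u)%C z (l * g z + f z * m)%C.
Proof.
  intros Hf Hg. pose proof (Cder_cont _ _ _ Hg) as Cg.
  destruct Hf as [p [Cp [Ep Hp]]]. destruct Hg as [q [Cq [Eq Hq]]].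
  exists (fun u => p u * g u + f z * q u)%C.
  split. { apply Ccont_plus; apply Ccont_mult; auto using Ccont_const. }
  split; [rewrite Ep, Eq; auto|].
  intros u. rewrite (Hp u), (Hq u). ring.
Qed.

Lemma Cder_inv (f : C -> C) (z l : C) :
  Cder f z l -> f z <> 0%C -> Cdiff (fun u => / f u)%C z.
Proof.
  intros Hf Hn. pose proof (Cder_cont _ _ _ Hf) as Cf.
  pose proof (Ccont_inv _ _ Cf Hn) as Ci.
  destruct Hf as [p [Cp [Ep Hp]]].
  destruct (Cf (Cmod (f z))) as [d [D Hd]]; [apply Cmod_gt_0; auto|].
  assert (Nz : forall u, Cmod (u - z) < d -> f u <> 0%C).
  { intros u Hu E. specialize (Hd u Hu). rewrite E in Hd.
    replace (0 - f z)%C with (- f z)%C in Hd by ring. rewrite Cmod_opp in Hd. lra. }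
  exists (- (p z) * / f z * / f z)%C. apply Cder_Cslope.
  (* Where [f] does not vanish, the slope of 1/f is -phi(u) / (f(z) f(u)), which is continuous at
     z. *)
  apply Ccont_ext_loc with (f := fun u => (-(1) * p u * / f z * / f u)%C) (d := d); auto.
  - intros u Hu. unfold Cslope. destruct (Ceq_dec u z) as [->|N].
    + ring.
    + pose proof (Cminus_neq_0 _ _ N) as N'. specialize (Nz u Hu).
      rewrite (Hp u). rewrite (Hp u) in Nz. field. repeat split; auto.
  - repeat apply Ccont_mult; auto using Ccont_const.
Qed.

Lemma Cdiff_const (c z : C) : Cdiff (fun _ => c) z.
Proof. eexists. apply Cder_const. Qed.

Lemma Cdiff_id (z : C) : Cdiff (fun u => u) z.
Proof. eexists. apply Cder_id. Qed.

Lemma Cdiff_plus (f g : C -> C) (z : C) :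
  Cdiff f z -> Cdiff g z -> Cdiff (fun u => f u + g u)%C z.
Proof. intros [l H] [m K]. eexists. apply Cder_plus; eauto. Qed.

Lemma Cdiff_mult (f g : C -> C) (z : C) :
  Cdiff f z -> Cdiff g z -> Cdiff (fun u => f u * g u)%C z.
Proof. intros [l H] [m K]. eexists. apply Cder_mult; eauto. Qed.

Lemma Cdiff_opp (f : C -> C) (z : C) : Cdiff f z -> Cdiff (fun u => - f u)%C z.
Proof.
  intros H. apply Cdiff_ext_loc with (f := fun u => (-(1) * f u)%C) (d := 1); [lra| |].
  - intros; ring.
  - apply Cdiff_mult; auto using Cdiff_const.
Qed.

Lemma Cdiff_minus (f g : C -> C) (z : C) :
  Cdiff f z -> Cdiff g z -> Cdiff (fun u => f u - g u)%C z.
Proof. intros. apply Cdiff_plus; auto using Cdiff_opp. Qed.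

Lemma Cdiff_inv (f : C -> C) (z : C) : Cdiff f z -> f z <> 0%C -> Cdiff (fun u => / f u)%C z.
Proof. intros [l H] N. eapply Cder_inv; eauto. Qed.

Lemma Cdiff_div (f g : C -> C) (z : C) :
  Cdiff f z -> Cdiff g z -> g z <> 0%C -> Cdiff (fun u => f u / g u)%C z.
Proof. intros. apply Cdiff_mult; auto using Cdiff_inv. Qed.

Lemma Cdiff_Cslope_neq (f : C -> C) (a l z : C) :
  z <> a -> Cdiff f z -> Cdiff (Cslope f a l) z.
Proof.
  intros N H. assert (P : 0 < Cmod (z - a)) by (apply Cmod_gt_0, Cminus_neq_0; auto).
  apply Cdiff_ext_loc with (f := fun u => ((f u - f a) / (u - a))%C) (d := Cmod (z - a)); auto.
  - intros u Hu. rewrite Cslope_neq; auto. intros ->.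
    rewrite (Cmod_minus_sym a z) in Hu. lra.
  - apply Cdiff_div; [| |apply Cminus_neq_0; auto];
      apply Cdiff_minus; auto using Cdiff_const, Cdiff_id.
Qed.

Lemma Cder_pow (f : C -> C) (z l : C) (n : nat) :
  Cder f z l -> Cder (fun u => f u ^ n)%C z (INR n * l * f z ^ pred n)%C.
Proof.
  intros H. induction n as [|n IH].
  - replace (INR 0 * l * f z ^ pred 0)%C with (RtoC 0) by (simpl; ring). exact (Cder_const 1 z).
  - replace (INR (S n) * l * f z ^ pred (S n))%C
      with (l * (f z ^ n) + f z * (INR n * l * f z ^ pred n))%C.
    + apply (Cder_mult _ _ _ _ _ H IH).
    + rewrite S_INR, RtoC_plus. destruct n as [|n]; [simpl; ring|].
      change (pred (S (S n))) with (S n). change (pred (S n)) with n. rewrite (Cpow_S (f z) n). ring.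
Qed.

Lemma Cder_minus (f g : C -> C) (z l m : C) :
  Cder f z l -> Cder g z m -> Cder (fun u => f u - g u)%C z (l - m)%C.
Proof.
  intros Hf Hg. pose proof (Cder_mult _ _ _ _ _ (Cder_const (-(1))%C z) Hg) as H.
  pose proof (Cder_plus _ _ _ _ _ Hf H) as K.
  replace (l - m)%C with (l + (0 * g z + - (1) * m))%C by ring.
  eapply Cder_ext_loc with (d := 1); [lra| |exact K]. intros u _. simpl. ring.
Qed.

Lemma Cdiff_pow (f : C -> C) (z : C) (n : nat) : Cdiff f z -> Cdiff (fun u => f u ^ n)%C z.
Proof. intros [l H]. eexists. apply Cder_pow; eauto. Qed.

Lemma continuous_eps_delta (h : R -> R) (t : R) :
  (forall eps, 0 < eps -> exists d, 0 < d /\ forall u, Rabs (u - t) < d -> Rabs (h u - h t) < eps) ->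
  continuous h t.
Proof.
  intros H. apply filterlim_locally. intros eps. destruct (H eps (cond_pos eps)) as [d [D Hd]].
  exists (mkposreal d D). intros u Hu. apply Hd. exact Hu.
Qed.

(** * Integrals along paths and boundaries of rectangles *)

(** The path is extended to the plane, constant in the imaginary direction, so that the continuity
    lemmas for [Ccont] carry over without new proofs. *)
Definition pcont (g : R -> C) (t : R) : Prop := Ccont (fun z => g (Re z)) (RtoC t).

Lemma pcont_iff (g : R -> C) (t : R) :
  pcont g t <-> (forall eps, 0 < eps -> exists d, 0 < d /\
    forall u, Rabs (u - t) < d -> Cmod (g u - g t) < eps).
Proof.
  split; intros H eps He; destruct (H eps He) as [d [D Hd]]; exists d; split; auto.
  - intros u Hu. apply (Hd (RtoC u)). rewrite <- RtoC_minus, Cmod_R. exact Hu.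
  - intros z Hz. apply Hd. eapply Rle_lt_trans; [|exact Hz].
    replace (Re z - t) with (Re (z - RtoC t)) by (unfold Re; simpl; ring). apply re_le_Cmod.
Qed.

Lemma pcont_comp (f : C -> C) (g : R -> C) (t : R) :
  pcont g t -> Ccont f (g t) -> pcont (fun u => f (g u)) t.
Proof. intros Hg Hf. exact (Ccont_comp f (fun z => g (Re z)) (RtoC t) Hg Hf). Qed.

Lemma pcont_const (c : C) (t : R) : pcont (fun _ => c) t.
Proof. apply Ccont_const. Qed.

Lemma pcont_plus (f g : R -> C) (t : R) :
  pcont f t -> pcont g t -> pcont (fun u => f u + g u)%C t.
Proof. apply Ccont_plus. Qed.

Lemma pcont_mult (f g : R -> C) (t : R) :
  pcont f t -> pcont g t -> pcont (fun u => f u * g u)%C t.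
Proof. apply Ccont_mult. Qed.

Lemma pcont_inv (f : R -> C) (t : R) : pcont f t -> f t <> 0%C -> pcont (fun u => / f u)%C t.
Proof. intros H N. apply Ccont_inv; auto. Qed.

Lemma pcont_minus (f g : R -> C) (t : R) :
  pcont f t -> pcont g t -> pcont (fun u => f u - g u)%C t.
Proof.
  intros Hf Hg. apply (Ccont_ext_loc (fun z => f (Re z) + -(1) * g (Re z))%C _ _ 1); [lra| |].
  - intros u _. ring.
  - apply Ccont_plus; [exact Hf|]. apply Ccont_mult; [apply Ccont_const|exact Hg].
Qed.

Lemma pcont_pow (f : R -> C) (t : R) (n : nat) : pcont f t -> pcont (fun u => f u ^ n)%C t.
Proof.
  intros H. induction n as [|n IH]; [exact (pcont_const 1 t)|].
  exact (pcont_mult _ _ _ H IH).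
Qed.

Lemma pcont_continuous (g : R -> C) (t : R) :
  pcont g t -> continuous (fun u => Re (g u)) t /\ continuous (fun u => Im (g u)) t.
Proof.
  rewrite pcont_iff. intros H.
  split; apply continuous_eps_delta; intros eps He; destruct (H eps He) as [d [D Hd]]; exists d;
    split; auto; intros u Hu; (eapply Rle_lt_trans; [|exact (Hd u Hu)]).
  - replace (Re (g u) - Re (g t)) with (Re (g u - g t)) by (unfold Re; simpl; ring). apply re_le_Cmod.
  - replace (Im (g u) - Im (g t)) with (Im (g u - g t)) by (unfold Im; simpl; ring). apply im_le_Cmod.
Qed.

Definition pder (g : R -> C) (t : R) (d : C) : Prop :=
  exists phi, pcont phi t /\ phi t = d /\ forall u, g u = (g t + phi u * RtoC (u - t))%C.

Lemma pder_is_derive (g : R -> C) (t : R) (d : C) :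
  pder g t d -> is_derive (fun u => Re (g u)) t (Re d) /\ is_derive (fun u => Im (g u)) t (Im d).
Proof.
  intros [phi [Hc [E H]]]. rewrite pcont_iff in Hc.
  split; apply is_derive_Reals; intros eps He; destruct (Hc eps He) as [del [D Hd]];
    exists (mkposreal del D); intros h Hh Hl; simpl in Hl;
    (assert (Hl' : Rabs (t + h - t) < del) by (replace (t + h - t) with h by ring; exact Hl));
    specialize (Hd _ Hl'); rewrite (H (t + h)); (eapply Rle_lt_trans; [|exact Hd]); rewrite <- E.
  - replace ((Re (g t + phi (t + h) * RtoC (t + h - t)) - Re (g t)) / h - Re (phi t))
      with (Re (phi (t + h) - phi t)) by (unfold Re, Im; simpl; field; auto). apply re_le_Cmod.
  - replace ((Im (g t + phi (t + h) * RtoC (t + h - t)) - Im (g t)) / h - Im (phi t))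
      with (Im (phi (t + h) - phi t)) by (unfold Re, Im; simpl; field; auto). apply im_le_Cmod.
Qed.

Lemma is_derive_pder (g : R -> C) (t : R) (d : C) :
  is_derive (fun u => Re (g u)) t (Re d) -> is_derive (fun u => Im (g u)) t (Im d) -> pder g t d.
Proof.
  intros H1 H2. apply is_derive_Reals in H1. apply is_derive_Reals in H2.
  exists (fun u => if Req_dec_T u t then d else ((g u - g t) / RtoC (u - t))%C).
  split; [|split].
  - apply pcont_iff. intros eps He.
    destruct (H1 (eps / 2)) as [d1 D1]; [lra|]. destruct (H2 (eps / 2)) as [d2 D2]; [lra|].
    exists (Rmin d1 d2). split; [apply Rmin_pos; apply cond_pos|]. intros u Hu.
    pose proof (Rmin_l d1 d2). pose proof (Rmin_r d1 d2).
    destruct (Req_dec_T t t) as [_|N]; [|tauto].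
    destruct (Req_dec_T u t) as [->|N].
    + replace (d - d)%C with (RtoC 0) by (simpl; ring). rewrite Cmod_0. auto.
    + assert (Nz : u - t <> 0) by lra.
      specialize (D1 (u - t) Nz ltac:(lra)). specialize (D2 (u - t) Nz ltac:(lra)).
      replace (t + (u - t)) with u in D1, D2 by ring.
      eapply Rle_lt_trans; [apply Cmod_le_Re_Im|].
      replace (Re ((g u - g t) / RtoC (u - t) - d)) with ((Re (g u) - Re (g t)) / (u - t) - Re d)
        by (unfold Re, Im; simpl; field; auto).
      replace (Im ((g u - g t) / RtoC (u - t) - d)) with ((Im (g u) - Im (g t)) / (u - t) - Im d)
        by (unfold Re, Im; simpl; field; auto). lra.
  - destruct (Req_dec_T t t); tauto.
  - intros u. destruct (Req_dec_T u t) as [->|N].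
    + replace (t - t) with 0 by ring. ring.
    + field. intros E. apply RtoC_inj in E. lra.
Qed.

Lemma pder_comp (F : C -> C) (g : R -> C) (t : R) (l d : C) :
  Cder F (g t) l -> pder g t d -> pder (fun u => F (g u)) t (l * d)%C.
Proof.
  intros [phi [Cp [Ep Hp]]] [psi [Cq [Eq Hq]]].
  exists (fun u => phi (g u) * psi u)%C. split; [|split].
  - apply pcont_mult; auto. apply pcont_comp; auto.
    apply (Ccont_ext_loc (fun z => (g t + psi (Re z) * RtoC (Re z - t)))%C _ _ 1); [lra| |].
    + intros u _. symmetry. apply Hq.
    + apply Ccont_plus; [apply Ccont_const|]. apply Ccont_mult; [exact Cq|].
      intros eps He. exists eps. split; auto. intros u Hu. rewrite <- RtoC_minus, Cmod_R.
      replace (Re u - t - (Re (RtoC t) - t)) with (Re (u - RtoC t)) by (unfold Re; simpl; ring).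
      eapply Rle_lt_trans; [apply re_le_Cmod|exact Hu].
  - rewrite Ep, Eq. auto.
  - intros u. rewrite (Hp (g u)). rewrite (Hq u) at 2. ring.
Qed.

Lemma pder_pcont (g : R -> C) (t : R) (d : C) : pder g t d -> pcont g t.
Proof.
  intros [psi [Cq [Eq Hq]]].
  apply (Ccont_ext_loc (fun z => (g t + psi (Re z) * RtoC (Re z - t)))%C _ _ 1); [lra| |].
  - intros u _. symmetry. apply Hq.
  - apply Ccont_plus; [apply Ccont_const|]. apply Ccont_mult; [exact Cq|].
    intros eps He. exists eps. split; auto. intros u Hu. rewrite <- RtoC_minus, Cmod_R.
    replace (Re u - t - (Re (RtoC t) - t)) with (Re (u - RtoC t)) by (unfold Re; simpl; ring).
    eapply Rle_lt_trans; [apply re_le_Cmod|exact Hu].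
Qed.

Definition Cint (g : R -> C) (a b : R) : C :=
  (RInt (fun t => Re (g t)) a b, RInt (fun t => Im (g t)) a b).

Definition pcont_on (g : R -> C) (a b : R) : Prop :=
  forall t, Rmin a b <= t <= Rmax a b -> pcont g t.

Lemma pcont_on_ex (g : R -> C) (a b : R) : pcont_on g a b ->
  ex_RInt (fun t => Re (g t)) a b /\ ex_RInt (fun t => Im (g t)) a b.
Proof.
  intros H. split; apply (@ex_RInt_continuous R_CompleteNormedModule); intros t Ht;
    apply (pcont_continuous g t (H t Ht)).
Qed.

Lemma Cint_plus (f g : R -> C) (a b : R) : pcont_on f a b -> pcont_on g a b ->
  Cint (fun t => f t + g t)%C a b = (Cint f a b + Cint g a b)%C.
Proof.
  intros Hf Hg. destruct (pcont_on_ex _ _ _ Hf). destruct (pcont_on_ex _ _ _ Hg).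
  unfold Cint, Cplus. simpl. f_equal; rewrite <- (@RInt_plus R_CompleteNormedModule); auto.
Qed.

Lemma Cint_scal (c : C) (g : R -> C) (a b : R) : pcont_on g a b ->
  Cint (fun t => c * g t)%C a b = (c * Cint g a b)%C.
Proof.
  intros Hg. destruct (pcont_on_ex _ _ _ Hg) as [H1 H2].
  assert (K : forall k h, ex_RInt h a b -> is_RInt (fun t => k * h t) a b (k * RInt h a b)).
  { intros k h Hh. exact (is_RInt_scal h a b k _ (RInt_correct (V:=R_CompleteNormedModule) h a b Hh)). }
  unfold Cint, Cmult. simpl. f_equal; apply is_RInt_unique.
  - exact (is_RInt_minus _ _ _ _ _ _ (K (fst c) _ H1) (K (snd c) _ H2)).
  - exact (is_RInt_plus _ _ _ _ _ _ (K (fst c) _ H2) (K (snd c) _ H1)).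
Qed.

Lemma Cint_ext (f g : R -> C) (a b : R) :
  (forall t, Rmin a b <= t <= Rmax a b -> f t = g t) -> Cint f a b = Cint g a b.
Proof.
  intros H. unfold Cint. f_equal; apply RInt_ext; intros t Ht; rewrite H; auto; lra.
Qed.

Lemma Cint_minus (f g : R -> C) (a b : R) : pcont_on f a b -> pcont_on g a b ->
  Cint (fun t => f t - g t)%C a b = (Cint f a b - Cint g a b)%C.
Proof.
  intros Hf Hg. rewrite (Cint_ext _ (fun t => f t + -(1) * g t)%C) by (intros; ring).
  rewrite Cint_plus, Cint_scal; auto; [ring|].
  intros t Ht. apply pcont_mult; auto using pcont_const.
Qed.

Lemma Cint_Chasles (f : R -> C) (a b c : R) : pcont_on f a b -> pcont_on f b c ->
  (Cint f a b + Cint f b c)%C = Cint f a c.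
Proof.
  intros Hf Hg. destruct (pcont_on_ex _ _ _ Hf). destruct (pcont_on_ex _ _ _ Hg).
  unfold Cint, Cplus. simpl. f_equal; apply (@RInt_Chasles R_CompleteNormedModule); auto.
Qed.

Lemma Cint_point (f : R -> C) (a : R) : Cint f a a = 0%C.
Proof. unfold Cint. rewrite !RInt_point. reflexivity. Qed.

Lemma Cint_swap (f : R -> C) (a b : R) : pcont_on f a b -> Cint f b a = (- Cint f a b)%C.
Proof.
  intros Hf. assert (K : pcont_on f b a) by (intros t Ht; apply Hf; rewrite Rmin_comm, Rmax_comm; auto).
  pose proof (Cint_Chasles f a b a Hf K) as E. rewrite Cint_point in E.
  replace (Cint f b a) with (Cint f a b + Cint f b a - Cint f a b)%C by ring. rewrite E. ring.
Qed.

(** The factor 2 comes from bounding the real and the imaginary part separately. *)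
Lemma Cint_bound (f : R -> C) (a b M : R) : pcont_on f a b ->
  (forall t, Rmin a b <= t <= Rmax a b -> Cmod (f t) <= M) -> Cmod (Cint f a b) <= 2 * M * Rabs (b - a).
Proof.
  assert (K : forall a b, a <= b -> pcont_on f a b ->
    (forall t, Rmin a b <= t <= Rmax a b -> Cmod (f t) <= M) -> Cmod (Cint f a b) <= 2 * M * Rabs (b - a)).
  { clear a b. intros a b Hab Hf HM. destruct (pcont_on_ex _ _ _ Hf) as [H1 H2].
    rewrite Rmin_left, Rmax_right in HM by auto. rewrite Rabs_pos_eq by lra.
    eapply Rle_trans; [apply Cmod_le_Re_Im|]. unfold Cint. simpl.
    assert (Rabs (RInt (fun t => Re (f t)) a b) <= (b - a) * M).
    { apply abs_RInt_le_const; auto. intros t Ht. eapply Rle_trans; [apply re_le_Cmod|auto]. }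
    assert (Rabs (RInt (fun t => Im (f t)) a b) <= (b - a) * M).
    { apply abs_RInt_le_const; auto. intros t Ht. eapply Rle_trans; [apply im_le_Cmod|auto]. }
    lra. }
  intros Hf HM. destruct (Rle_dec a b) as [H|H]; [auto|].
  rewrite (Rabs_minus_sym b a).
  assert (Hf' : pcont_on f b a) by (intros t Ht; apply Hf; rewrite Rmin_comm, Rmax_comm; auto).
  rewrite Cint_swap, Cmod_opp by auto.
  apply K; auto; try lra. intros t Ht. apply HM. rewrite Rmin_comm, Rmax_comm; auto.
Qed.

Lemma Cint_derive (G g : R -> C) (a b : R) :
  (forall t, Rmin a b <= t <= Rmax a b -> pder G t (g t)) -> pcont_on g a b ->
  Cint g a b = (G b - G a)%C.
Proof.
  intros HG Hg.
  assert (E1 : is_RInt (fun t => Re (g t)) a b (Re (G b) - Re (G a))).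
  { apply (is_RInt_derive (V:=R_CompleteNormedModule) (fun t => Re (G t))); intros t Ht.
    - apply (pder_is_derive _ _ _ (HG t Ht)).
    - apply (pcont_continuous _ _ (Hg t Ht)). }
  assert (E2 : is_RInt (fun t => Im (g t)) a b (Im (G b) - Im (G a))).
  { apply (is_RInt_derive (V:=R_CompleteNormedModule) (fun t => Im (G t))); intros t Ht.
    - apply (pder_is_derive _ _ _ (HG t Ht)).
    - apply (pcont_continuous _ _ (Hg t Ht)). }
  unfold Cint. rewrite (is_RInt_unique _ _ _ _ E1), (is_RInt_unique _ _ _ _ E2).
  unfold Cminus, Cplus, Copp, Re, Im. simpl. reflexivity.
Qed.

Lemma pder_hor (y t : R) : pder (fun u => (u, y)) t 1%C.
Proof.
  exists (fun _ => 1%C). split; [apply pcont_const|]. split; auto.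
  intros u. unfold Cplus, Cmult, RtoC. simpl. f_equal; ring.
Qed.

Lemma pder_ver (x t : R) : pder (fun u => (x, u)) t Ci.
Proof.
  exists (fun _ => Ci). split; [apply pcont_const|]. split; auto.
  intros u. unfold Cplus, Cmult, RtoC, Ci. simpl. f_equal; ring.
Qed.

(** The integral of f(z) dz along the boundary, counterclockwise from the lower left corner; on the
    vertical sides dz = i dt. *)
Definition rectI (f : C -> C) (x1 x2 y1 y2 : R) : C :=
  (Cint (fun t => f (t, y1)) x1 x2 + Ci * Cint (fun t => f (x2, t)) y1 y2
   - Cint (fun t => f (t, y2)) x1 x2 - Ci * Cint (fun t => f (x1, t)) y1 y2)%C.

Definition in_rect (x1 x2 y1 y2 : R) (z : C) : Prop := x1 <= Re z <= x2 /\ y1 <= Im z <= y2.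

Lemma hor_pcont_on (f : C -> C) (x1 x2 y : R) : x1 <= x2 ->
  (forall t, x1 <= t <= x2 -> Ccont f (t, y)) -> pcont_on (fun t => f (t, y)) x1 x2.
Proof.
  intros Hx H t Ht. rewrite Rmin_left, Rmax_right in Ht by auto.
  apply (pcont_comp f (fun t => (t, y))); [eapply pder_pcont, pder_hor|auto].
Qed.

Lemma ver_pcont_on (f : C -> C) (x y1 y2 : R) : y1 <= y2 ->
  (forall t, y1 <= t <= y2 -> Ccont f (x, t)) -> pcont_on (fun t => f (x, t)) y1 y2.
Proof.
  intros Hx H t Ht. rewrite Rmin_left, Rmax_right in Ht by auto.
  apply (pcont_comp f (fun t => (x, t))); [eapply pder_pcont, pder_ver|auto].
Qed.

Ltac rect_cont :=
  solve [ first [apply hor_pcont_on | apply ver_pcont_on]; [lra|];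
          let t := fresh in let H := fresh in intros t H;
          match goal with Hf : forall z, in_rect _ _ _ _ z -> Ccont _ z |- _ =>
            apply Hf; unfold in_rect; simpl; lra end ].

Lemma rectI_split_x (f : C -> C) (x1 m x2 y1 y2 : R) :
  x1 <= m <= x2 -> y1 <= y2 -> (forall z, in_rect x1 x2 y1 y2 z -> Ccont f z) ->
  rectI f x1 x2 y1 y2 = (rectI f x1 m y1 y2 + rectI f m x2 y1 y2)%C.
Proof.
  intros Hm Hy Hf. unfold rectI.
  rewrite <- (Cint_Chasles (fun t => f (t, y1)) x1 m x2) by rect_cont.
  rewrite <- (Cint_Chasles (fun t => f (t, y2)) x1 m x2) by rect_cont. ring.
Qed.

Lemma rectI_split_y (f : C -> C) (x1 x2 y1 m y2 : R) :
  x1 <= x2 -> y1 <= m <= y2 -> (forall z, in_rect x1 x2 y1 y2 z -> Ccont f z) ->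
  rectI f x1 x2 y1 y2 = (rectI f x1 x2 y1 m + rectI f x1 x2 m y2)%C.
Proof.
  intros Hm Hy Hf. unfold rectI.
  rewrite <- (Cint_Chasles (fun t => f (x1, t)) y1 m y2) by rect_cont.
  rewrite <- (Cint_Chasles (fun t => f (x2, t)) y1 m y2) by rect_cont. ring.
Qed.

Lemma rectI_bound (f : C -> C) (x1 x2 y1 y2 M : R) :
  x1 <= x2 -> y1 <= y2 -> (forall z, in_rect x1 x2 y1 y2 z -> Ccont f z) ->
  (forall z, in_rect x1 x2 y1 y2 z -> Cmod (f z) <= M) ->
  Cmod (rectI f x1 x2 y1 y2) <= 4 * M * ((x2 - x1) + (y2 - y1)).
Proof.
  intros Hx Hy Hf HM. unfold rectI.
  assert (A : forall y, y1 <= y <= y2 -> Cmod (Cint (fun t => f (t, y)) x1 x2) <= 2 * M * (x2 - x1)).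
  { intros y H. rewrite <- (Rabs_pos_eq (x2 - x1)) by lra. apply Cint_bound; [rect_cont|].
    intros t Ht. rewrite Rmin_left, Rmax_right in Ht by auto. apply HM. unfold in_rect; simpl; lra. }
  assert (B : forall x, x1 <= x <= x2 -> Cmod (Ci * Cint (fun t => f (x, t)) y1 y2) <= 2 * M * (y2 - y1)).
  { intros x H. rewrite Cmod_mult, Cmod_Ci, Rmult_1_l.
    rewrite <- (Rabs_pos_eq (y2 - y1)) by lra. apply Cint_bound; [rect_cont|].
    intros t Ht. rewrite Rmin_left, Rmax_right in Ht by auto. apply HM. unfold in_rect; simpl; lra. }
  pose proof (A y1 ltac:(lra)). pose proof (A y2 ltac:(lra)).
  pose proof (B x1 ltac:(lra)). pose proof (B x2 ltac:(lra)).
  eapply Rle_trans; [apply Cmod_triangle_minus|].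
  eapply Rle_trans; [apply Rplus_le_compat_r, Cmod_triangle_minus|].
  eapply Rle_trans; [apply Rplus_le_compat_r, Rplus_le_compat_r, Cmod_triangle|]. lra.
Qed.

(** Each side contributes a difference of corner values of [F], and these cancel around the
    boundary. *)
Lemma rectI_primitive (F f : C -> C) (x1 x2 y1 y2 : R) :
  x1 <= x2 -> y1 <= y2 -> (forall z, in_rect x1 x2 y1 y2 z -> Ccont f z) ->
  (forall z, in_rect x1 x2 y1 y2 z -> Cder F z (f z)) ->
  rectI f x1 x2 y1 y2 = 0%C.
Proof.
  intros Hx Hy Hf HF. unfold rectI.
  assert (A : forall y, y1 <= y <= y2 -> Cint (fun t => f (t, y)) x1 x2 = (F (x2, y) - F (x1, y))%C).
  { intros y H. apply (Cint_derive (fun t => F (t, y))); [|rect_cont].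
    intros t Ht. rewrite Rmin_left, Rmax_right in Ht by auto.
    replace (f (t, y)) with (f (t, y) * 1)%C by ring.
    apply (pder_comp F (fun u => (u, y))); [|apply pder_hor]. apply HF. unfold in_rect; simpl; lra. }
  assert (B : forall x, x1 <= x <= x2 -> (Ci * Cint (fun t => f (x, t)) y1 y2 = F (x, y2) - F (x, y1))%C).
  { intros x H. rewrite <- Cint_scal by rect_cont. apply (Cint_derive (fun t => F (x, t))).
    - intros t Ht. rewrite Rmin_left, Rmax_right in Ht by auto.
      replace (Ci * f (x, t))%C with (f (x, t) * Ci)%C by ring.
      apply (pder_comp F (fun u => (x, u))); [|apply pder_ver]. apply HF. unfold in_rect; simpl; lra.
    - intros t Ht. apply pcont_mult; [apply pcont_const|]. revert t Ht.
      change (pcont_on (fun t => f (x, t)) y1 y2). rect_cont. }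
  rewrite !A, !B by lra. ring.
Qed.

Lemma rectI_minus (f g : C -> C) (x1 x2 y1 y2 : R) :
  x1 <= x2 -> y1 <= y2 -> (forall z, in_rect x1 x2 y1 y2 z -> Ccont f z) ->
  (forall z, in_rect x1 x2 y1 y2 z -> Ccont g z) ->
  rectI (fun z => f z - g z)%C x1 x2 y1 y2 = (rectI f x1 x2 y1 y2 - rectI g x1 x2 y1 y2)%C.
Proof.
  intros Hx Hy Hf Hg. unfold rectI.
  rewrite !Cint_minus by (first [rect_cont | clear Hf; rect_cont | clear Hg; rect_cont]). ring.
Qed.

(** * Goursat's lemma *)

Lemma nested_point (X1 X2 : nat -> R) :
  (forall n, X1 n <= X1 (S n) /\ X2 (S n) <= X2 n /\ X1 n <= X2 n) ->
  exists p, forall n, X1 n <= p <= X2 n.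
Proof.
  intros H.
  assert (M1 : forall n k, X1 n <= X1 (n + k)%nat).
  { intros n k. induction k as [|k IH]; [rewrite Nat.add_0_r; lra|].
    rewrite Nat.add_succ_r. pose proof (H (n + k)%nat). lra. }
  assert (M2 : forall n k, X2 (n + k)%nat <= X2 n).
  { intros n k. induction k as [|k IH]; [rewrite Nat.add_0_r; lra|].
    rewrite Nat.add_succ_r. pose proof (H (n + k)%nat). lra. }
  assert (M : forall n k, X1 n <= X2 k).
  { intros n k. pose proof (M1 n k). pose proof (M2 k n). rewrite Nat.add_comm in H1.
    pose proof (H (n + k)%nat). lra. }
  destruct (completeness (fun x => exists n, x = X1 n)) as [p [Hu Hl]].
  - exists (X2 0%nat). intros x [n ->]. apply M.
  - exists (X1 0%nat), 0%nat. reflexivity.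
  - exists p. intros n. split; [apply Hu; eauto|].
    apply Hl. intros x [k ->]. apply M.
Qed.

Definition halve (b : bool) (I : R * R) : R * R :=
  if b then (fst I, (fst I + snd I) / 2) else ((fst I + snd I) / 2, snd I).

Definition rectP (f : C -> C) (q : (R * R) * (R * R)) : R :=
  Cmod (rectI f (fst (fst q)) (snd (fst q)) (fst (snd q)) (snd (snd q))).

Definition quarter (b c : bool) (q : (R * R) * (R * R)) := (halve b (fst q), halve c (snd q)).

(** The last quarter is taken without a test: by the triangle inequality the four integrals cannot
    all be smaller than a fourth of the whole. *)
Definition worst_quarter (f : C -> C) (q : (R * R) * (R * R)) :=
  if Rle_dec (rectP f q) (4 * rectP f (quarter true true q)) then quarter true true q else
  if Rle_dec (rectP f q) (4 * rectP f (quarter true false q)) then quarter true false q else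
  if Rle_dec (rectP f q) (4 * rectP f (quarter false true q)) then quarter false true q else
  quarter false false q.

Definition in_rectq (q : (R * R) * (R * R)) (z : C) : Prop :=
  in_rect (fst (fst q)) (snd (fst q)) (fst (snd q)) (snd (snd q)) z.

Definition okq (q : (R * R) * (R * R)) : Prop := fst (fst q) <= snd (fst q) /\ fst (snd q) <= snd (snd q).

Lemma worst_quarter_form (f : C -> C) q : exists b c, worst_quarter f q = quarter b c q.
Proof. unfold worst_quarter. repeat (destruct (Rle_dec _ _); [eauto|]). eauto. Qed.

Lemma worst_quarter_le (f : C -> C) q : okq q -> (forall z, in_rectq q z -> Ccont f z) ->
  rectP f q <= 4 * rectP f (worst_quarter f q).
Proof.
  intros [Hx Hy] Hf. unfold worst_quarter. repeat (destruct (Rle_dec _ _); [assumption|]).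
  destruct q as [[x1 x2] [y1 y2]]. simpl in *.
  assert (E : rectI f x1 x2 y1 y2 =
    (rectI f x1 ((x1+x2)/2) y1 ((y1+y2)/2) + rectI f x1 ((x1+x2)/2) ((y1+y2)/2) y2
     + (rectI f ((x1+x2)/2) x2 y1 ((y1+y2)/2) + rectI f ((x1+x2)/2) x2 ((y1+y2)/2) y2))%C).
  { rewrite (rectI_split_x f x1 ((x1+x2)/2) x2) by (auto; lra).
    rewrite (rectI_split_y f x1 ((x1+x2)/2) y1 ((y1+y2)/2) y2);
    [rewrite (rectI_split_y f ((x1+x2)/2) x2 y1 ((y1+y2)/2) y2); [reflexivity|lra|lra|]|lra|lra|];
    intros z Hz; apply Hf; unfold in_rectq, in_rect in *; simpl; lra. }
  unfold rectP in *. simpl in *. rewrite E in *.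
  match goal with |- Cmod (?a + ?b + (?c + ?d)) <= _ =>
    pose proof (Cmod_triangle (a + b) (c + d)); pose proof (Cmod_triangle a b); pose proof (Cmod_triangle c d) end.
  lra.
Qed.

Fixpoint bisect (f : C -> C) q (n : nat) :=
  match n with O => q | S n => worst_quarter f (bisect f q n) end.

Lemma bisect_facts (f : C -> C) q : okq q -> forall n,
  okq (bisect f q n) /\
  fst (fst (bisect f q n)) <= fst (fst (bisect f q (S n))) /\
  snd (fst (bisect f q (S n))) <= snd (fst (bisect f q n)) /\
  fst (snd (bisect f q n)) <= fst (snd (bisect f q (S n))) /\
  snd (snd (bisect f q (S n))) <= snd (snd (bisect f q n)) /\
  snd (fst (bisect f q n)) - fst (fst (bisect f q n)) = (snd (fst q) - fst (fst q)) / 2 ^ n /\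
  snd (snd (bisect f q n)) - fst (snd (bisect f q n)) = (snd (snd q) - fst (snd q)) / 2 ^ n.
Proof.
  intros Hq n.
  assert (P2 : forall k, 2 ^ k <> 0) by (intros; apply pow_nonzero; lra).
  assert (A : okq (bisect f q n) /\
    snd (fst (bisect f q n)) - fst (fst (bisect f q n)) = (snd (fst q) - fst (fst q)) / 2 ^ n /\
    snd (snd (bisect f q n)) - fst (snd (bisect f q n)) = (snd (snd q) - fst (snd q)) / 2 ^ n).
  { induction n as [|n [[IH1 IH2] [IH3 IH4]]]; [simpl; split; [auto|split; field]|].
    change (bisect f q (S n)) with (worst_quarter f (bisect f q n)).
    destruct (worst_quarter_form f (bisect f q n)) as [b [c ->]].
    unfold quarter, halve, okq. simpl.
    replace ((snd (fst q) - fst (fst q)) / (2 * 2 ^ n)) with ((snd (fst q) - fst (fst q)) / 2 ^ n / 2) by (field; auto).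
    replace ((snd (snd q) - fst (snd q)) / (2 * 2 ^ n)) with ((snd (snd q) - fst (snd q)) / 2 ^ n / 2) by (field; auto).
    rewrite <- IH3, <- IH4.
    destruct b, c; simpl; repeat split; lra. }
  destruct A as [[A0 A0'] [A1 A2]]. split; [split; auto|].
  change (bisect f q (S n)) with (worst_quarter f (bisect f q n)).
  destruct (worst_quarter_form f (bisect f q n)) as [b [c ->]].
  unfold quarter, halve. destruct b, c; simpl; repeat split; auto; lra.
Qed.

Lemma bisect_in (f : C -> C) q : okq q -> forall n z, in_rectq (bisect f q n) z -> in_rectq q z.
Proof.
  intros Hq n. induction n as [|n IH]; auto. intros z Hz. apply IH.
  pose proof (bisect_facts f q Hq n). unfold in_rectq, in_rect in *. lra.
Qed.

Lemma bisect_le (f : C -> C) q : okq q -> (forall z, in_rectq q z -> Ccont f z) ->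
  forall n, rectP f q <= 4 ^ n * rectP f (bisect f q n).
Proof.
  intros Hq Hf n. induction n as [|n IH]; [simpl; lra|].
  eapply Rle_trans; [exact IH|].
  assert (rectP f (bisect f q n) <= 4 * rectP f (bisect f q (S n))).
  { apply worst_quarter_le; [apply (bisect_facts f q Hq n)|].
    intros z Hz. apply Hf. eapply bisect_in; eauto. }
  simpl (4 ^ S n). pose proof (pow_lt 4 n). nra.
Qed.

Lemma Cder_affine_primitive (c l p z : C) :
  Cder (fun u => c * u + l / 2 * ((u - p) * (u - p)))%C z (c + l * (z - p))%C.
Proof.
  assert (D : Cder (fun u => u - p)%C z 1%C).
  { replace (RtoC 1) with (1 - 0)%C by ring. apply Cder_minus; [apply Cder_id|apply Cder_const]. }
  pose proof (Cder_mult _ _ _ _ _ (Cder_const c z) (Cder_id z)) as A.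
  pose proof (Cder_mult _ _ _ _ _ (Cder_const (l / 2)%C z) (Cder_mult _ _ _ _ _ D D)) as B.
  pose proof (Cder_plus _ _ _ _ _ A B) as E. simpl in E.
  replace (c + l * (z - p))%C with (0 * z + c * 1 + (0 * ((z - p) * (z - p)) + l / 2 * (1 * (z - p) + (z - p) * 1)))%C.
  - exact E.
  - field.
Qed.

(** Near the common point [p] of the bisected rectangles, the affine part of [f] has a primitive and
    integrates to zero. The rest is at most eps times the distance to [p], so at stage n the
    integral is O(eps (L / 2^n)^2); the square absorbs the factor 4^n lost by the bisection. *)
Lemma goursat (f : C -> C) (x1 x2 y1 y2 : R) :
  x1 <= x2 -> y1 <= y2 -> (forall z, in_rect x1 x2 y1 y2 z -> Cdiff f z) ->
  rectI f x1 x2 y1 y2 = 0%C.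
Proof.
  intros Hx Hy Hd. set (q := ((x1, x2), (y1, y2))).
  assert (Hq : okq q) by (split; auto).
  assert (Hc : forall z, in_rectq q z -> Ccont f z) by (intros; apply Cdiff_cont, Hd; auto).
  destruct (nested_point (fun n => fst (fst (bisect f q n))) (fun n => snd (fst (bisect f q n)))) as [px Hpx].
  { intros n. pose proof (bisect_facts f q Hq n) as H. unfold okq in H. repeat split; lra. }
  destruct (nested_point (fun n => fst (snd (bisect f q n))) (fun n => snd (snd (bisect f q n)))) as [py Hpy].
  { intros n. pose proof (bisect_facts f q Hq n) as H. unfold okq in H. repeat split; lra. }
  set (p := (px, py) : C).
  destruct (Hd p) as [l Hl]. { pose proof (Hpx 0%nat); pose proof (Hpy 0%nat); unfold in_rect; simpl in *; lra. }
  set (L := (x2 - x1) + (y2 - y1)). assert (HL : 0 <= L) by (unfold L; lra).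
  cut (rectP f q <= 0).
  { intros H. apply Cmod_eq_0. apply Rle_antisym; [exact H|apply Cmod_ge_0]. }
  apply Rnot_lt_le. intros Hpos.
  assert (K : forall eps, 0 < eps -> rectP f q <= 4 * eps * L * L).
  { intros eps He. destruct (proj1 (Cder_bound f p l) Hl eps He) as [d [D HD]].
    assert (exists n, L / 2 ^ n < d) as [n Hn].
    { destruct (Pow_x_infinity 2 ltac:(rewrite Rabs_pos_eq; lra) (L / d + 1)) as [n Hn].
      exists n. specialize (Hn n (Nat.le_refl n)). pose proof (pow_lt 2 n ltac:(lra)) as P.
      rewrite Rabs_pos_eq in Hn by lra. apply Rmult_lt_reg_r with (2 ^ n); auto.
      unfold Rdiv. rewrite Rmult_assoc, Rinv_l, Rmult_1_r by lra.
      replace L with (d * (L / d)) by (field; lra). apply Rmult_lt_compat_l; lra. }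
    pose proof (pow_lt 2 n ltac:(lra)) as P.
    eapply Rle_trans; [apply (bisect_le f q Hq Hc n)|].
    destruct (bisect_facts f q Hq n) as [[O1 O2] [_ [_ [_ [_ [W1 W2]]]]]].
    unfold q in W1, W2. simpl in W1, W2. fold q in W1, W2.
    assert (HB : forall z, in_rectq (bisect f q n) z -> Cmod (z - p) <= L / 2 ^ n).
    { intros z [Z1 Z2]. eapply Rle_trans; [apply Cmod_le_Re_Im|].
      pose proof (Hpx n) as A1. pose proof (Hpy n) as A2. simpl in A1, A2.
      replace (Re (z - p)) with (Re z - px) by (unfold Re; simpl; ring).
      replace (Im (z - p)) with (Im z - py) by (unfold Im; simpl; ring).
      replace (L / 2 ^ n) with ((x2 - x1) / 2 ^ n + (y2 - y1) / 2 ^ n) by (unfold L; field; lra).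
      apply Rplus_le_compat; apply Rabs_le; lra. }
    assert (HcB : forall z, in_rectq (bisect f q n) z -> Ccont f z)
      by (intros z Hz; apply Hc; eapply bisect_in; eauto).
    assert (HcA : forall z, Ccont (fun u => f p + l * (u - p))%C z).
    { intros z. apply Cdiff_cont. apply Cdiff_plus; [apply Cdiff_const|].
      apply Cdiff_mult; [apply Cdiff_const|]. apply Cdiff_minus; [apply Cdiff_id|apply Cdiff_const]. }
    assert (E : rectP f (bisect f q n) <= 4 * (eps * (L / 2 ^ n)) * (L / 2 ^ n)).
    { unfold rectP. set (b := bisect f q n) in *.
      pose proof (rectI_minus f (fun u => f p + l * (u - p))%C _ _ _ _ O1 O2 HcB (fun z _ => HcA z)) as E.
      rewrite (rectI_primitive (fun u => f p * u + l / 2 * ((u - p) * (u - p)))%C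
        (fun u => f p + l * (u - p))%C) in E; auto; [|intros z _; apply Cder_affine_primitive].
      assert (E' : forall a : C, (a - 0)%C = a) by (intros; ring). rewrite E' in E.
      rewrite <- E.
      replace (L / 2 ^ n) with ((snd (fst b) - fst (fst b)) + (snd (snd b) - fst (snd b))) at 2
        by (rewrite W1, W2; unfold L; field; lra).
      apply rectI_bound; auto.
      - intros z Hz. apply (Ccont_ext_loc (fun u => f u + -(1) * (f p + l * (u - p)))%C _ _ 1); [lra| |].
        + intros u _; ring.
        + apply Ccont_plus; [apply HcB; exact Hz|]. apply Ccont_mult; [apply Ccont_const|apply HcA].
      - intros z Hz. specialize (HB z Hz).
        replace (f z - (f p + l * (z - p)))%C with (f z - f p - l * (z - p))%C by ring.
        eapply Rle_trans; [apply HD; lra|]. apply Rmult_le_compat_l; lra. }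
    eapply Rle_trans; [apply Rmult_le_compat_l; [|exact E]; apply pow_le; lra|].
    replace (4 ^ n) with (2 ^ n * 2 ^ n) by (rewrite <- Rpow_mult_distr; f_equal; ring).
    right. field. lra. }
  (* With this eps, 4 eps L^2 is less than half of the supposedly positive integral; the summand 1
     covers L = 0. *)
  assert (H1 : 0 < rectP f q / (8 * (L * L + 1))) by (apply Rdiv_lt_0_compat; nra).
  specialize (K _ H1).
  assert (4 * (rectP f q / (8 * (L * L + 1))) * L * L < rectP f q); [|lra].
  replace (4 * (rectP f q / (8 * (L * L + 1))) * L * L) with (rectP f q * (L * L / (2 * (L * L + 1)))) by (field; nra).
  assert (L * L / (2 * (L * L + 1)) < 1).
  { apply Rmult_lt_reg_r with (2 * (L * L + 1)); [nra|]. unfold Rdiv.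
    rewrite Rmult_assoc, Rinv_l by nra. nra. }
  nra.
Qed.

Lemma rectI_degenerate_x (f : C -> C) (x y1 y2 : R) : rectI f x x y1 y2 = 0%C.
Proof. unfold rectI. rewrite !Cint_point. ring. Qed.

Lemma rectI_degenerate_y (f : C -> C) (x1 x2 y : R) : rectI f x1 x2 y y = 0%C.
Proof. unfold rectI. rewrite !Cint_point. ring. Qed.

(** Used to cut off the small square around the exceptional point by the rectangle, so that
    positions of this point near the boundary or outside need no separate treatment. *)
Definition clamp (a b x : R) : R := Rmax a (Rmin b x).

Lemma clamp_spec (a b x : R) : a <= b -> a <= clamp a b x <= b /\
  (x <= a -> clamp a b x = a) /\ (b <= x -> clamp a b x = b) /\ (a <= x <= b -> clamp a b x = x).
Proof.
  intros H. unfold clamp, Rmax, Rmin. repeat destruct (Rle_dec _ _); repeat split; intros; lra.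
Qed.

Lemma clamp_lip (a b x y eta : R) : x <= y <= x + eta ->
  clamp a b x <= clamp a b y <= clamp a b x + eta.
Proof.
  intros H. unfold clamp, Rmax, Rmin. repeat destruct (Rle_dec _ _); lra.
Qed.

(* Away from a small square around [p] Goursat applies, and the small square contributes O(eta). *)
Lemma goursat_except (f : C -> C) (p : C) (x1 x2 y1 y2 : R) :
  x1 <= x2 -> y1 <= y2 -> (forall z, in_rect x1 x2 y1 y2 z -> Ccont f z) -> Ccont f p ->
  (forall z, in_rect x1 x2 y1 y2 z -> z <> p -> Cdiff f z) ->
  rectI f x1 x2 y1 y2 = 0%C.
Proof.
  intros Hx Hy Hc Hp Hd.
  destruct (Hp 1 ltac:(lra)) as [d0 [D0 Hb]].
  apply Cmod_eq_0. apply Rle_antisym; [|apply Cmod_ge_0]. apply Rnot_lt_le. intros Hpos.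
  remember (Cmod (rectI f x1 x2 y1 y2)) as v eqn:Hv.
  set (M := 1 + Cmod (f p)). assert (HM : 1 <= M) by (unfold M; pose proof (Cmod_ge_0 (f p)); lra).
  (* The first bound keeps the square inside the ball where |f| <= M; the second makes its
     contribution, at most 16 M eta, no larger than v / 2. *)
  set (eta := Rmin (d0 / 8) (v / (32 * M))).
  assert (He : 0 < eta). { apply Rmin_pos; [lra|]. apply Rdiv_lt_0_compat; lra. }
  assert (He1 : eta <= d0 / 8) by apply Rmin_l.
  assert (He2 : 32 * M * eta <= v).
  { apply Rle_trans with (32 * M * (v / (32 * M))); [|right; field; lra].
    apply Rmult_le_compat_l; [lra|apply Rmin_r]. }
  assert (Hab := clamp_lip x1 x2 (Re p - eta) (Re p + eta) (2 * eta) ltac:(lra)).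
  assert (Hce := clamp_lip y1 y2 (Im p - eta) (Im p + eta) (2 * eta) ltac:(lra)).
  destruct (clamp_spec x1 x2 (Re p - eta) Hx) as [A1 [A2 [A3 A4]]].
  destruct (clamp_spec x1 x2 (Re p + eta) Hx) as [B1 [B2 [B3 B4]]].
  destruct (clamp_spec y1 y2 (Im p - eta) Hy) as [C1 [C2 [C3 C4]]].
  destruct (clamp_spec y1 y2 (Im p + eta) Hy) as [E1 [E2 [E3 E4]]].
  set (a := clamp x1 x2 (Re p - eta)) in *. set (b := clamp x1 x2 (Re p + eta)) in *.
  set (c := clamp y1 y2 (Im p - eta)) in *. set (e := clamp y1 y2 (Im p + eta)) in *.
  clearbody a b c e eta.
  assert (Z : forall u1 u2 v1 v2, x1 <= u1 <= u2 -> u2 <= x2 -> y1 <= v1 <= v2 -> v2 <= y2 ->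
     (forall z, in_rect u1 u2 v1 v2 z -> z <> p) -> rectI f u1 u2 v1 v2 = 0%C).
  { clear A2 A3 A4 B2 B3 B4 C2 C3 C4 E2 E3 E4. intros u1 u2 v1 v2 P1 P2 P3 P4 N. apply goursat; try lra. intros z Hz. apply Hd; auto.
    unfold in_rect in *. lra. }
  (* Each of the four strips around the square either is degenerate or does not contain [p]. *)
  assert (Za : rectI f x1 a y1 y2 = 0%C).
  { destruct (Rle_dec (Re p - eta) x1) as [H|H]; [rewrite A2 by auto; apply rectI_degenerate_x|].
    apply Z; try lra. intros z [Hz _] ->.
    destruct (Rle_dec x2 (Re p - eta)); [rewrite A3 in Hz by auto|rewrite A4 in Hz by lra]; lra. }
  assert (Zb : rectI f b x2 y1 y2 = 0%C).
  { destruct (Rle_dec x2 (Re p + eta)) as [H|H]; [rewrite B3 by auto; apply rectI_degenerate_x|].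
    apply Z; try lra. intros z [Hz _] ->.
    destruct (Rle_dec (Re p + eta) x1); [rewrite B2 in Hz by auto|rewrite B4 in Hz by lra]; lra. }
  assert (Zc : rectI f a b y1 c = 0%C).
  { destruct (Rle_dec (Im p - eta) y1) as [H|H]; [rewrite C2 by auto; apply rectI_degenerate_y|].
    apply Z; try lra. intros z [_ Hz] ->.
    destruct (Rle_dec y2 (Im p - eta)); [rewrite C3 in Hz by auto|rewrite C4 in Hz by lra]; lra. }
  assert (Ze : rectI f a b e y2 = 0%C).
  { destruct (Rle_dec y2 (Im p + eta)) as [H|H]; [rewrite E3 by auto; apply rectI_degenerate_y|].
    apply Z; try lra. intros z [_ Hz] ->.
    destruct (Rle_dec (Im p + eta) y1); [rewrite E2 in Hz by auto|rewrite E4 in Hz by lra]; lra. }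
  assert (E : rectI f x1 x2 y1 y2 = rectI f a b c e).
  { clear A2 A3 A4 B2 B3 B4 C2 C3 C4 E2 E3 E4. rewrite (rectI_split_x f x1 a x2) by (auto; lra). rewrite Za.
    rewrite (rectI_split_x f a b x2); [|lra|lra|intros z Hz; apply Hc; unfold in_rect in *; lra].
    rewrite Zb.
    rewrite (rectI_split_y f a b y1 c y2); [|lra|lra|intros z Hz; apply Hc; unfold in_rect in *; lra].
    rewrite Zc.
    rewrite (rectI_split_y f a b c e y2); [|lra|lra|intros z Hz; apply Hc; unfold in_rect in *; lra].
    rewrite Ze. ring. }
  clear Za Zb Zc Ze A2 A3 A4 B2 B3 B4 C2 C3 C4 E2 E3 E4.
  destruct (classic (in_rect a b c e p)) as [Hin|Hout].
  - assert (v <= 4 * M * ((b - a) + (e - c))); [|nra].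
    rewrite Hv, E. apply rectI_bound; [lra|lra| |].
    + intros z Hz. apply Hc. unfold in_rect in *; lra.
    + intros z Hz. unfold M. pose proof (Cmod_triangle (f z - f p) (f p)) as T.
      replace (f z - f p + f p)%C with (f z) in T by ring.
      assert (Cmod (f z - f p) < 1); [|lra]. apply Hb.
      eapply Rle_lt_trans; [apply Cmod_le_Re_Im|].
      replace (Re (z - p)) with (Re z - Re p) by (unfold Re; simpl; ring).
      replace (Im (z - p)) with (Im z - Im p) by (unfold Im; simpl; ring).
      unfold in_rect in *.
      assert (Rabs (Re z - Re p) <= 2 * eta) by (apply Rabs_le; lra).
      assert (Rabs (Im z - Im p) <= 2 * eta) by (apply Rabs_le; lra). lra.
  - assert (v = 0); [|lra]. rewrite Hv, E, Z, Cmod_0; auto; try lra. intros z Hz ->. auto.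
Qed.

(** * Cauchy's formula and power series *)

Lemma Cmod_pair_le (u v x y : R) : Rabs u <= Rabs x -> Rabs v <= Rabs y -> Cmod (u, v) <= Cmod (x, y).
Proof.
  intros H1 H2. unfold Cmod. simpl. apply sqrt_le_1_alt.
  pose proof (Rsqr_le_abs_1 u x H1). pose proof (Rsqr_le_abs_1 v y H2). unfold Rsqr in *. lra.
Qed.

Lemma between_dist (a b t : R) : Rmin a b <= t <= Rmax a b -> Rabs (t - a) <= Rabs (b - a).
Proof.
  unfold Rmin, Rmax. destruct (Rle_dec a b); intros H.
  - rewrite !Rabs_pos_eq; lra.
  - rewrite !Rabs_left1; lra.
Qed.

Lemma rectI_swap_x (f : C -> C) (x1 x2 y1 y2 : R) :
  pcont_on (fun t => f (t, y1)) x1 x2 -> pcont_on (fun t => f (t, y2)) x1 x2 ->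
  rectI f x2 x1 y1 y2 = (- rectI f x1 x2 y1 y2)%C.
Proof. intros H1 H2. unfold rectI. rewrite !(Cint_swap _ x1 x2) by auto. ring. Qed.

Lemma rectI_swap_y (f : C -> C) (x1 x2 y1 y2 : R) :
  pcont_on (fun t => f (x1, t)) y1 y2 -> pcont_on (fun t => f (x2, t)) y1 y2 ->
  rectI f x1 x2 y2 y1 = (- rectI f x1 x2 y1 y2)%C.
Proof. intros H1 H2. unfold rectI. rewrite !(Cint_swap _ y1 y2) by auto. ring. Qed.

Lemma Cint_const (c : C) (a b : R) : Cint (fun _ => c) a b = (c * RtoC (b - a))%C.
Proof.
  unfold Cint. rewrite !RInt_const. unfold scal, Cmult, RtoC, Re, Im. simpl. unfold mult. simpl.
  f_equal; ring.
Qed.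

Lemma Cder_scal (c z : C) : Cder (fun u => c * u)%C z c.
Proof. exists (fun _ => c). split; [apply Ccont_const|]. split; auto. intros u. ring. Qed.

Section Primitive.
Variables (g : C -> C) (r : R).
Hypothesis Hr : 0 < r.
Hypothesis Hc : forall z, Cmod z < r -> Ccont g z.
Hypothesis Hrect : forall x1 x2 y1 y2, x1 <= x2 -> y1 <= y2 ->
  (forall z, in_rect x1 x2 y1 y2 z -> Cmod z < r) -> rectI g x1 x2 y1 y2 = 0%C.

Let hor_ok (x1 x2 y : R) :
  (forall t, Rmin x1 x2 <= t <= Rmax x1 x2 -> Cmod (t, y) < r) -> pcont_on (fun t => g (t, y)) x1 x2.
Proof.
  intros H t Ht. apply (pcont_comp g (fun t => (t, y))); [eapply pder_pcont, pder_hor|auto].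
Qed.

Let ver_ok (x y1 y2 : R) :
  (forall t, Rmin y1 y2 <= t <= Rmax y1 y2 -> Cmod (x, t) < r) -> pcont_on (fun t => g (x, t)) y1 y2.
Proof.
  intros H t Ht. apply (pcont_comp g (fun t => (x, t))); [eapply pder_pcont, pder_ver|auto].
Qed.

(** Exchanging the ends of a side only changes the sign. The primitive below needs this since
    neither the quadrant of z nor the direction of the increment is known. *)
Let rect_any (x1 x2 y1 y2 : R) :
  (forall u v, Rmin x1 x2 <= u <= Rmax x1 x2 -> Rmin y1 y2 <= v <= Rmax y1 y2 -> Cmod (u, v) < r) ->
  rectI g x1 x2 y1 y2 = 0%C.
Proof.
  intros H.
  assert (B : forall a b, Rmin a b <= a <= Rmax a b /\ Rmin a b <= b <= Rmax a b).
  { intros a b. unfold Rmin, Rmax. destruct (Rle_dec a b); lra. }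
  destruct (Rle_dec x1 x2) as [Hx|Hx]; destruct (Rle_dec y1 y2) as [Hy|Hy].
  - apply Hrect; auto. intros [u v] [H1 H2]. simpl in *.
    apply H; rewrite ?Rmin_left, ?Rmax_right; auto.
  - rewrite rectI_swap_y.
    + rewrite Hrect; [ring|lra|lra|]. intros [u v] [H1 H2]. simpl in *.
      apply H; [rewrite Rmin_left, Rmax_right; auto|rewrite Rmin_right, Rmax_left; lra].
    + apply ver_ok. intros t Ht. rewrite Rmin_comm, Rmax_comm in Ht. apply H; auto. apply B.
    + apply ver_ok. intros t Ht. rewrite Rmin_comm, Rmax_comm in Ht. apply H; auto. apply B.
  - rewrite rectI_swap_x.
    + rewrite Hrect; [ring|lra|lra|]. intros [u v] [H1 H2]. simpl in *.
      apply H; [rewrite Rmin_right, Rmax_left; lra|rewrite Rmin_left, Rmax_right; auto].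
    + apply hor_ok. intros t Ht. rewrite Rmin_comm, Rmax_comm in Ht. apply H; auto. apply B.
    + apply hor_ok. intros t Ht. rewrite Rmin_comm, Rmax_comm in Ht. apply H; auto. apply B.
  - assert (H' : forall t v, Rmin x2 x1 <= t <= Rmax x2 x1 -> Rmin y1 y2 <= v <= Rmax y1 y2 -> Cmod (t, v) < r).
    { intros t v Ht Hv. apply H; auto. rewrite Rmin_comm, Rmax_comm; auto. }
    rewrite rectI_swap_x.
    + rewrite rectI_swap_y.
      * rewrite Hrect; [ring|lra|lra|]. intros [u v] [H1 H2]. simpl in *.
        apply H; rewrite Rmin_right, Rmax_left; lra.
      * apply ver_ok. intros t Ht. rewrite Rmin_comm, Rmax_comm in Ht. apply H'; auto. apply B.
      * apply ver_ok. intros t Ht. rewrite Rmin_comm, Rmax_comm in Ht. apply H'; auto. apply B.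
    + apply hor_ok. intros t Ht. apply H'; auto. apply B.
    + apply hor_ok. intros t Ht. apply H'; auto. apply B.
Qed.

(** The primitive integrates from 0 along the real axis to Re z and then vertically to z. The
    rectangle between x and x' and between 0 and y has integral zero, so passing from z to u only
    adds a horizontal piece at height y and a vertical piece at x'. On both, g is within eps/4 of
    g(z). *)
Lemma ball_primitive : exists G, forall z, Cmod z < r -> Cder G z (g z).
Proof.
  exists (fun z => Cint (fun t => g (t, 0)) 0 (Re z) + Ci * Cint (fun t => g (Re z, t)) 0 (Im z))%C.
  intros z Hz. apply Cder_bound. intros eps He.
  destruct (Hc z Hz (eps / 4)) as [d1 [D1 Hd1]]; [lra|].
  exists (Rmin d1 (r - Cmod z)). split; [apply Rmin_pos; lra|]. intros u Hu.
  assert (Hu1 : Cmod (u - z) < d1) by (eapply Rlt_le_trans; [exact Hu|apply Rmin_l]).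
  assert (Hu2 : Cmod (u - z) < r - Cmod z) by (eapply Rlt_le_trans; [exact Hu|apply Rmin_r]).
  clear Hu. destruct z as [x y]. destruct u as [x' y']. simpl Re. simpl Im.
  assert (N : forall s t, Rabs (s - x) <= Rabs (x' - x) -> Rabs (t - y) <= Rabs (y' - y) ->
     Cmod ((s, t) - (x, y)) <= Cmod ((x', y') - (x, y))).
  { intros s t H1 H2.
    change (Cmod (s - x, t - y) <= Cmod (x' - x, y' - y)). apply Cmod_pair_le; auto. }
  assert (NB : forall s t, Rabs (s - x) <= Rabs (x' - x) -> Rabs (t - y) <= Rabs (y' - y) -> Cmod (s, t) < r).
  { intros s t H1 H2. pose proof (N s t H1 H2). pose proof (Cmod_minus_ge (s, t) (x, y)). lra. }
  assert (Z0 : forall b, Rabs (b - b) <= Rabs (y' - y)) by (intros; rewrite Rminus_diag, Rabs_R0; apply Rabs_pos).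
  assert (Z1 : forall b, Rabs (b - b) <= Rabs (x' - x)) by (intros; rewrite Rminus_diag, Rabs_R0; apply Rabs_pos).
  assert (RB : forall s t, Rabs (s - x) <= Rabs (x' - x) -> Rabs t <= Rabs y -> Cmod (s, t) < r).
  { intros s t H1 H2. eapply Rle_lt_trans; [apply (Cmod_pair_le s t s y); auto; lra|]. apply NB; auto. }
  assert (LB : forall s t, Rabs s <= Rabs x -> Rabs t <= Rabs y -> Cmod (s, t) < r).
  { intros s t H1 H2. eapply Rle_lt_trans; [apply (Cmod_pair_le s t x y); auto|]. auto. }
  assert (A0 : forall b, Rabs 0 <= Rabs b) by (intros; rewrite Rabs_R0; apply Rabs_pos).
  assert (bz : forall b t, Rmin 0 b <= t <= Rmax 0 b -> Rabs t <= Rabs b).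
  { intros b t H. pose proof (between_dist 0 b t H). rewrite !Rminus_0_r in H0. exact H0. }
  rewrite <- (Cint_Chasles (fun t => g (t, 0)) 0 x x').
  2:{ apply hor_ok. intros t Ht. apply LB; auto. }
  2:{ apply hor_ok. intros t Ht. apply RB; auto. apply between_dist; auto. }
  rewrite <- (Cint_Chasles (fun t => g (x', t)) 0 y y').
  2:{ apply ver_ok. intros t Ht. apply RB; auto; lra. }
  2:{ apply ver_ok. intros t Ht. apply NB; [lra|]. apply between_dist; auto. }
  assert (E := rect_any x x' 0 y). unfold rectI in E.
  assert (Hbox : forall u v, Rmin x x' <= u <= Rmax x x' -> Rmin 0 y <= v <= Rmax 0 y -> Cmod (u, v) < r).
  { intros s t Hs Ht. apply RB; auto. apply between_dist; auto. }
  specialize (E Hbox).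
  assert (Pa : pcont_on (fun t => g (t, y)) x x').
  { apply hor_ok. intros t Ht. apply NB; auto. apply between_dist; auto. }
  assert (Pb : pcont_on (fun t => g (x', t)) y y').
  { apply ver_ok. intros t Ht. apply NB; [lra|]. apply between_dist; auto. }
  assert (Fa : Cint (fun t => g (t, y) - g (x, y))%C x x' = (Cint (fun t => g (t, y)) x x' - g (x, y) * RtoC (x' - x))%C).
  { rewrite Cint_minus, Cint_const; auto. intros t _; apply pcont_const. }
  assert (Fb : Cint (fun t => g (x', t) - g (x, y))%C y y' = (Cint (fun t => g (x', t)) y y' - g (x, y) * RtoC (y' - y))%C).
  { rewrite Cint_minus, Cint_const; auto. intros t _; apply pcont_const. }
  (* The vanishing rectangle integral [E] is added to rewrite the increment, minus g(z) (u - z), as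
     integrals of g - g(z) over the two short pieces. *)
  match goal with |- Cmod ?X <= _ =>
    replace X with (Cint (fun t => g (t, y) - g (x, y))%C x x' + Ci * Cint (fun t => g (x', t) - g (x, y))%C y y')%C end.
  2:{ rewrite Fa, Fb.
      replace ((x', y') - (x, y))%C with (RtoC (x' - x) + Ci * RtoC (y' - y))%C.
      2:{ unfold RtoC, Ci, Cmult, Cminus, Cplus, Copp. simpl. f_equal; ring. }
      match type of E with ?X = _ =>
        match goal with |- ?Y = _ => replace Y with (Y + X)%C by (rewrite E; ring) end end.
      ring. }
  eapply Rle_trans; [apply Cmod_triangle|]. rewrite Cmod_mult, Cmod_Ci, Rmult_1_l.
  assert (Ba : Cmod (Cint (fun t => g (t, y) - g (x, y))%C x x') <= 2 * (eps / 4) * Rabs (x' - x)).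
  { apply Cint_bound.
    - intros t Ht. apply pcont_minus; auto using pcont_const.
    - intros t Ht. left. apply Hd1. eapply Rle_lt_trans; [|exact Hu1].
      apply N; auto. apply between_dist; auto. }
  assert (Bb : Cmod (Cint (fun t => g (x', t) - g (x, y))%C y y') <= 2 * (eps / 4) * Rabs (y' - y)).
  { apply Cint_bound.
    - intros t Ht. apply pcont_minus; auto using pcont_const.
    - intros t Ht. left. apply Hd1. eapply Rle_lt_trans; [|exact Hu1].
      apply N; [lra|apply between_dist; auto]. }
  assert (M1 : Rabs (x' - x) <= Cmod ((x', y') - (x, y))).
  { replace (x' - x) with (Re ((x', y') - (x, y))) by (unfold Re; simpl; ring). apply re_le_Cmod. }
  assert (M2 : Rabs (y' - y) <= Cmod ((x', y') - (x, y))).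
  { replace (y' - y) with (Im ((x', y') - (x, y))) by (unfold Im; simpl; ring). apply im_le_Cmod. }
  nra.
Qed.
End Primitive.

Definition circ (rho t : R) : C := (RtoC rho * cexpi t)%C.

Lemma Cmod_cexpi (t : R) : Cmod (cexpi t) = 1.
Proof.
  unfold Cmod, cexpi, fst, snd. rewrite <- sqrt_1. f_equal.
  pose proof (sin2_cos2 t). unfold Rsqr in *. lra.
Qed.

Lemma Cmod_circ (rho t : R) : 0 < rho -> Cmod (circ rho t) = rho.
Proof. intros H. unfold circ. rewrite Cmod_mult, Cmod_cexpi, Cmod_R, Rabs_pos_eq; lra. Qed.

Lemma circ_neq_0 (rho t : R) : 0 < rho -> circ rho t <> 0%C.
Proof. intros H. apply Cmod_gt_0. rewrite Cmod_circ; auto. Qed.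

Lemma circ_closed (rho : R) : circ rho (2 * PI) = circ rho 0.
Proof. unfold circ, cexpi. rewrite cos_2PI, sin_2PI, cos_0, sin_0. reflexivity. Qed.

Lemma pder_circ (rho t : R) : pder (circ rho) t (Ci * circ rho t)%C.
Proof.
  apply is_derive_pder; unfold circ, cexpi, Re, Im; simpl.
  - auto_derive; auto. ring.
  - auto_derive; auto. ring.
Qed.

Lemma pcont_circ (rho t : R) : pcont (circ rho) t.
Proof. eapply pder_pcont, pder_circ. Qed.

Lemma pcont_bounded (g : R -> C) (a b : R) : a <= b -> pcont_on g a b ->
  exists M, 0 < M /\ forall t, a <= t <= b -> Cmod (g t) <= M.
Proof.
  intros Hab H.
  destruct (continuity_ab_maj (fun t => Cmod (g t)) a b Hab) as [x [Hx _]].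
  - intros t Ht. apply continuity_pt_filterlim. apply continuous_eps_delta. intros eps He.
    assert (Hp : pcont g t) by (apply H; rewrite Rmin_left, Rmax_right; auto).
    rewrite pcont_iff in Hp. destruct (Hp eps He) as [d [D Hd]]. exists d. split; auto.
    intros u Hu. specialize (Hd u Hu). eapply Rle_lt_trans; [|exact Hd]. apply Rabs_le.
    pose proof (Cmod_minus_ge (g u) (g t)). pose proof (Cmod_minus_ge (g t) (g u)).
    rewrite (Cmod_minus_sym (g t)) in H1. lra.
  - exists (Cmod (g x) + 1). split; [pose proof (Cmod_ge_0 (g x)); lra|].
    intros t Ht. specialize (Hx t Ht). simpl in Hx. lra.
Qed.

Fixpoint csum (u : nat -> C) (n : nat) : C :=
  match n with O => 0%C | S n => (csum u n + u n)%C end.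

Definition Ccv (u : nat -> C) (l : C) : Prop :=
  forall eps, 0 < eps -> exists N, forall n, (N <= n)%nat -> Cmod (u n - l) < eps.

Lemma Ccv_geom (u : nat -> C) (l : C) (K theta : R) :
  0 <= theta < 1 -> (forall n, Cmod (u n - l) <= K * theta ^ n) -> Ccv u l.
Proof.
  intros Ht H eps He.
  destruct (pow_lt_1_zero theta ltac:(rewrite Rabs_pos_eq; lra) (eps / (Rabs K + 1))) as [N HN].
  { apply Rdiv_lt_0_compat; auto. pose proof (Rabs_pos K). lra. }
  exists N. intros n Hn. specialize (HN n Hn). rewrite Rabs_pos_eq in HN by (apply pow_le; lra).
  eapply Rle_lt_trans; [apply H|]. pose proof (Rabs_pos K). pose proof (Rle_abs K).
  pose proof (pow_le theta n ltac:(lra)).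
  apply Rle_lt_trans with ((Rabs K + 1) * theta ^ n); [nra|].
  replace eps with ((Rabs K + 1) * (eps / (Rabs K + 1))) by (field; lra).
  apply Rmult_lt_compat_l; lra.
Qed.

Lemma Ccv_unique (u : nat -> C) (l m : C) : Ccv u l -> Ccv u m -> l = m.
Proof.
  intros H1 H2. apply Cmod_minus_0_eq. apply Rle_antisym; [|apply Cmod_ge_0].
  apply Rnot_lt_le. intros P.
  destruct (H1 (Cmod (l - m) / 2)) as [N1 K1]; [lra|]. destruct (H2 (Cmod (l - m) / 2)) as [N2 K2]; [lra|].
  specialize (K1 (Nat.max N1 N2) (Nat.le_max_l _ _)). specialize (K2 (Nat.max N1 N2) (Nat.le_max_r _ _)).
  pose proof (Cmod_triangle_via (u (Nat.max N1 N2)) l m) as T. rewrite (Cmod_minus_sym l (u _)) in T. lra.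
Qed.

Section Cauchy.
Variables (f : C -> C) (r rho : R).
Hypothesis Hrho : 0 < rho < r.
Hypothesis Hf : forall z, Cmod z < r -> Cdiff f z.

Let f_circ_cont (h : C -> C) : (forall z, Cmod z < r -> Ccont h z) -> pcont_on (fun t => h (circ rho t)) 0 (2 * PI).
Proof.
  intros Hh t _. apply pcont_comp; [apply pcont_circ|]. apply Hh. rewrite Cmod_circ; lra.
Qed.

Lemma circle_integral_zero (g : C -> C) :
  (forall z, Cmod z < r -> Ccont g z) ->
  (exists G, forall z, Cmod z < r -> Cder G z (g z)) ->
  Cint (fun t => g (circ rho t) * circ rho t)%C 0 (2 * PI) = 0%C.
Proof.
  intros Hg [G HG].
  assert (P : pcont_on (fun t => g (circ rho t) * circ rho t)%C 0 (2 * PI)).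
  { intros t Ht. apply pcont_mult; [apply (f_circ_cont g Hg t Ht)|apply pcont_circ]. }
  assert (E : Cint (fun t => Ci * (g (circ rho t) * circ rho t))%C 0 (2 * PI) = 0%C).
  { rewrite (Cint_derive (fun t => G (circ rho t))).
    - rewrite circ_closed. ring.
    - intros t _. replace (Ci * (g (circ rho t) * circ rho t))%C with (g (circ rho t) * (Ci * circ rho t))%C by ring.
      apply pder_comp; [|apply pder_circ]. apply HG. rewrite Cmod_circ; lra.
    - intros t Ht. apply pcont_mult; [apply pcont_const|auto]. }
  rewrite Cint_scal in E by auto.
  apply Cmod_eq_0. rewrite <- (Rmult_1_l (Cmod _)), <- Cmod_Ci, <- Cmod_mult, E. apply Cmod_0.
Qed.

(** On the circle dz = i z dt, so this is the Cauchy kernel dz / (z - w) with the factor i dropped;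
    all circle integrals follow this convention. *)
Definition kern (w : C) (t : R) : C := (circ rho t / (circ rho t - w))%C.

Lemma circ_minus_neq (w : C) (t : R) : Cmod w < rho -> (circ rho t - w)%C <> 0%C.
Proof.
  intros Hw. apply Cmod_gt_0. pose proof (Cmod_minus_ge (circ rho t) w). rewrite Cmod_circ in H; lra.
Qed.

Lemma pcont_kern (w : C) (t : R) : Cmod w < rho -> pcont (kern w) t.
Proof.
  intros Hw. unfold kern, Cdiv. apply pcont_mult; [apply pcont_circ|].
  apply pcont_inv; [|apply circ_minus_neq; auto]. apply pcont_minus; [apply pcont_circ|apply pcont_const].
Qed.

(** The slope of [f] at w is continuous and differentiable except at w, so Goursat's lemma with an
    exceptional point gives it a primitive and its circle integral vanishes. The integral of the
    kernel stays as a factor; [kern_integral] evaluates it. *)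
Lemma cauchy_kern (w : C) : Cmod w < rho ->
  (Cint (fun t => f (circ rho t) * kern w t)%C 0 (2 * PI) = f w * Cint (kern w) 0 (2 * PI))%C.
Proof.
  intros Hw. destruct (Hf w ltac:(lra)) as [l Hl].
  assert (Hgc : forall z, Cmod z < r -> Ccont (Cslope f w l) z).
  { intros z Hz. destruct (Ceq_dec z w) as [->|N]; [apply Cder_Cslope; auto|].
    apply Cdiff_cont, Cdiff_Cslope_neq; auto. }
  assert (E := circle_integral_zero (Cslope f w l) Hgc).
  assert (Hp : exists G, forall z, Cmod z < r -> Cder G z (Cslope f w l z)).
  { apply ball_primitive; auto. intros x1 x2 y1 y2 Hx Hy Hin.
    apply (goursat_except _ w); auto.
    - apply Hgc; lra.
    - intros z Hz N. apply Cdiff_Cslope_neq; auto. }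
  specialize (E Hp).
  rewrite (Cint_ext _ (fun t => f (circ rho t) * kern w t - f w * kern w t)%C) in E.
  - assert (K : forall t, pcont (kern w) t) by (intros; apply pcont_kern; auto).
    assert (A : pcont_on (fun t => f (circ rho t) * kern w t)%C 0 (2 * PI)).
    { intros t Ht. apply pcont_mult; auto. apply (f_circ_cont f); auto. intros z Hz. apply Cdiff_cont; auto. }
    rewrite Cint_minus, Cint_scal in E; auto.
    + match type of E with (?x - ?y)%C = _ => replace x with (x - y + y)%C by ring end. rewrite E. ring.
    + intros t _; auto.
    + intros t _. apply pcont_mult; auto using pcont_const.
  - intros t _. rewrite Cslope_neq.
    + unfold kern. field. apply circ_minus_neq; auto.
    + intros Q. apply (circ_minus_neq w t Hw). rewrite Q. ring.
Qed.

(** For holomorphic [h] this is 2 pi times the k-th Taylor coefficient at 0. *)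
Definition ccoef (h : C -> C) (k : nat) : C := Cint (fun t => h (circ rho t) * (/ circ rho t) ^ k)%C 0 (2 * PI).

(** The kernel is a finite geometric sum in w/z plus (w/z)^n times itself. Keeping the exact
    remainder avoids any exchange of limit and integral. *)
Lemma cauchy_expand (h : C -> C) (w : C) (n : nat) :
  (forall z, Cmod z < r -> Ccont h z) -> Cmod w < rho ->
  Cint (fun t => h (circ rho t) * kern w t)%C 0 (2 * PI) =
  (csum (fun k => ccoef h k * w ^ k)%C n
   + Cint (fun t => h (circ rho t) * ((w * / circ rho t) ^ n * kern w t))%C 0 (2 * PI))%C.
Proof.
  intros Hh Hw. pose proof (f_circ_cont h Hh) as Ph.
  assert (Pi : forall t, pcont (fun t => / circ rho t)%C t).
  { intros t. apply pcont_inv; [apply pcont_circ|apply circ_neq_0; lra]. }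
  induction n as [|n IH].
  - simpl csum. rewrite (Cint_ext _ (fun t => h (circ rho t) * ((w * / circ rho t) ^ 0 * kern w t))%C 0 (2 * PI)).
    + ring.
    + intros t _. simpl. ring.
  - rewrite IH. simpl csum. rewrite <- Cplus_assoc. f_equal.
    rewrite (Cint_ext _ (fun t => w ^ n * (h (circ rho t) * (/ circ rho t) ^ n)
       + h (circ rho t) * ((w * / circ rho t) ^ S n * kern w t))%C).
    + rewrite Cint_plus, Cint_scal.
      * unfold ccoef. ring.
      * intros t Ht. apply pcont_mult; auto. apply pcont_pow; auto.
      * intros t Ht. apply pcont_mult; [apply pcont_const|]. apply pcont_mult; auto. apply pcont_pow; auto.
      * intros t Ht. apply pcont_mult; auto. apply pcont_mult; [|apply pcont_kern; auto].
        apply pcont_pow. apply pcont_mult; auto using pcont_const.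
    + intros t _. rewrite Cpow_S, Cpow_mult_l. unfold kern.
      field. split; [apply circ_minus_neq; auto|apply circ_neq_0; lra].
Qed.

Lemma cauchy_remainder (h : C -> C) (w : C) : (forall z, Cmod z < r -> Ccont h z) -> Cmod w < rho ->
  Ccv (csum (fun k => ccoef h k * w ^ k)%C) (Cint (fun t => h (circ rho t) * kern w t)%C 0 (2 * PI)).
Proof.
  intros Hh Hw. pose proof (f_circ_cont h Hh) as Ph. pose proof PI_RGT_0.
  assert (Pi : forall t, pcont (fun t => / circ rho t)%C t).
  { intros t. apply pcont_inv; [apply pcont_circ|apply circ_neq_0; lra]. }
  destruct (pcont_bounded (fun t => h (circ rho t) * kern w t)%C 0 (2 * PI)) as [M [HM HB]]; [lra| |].
  { intros t Ht. apply pcont_mult; auto. apply pcont_kern; auto. }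
  apply (Ccv_geom _ _ (2 * M * (2 * PI)) (Cmod w / rho)).
  { split; [apply Rdiv_le_0_compat; [apply Cmod_ge_0|lra]|].
    apply Rmult_lt_reg_r with rho; [lra|]. unfold Rdiv. rewrite Rmult_assoc, Rinv_l by lra. lra. }
  intros n. rewrite (cauchy_expand h w n) by auto. rewrite Cmod_minus_sym.
  match goal with |- Cmod (?a + ?b - ?a) <= _ => replace (a + b - a)%C with b by ring end.
  replace (2 * M * (2 * PI) * (Cmod w / rho) ^ n) with (2 * (M * (Cmod w / rho) ^ n) * Rabs (2 * PI - 0)).
  2:{ rewrite Rabs_pos_eq by lra. ring. }
  apply Cint_bound.
  - intros t Ht. apply pcont_mult; auto. apply pcont_mult; [|apply pcont_kern; auto].
    apply pcont_pow. apply pcont_mult; auto using pcont_const.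
  - intros t Ht. rewrite Rmin_left, Rmax_right in Ht by lra.
    replace (h (circ rho t) * ((w * / circ rho t) ^ n * kern w t))%C
      with (h (circ rho t) * kern w t * (w * / circ rho t) ^ n)%C by ring.
    rewrite Cmod_mult, Cmod_pow, (Cmod_mult w), Cmod_inv, Cmod_circ by (try apply circ_neq_0; lra).
    apply Rmult_le_compat_r; [|auto]. apply pow_le. apply Rmult_le_pos; [apply Cmod_ge_0|].
    left. apply Rinv_0_lt_compat. lra.
Qed.

Lemma pder_inv_circ_pow (k : nat) (t : R) :
  pder (fun t => (/ circ rho t) ^ k)%C t (- (RtoC (INR k) * Ci) * (/ circ rho t) ^ k)%C.
Proof.
  assert (E : forall t, (/ circ rho t)%C = circ (/ rho) (- t)).
  { intros u. assert (P : (circ (/ rho) (- u) * circ rho u)%C = 1%C).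
    { unfold circ, cexpi. rewrite cos_neg, sin_neg. unfold Cmult, RtoC. simpl.
      pose proof (sin2_cos2 u) as S. unfold Rsqr in S.
      f_equal.
      - field_simplify; [|lra]. replace (cos u ^ 2 + sin u ^ 2) with 1 by lra. reflexivity.
      - field. lra. }
    replace (/ circ rho u)%C with (circ (/ rho) (- u) * circ rho u * / circ rho u)%C by (rewrite P; ring).
    field. apply circ_neq_0; lra. }
  assert (D : pder (fun t => / circ rho t)%C t (- Ci * / circ rho t)%C).
  { apply is_derive_pder.
    - apply is_derive_ext with (fun t => Re (circ (/ rho) (- t))); [intros; rewrite E; auto|].
      rewrite E. unfold circ, cexpi, Re, Im. simpl. auto_derive; auto. ring.
    - apply is_derive_ext with (fun t => Im (circ (/ rho) (- t))); [intros; rewrite E; auto|].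
      rewrite E. unfold circ, cexpi, Re, Im. simpl. auto_derive; auto. ring. }
  pose proof (pder_comp _ _ _ _ _ (Cder_pow _ _ _ k (Cder_id (/ circ rho t)%C)) D) as P.
  match type of P with pder _ _ ?x => match goal with |- pder _ _ ?y => replace y with x end end; [exact P|].
  destruct k as [|k]; [simpl; ring|]. change (pred (S k)) with k. rewrite (Cpow_S _ k). ring.
Qed.

Lemma ccoef_one (k : nat) : ccoef (fun _ => 1%C) k = if Nat.eqb k 0 then RtoC (2 * PI) else 0%C.
Proof.
  unfold ccoef. destruct k as [|k]; simpl Nat.eqb; cbv iota.
  - rewrite (Cint_ext _ (fun _ => 1%C)) by (intros; simpl; ring).
    rewrite Cint_const, Rminus_0_r. ring.
  - rewrite (Cint_derive (fun t => / - (RtoC (INR (S k)) * Ci) * (/ circ rho t) ^ S k)%C).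
    + rewrite circ_closed. ring.
    + intros t _.
      pose proof (pder_comp (fun z => / - (RtoC (INR (S k)) * Ci) * z)%C (fun t => (/ circ rho t) ^ S k)%C t
        (/ - (RtoC (INR (S k)) * Ci))%C (- (RtoC (INR (S k)) * Ci) * (/ circ rho t) ^ S k)%C) as P.
      assert (N : (- (RtoC (INR (S k)) * Ci))%C <> 0%C).
      { intros Q. apply (f_equal Im) in Q. unfold Im in Q.
        pose proof (lt_0_INR (S k) (Nat.lt_0_succ k)).
        change (- (INR (S k) * 1 + 0 * 0) = 0) in Q. lra. }
      match goal with |- pder _ _ ?y => replace y with (/ - (INR (S k) * Ci) * (- (INR (S k) * Ci) * (/ circ rho t) ^ S k))%C end.
      * apply P; [|apply pder_inv_circ_pow].
        apply Cder_scal.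
      * rewrite Cmult_assoc, Cinv_l by auto. reflexivity.
    + intros t _. apply pcont_mult; [apply pcont_const|]. apply pcont_pow.
      apply pcont_inv; [apply pcont_circ|apply circ_neq_0; lra].
Qed.

(** In the expansion for the constant function 1 only the coefficient of index 0 survives, so the
    partial sums equal 2 pi from the first one on. *)
Lemma kern_integral (w : C) : Cmod w < rho -> Cint (kern w) 0 (2 * PI) = RtoC (2 * PI).
Proof.
  intros Hw. pose proof (cauchy_remainder (fun _ => 1%C) w (fun z _ => Ccont_const 1 z) Hw) as H.
  rewrite (Cint_ext _ (kern w)) in H by (intros; ring).
  apply (Ccv_unique _ _ _ H). intros eps He. exists 1%nat. intros n Hn.
  assert (E : csum (fun k => ccoef (fun _ => 1) k * w ^ k)%C n = RtoC (2 * PI)).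
  { induction Hn as [|n Hn IH].
    - simpl. rewrite ccoef_one. simpl. ring.
    - simpl. rewrite IH, ccoef_one. destruct n; [lia|]. simpl. ring. }
  rewrite E. unfold Cminus. rewrite Cplus_opp_r, Cmod_0. exact He.
Qed.
End Cauchy.

Lemma holomorphic_power_series_0 (f : C -> C) (r rho : R) : 0 < rho < r ->
  (forall z, Cmod z < r -> Cdiff f z) ->
  exists (a : nat -> C) (K : R), (forall k, Cmod (a k) * rho ^ k <= K) /\
    forall w, Cmod w < rho -> Ccv (csum (fun k => a k * w ^ k)%C) (f w).
Proof.
  intros Hr Hf. pose proof PI_RGT_0 as HPI.
  assert (Hc : forall z, Cmod z < r -> Ccont f z) by (intros; apply Cdiff_cont; auto).
  assert (P2 : RtoC (2 * PI) <> 0%C) by (intros Q; apply RtoC_inj in Q; lra).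
  destruct (pcont_bounded (fun t => f (circ rho t)) 0 (2 * PI)) as [M [HM HB]]; [lra| |].
  { intros t _. apply pcont_comp; [apply pcont_circ|]. apply Hc. rewrite Cmod_circ; lra. }
  exists (fun k => / RtoC (2 * PI) * ccoef rho f k)%C, (2 * M). split.
  - intros k. rewrite Cmod_mult, Cmod_inv, Cmod_R, Rabs_pos_eq by (auto; lra).
    assert (B : Cmod (ccoef rho f k) <= 2 * (M * (/ rho) ^ k) * Rabs (2 * PI - 0)).
    { apply Cint_bound.
      - intros t Ht. apply pcont_mult.
        + apply pcont_comp; [apply pcont_circ|]. apply Hc. rewrite Cmod_circ; lra.
        + apply pcont_pow, pcont_inv; [apply pcont_circ|apply circ_neq_0; lra].
      - intros t Ht. rewrite Rmin_left, Rmax_right in Ht by lra.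
        rewrite Cmod_mult, Cmod_pow, Cmod_inv, Cmod_circ by (try apply circ_neq_0; lra).
        apply Rmult_le_compat_r; [apply pow_le; left; apply Rinv_0_lt_compat; lra|auto]. }
    rewrite Rabs_pos_eq in B by lra.
    pose proof (pow_lt rho k ltac:(lra)) as Pk.
    apply Rle_trans with (/ (2 * PI) * (2 * (M * (/ rho) ^ k) * (2 * PI - 0)) * rho ^ k).
    + apply Rmult_le_compat_r; [lra|]. apply Rmult_le_compat_l; auto. left; apply Rinv_0_lt_compat; lra.
    + right. rewrite pow_inv. field. lra.
  - intros w Hw. pose proof (cauchy_remainder r rho Hr f w Hc Hw) as H.
    rewrite (cauchy_kern f r rho Hr Hf w Hw), (kern_integral r rho Hr w Hw) in H.
    intros eps He. destruct (H (eps * (2 * PI))) as [N HN]; [nra|].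
    exists N. intros n Hn. specialize (HN n Hn).
    assert (E : csum (fun k => / RtoC (2 * PI) * ccoef rho f k * w ^ k)%C n
      = (/ RtoC (2 * PI) * csum (fun k => ccoef rho f k * w ^ k) n)%C).
    { clear. induction n as [|n IH]; simpl; [ring|]. rewrite IH. ring. }
    rewrite E.
    replace (/ RtoC (2 * PI) * csum (fun k => ccoef rho f k * w ^ k) n - f w)%C
      with (/ RtoC (2 * PI) * (csum (fun k => ccoef rho f k * w ^ k) n - f w * RtoC (2 * PI)))%C by (field; auto).
    rewrite Cmod_mult, Cmod_inv, Cmod_R, Rabs_pos_eq by (auto; lra).
    apply Rmult_lt_reg_l with (2 * PI); [lra|]. rewrite <- Rmult_assoc, Rinv_r, Rmult_1_l by lra. lra.
Qed.

(** * Analytic continuation and removal of poles *)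

Lemma Cder_shift (f : C -> C) (a w l : C) : Cder f (a + w)%C l -> Cder (fun u => f (a + u)%C) w l.
Proof.
  intros [phi [Hc [E H]]]. exists (fun u => phi (a + u)%C). split; [|split; auto].
  - apply (Ccont_comp phi (fun u => a + u)%C); auto. apply Ccont_plus; [apply Ccont_const|apply Ccont_id].
  - intros u. rewrite (H (a + u)%C). f_equal. f_equal. ring.
Qed.

Lemma holomorphic_power_series (f : C -> C) (a : C) (r rho : R) : 0 < rho < r ->
  (forall z, Cmod (z - a) < r -> Cdiff f z) ->
  exists (b : nat -> C) (K : R), (forall k, Cmod (b k) * rho ^ k <= K) /\
    forall w, Cmod w < rho -> Ccv (csum (fun k => b k * w ^ k)%C) (f (a + w)%C).
Proof.
  intros Hr Hf. apply (holomorphic_power_series_0 (fun w => f (a + w)%C) r rho Hr).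
  intros z Hz. destruct (Hf (a + z)%C) as [l Hl].
  - replace (a + z - a)%C with z by ring. exact Hz.
  - exists l. apply Cder_shift. exact Hl.
Qed.

(** For a ratio of at most 1/2 a geometric tail is at most twice its first term; the induction uses
    the telescoping form of this bound. *)
Lemma csum_tail_bound (u : nat -> C) (L : C) (B theta : R) (m : nat) :
  0 <= B -> 0 <= theta <= 1 / 2 -> (forall k, Cmod (u k) <= B * theta ^ k) -> Ccv (csum u) L ->
  Cmod (L - csum u m) <= 2 * B * theta ^ m.
Proof.
  intros HB Ht Hu HL.
  assert (P : forall i, Cmod (csum u (m + i) - csum u m) <= 2 * B * theta ^ m - 2 * B * theta ^ (m + i)).
  { induction i as [|i IH].
    - rewrite Nat.add_0_r. unfold Cminus. rewrite Cplus_opp_r, Cmod_0. lra.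
    - rewrite Nat.add_succ_r. simpl csum.
      replace (csum u (m + i) + u (m + i)%nat - csum u m)%C with ((csum u (m + i) - csum u m) + u (m + i)%nat)%C by ring.
      eapply Rle_trans; [apply Cmod_triangle|]. specialize (Hu (m + i)%nat).
      simpl (theta ^ S (m + i)). pose proof (pow_le theta (m + i) ltac:(lra)).
      assert (0 <= B * theta ^ (m + i)) by (apply Rmult_le_pos; auto). nra. }
  apply le_epsilon. intros eps He. destruct (HL eps He) as [N HN].
  specialize (HN (m + N)%nat ltac:(lia)). specialize (P N).
  pose proof (Cmod_triangle_via (csum u (m + N)) L (csum u m)) as T.
  rewrite (Cmod_minus_sym L (csum u (m + N))) in T.
  assert (0 <= 2 * B * theta ^ (m + N)) by (apply Rmult_le_pos; [lra|apply pow_le; lra]). lra.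
Qed.

Lemma Cder_unique (f : C -> C) (z l m : C) : Cder f z l -> Cder f z m -> l = m.
Proof.
  intros H1 H2. apply Cder_Cslope in H1. apply Cder_Cslope in H2.
  apply Cmod_minus_0_eq. apply Rle_antisym; [|apply Cmod_ge_0]. apply Rnot_lt_le. intros P.
  destruct (H1 (Cmod (l - m) / 2)) as [d1 [D1 K1]]; [lra|].
  destruct (H2 (Cmod (l - m) / 2)) as [d2 [D2 K2]]; [lra|].
  set (h := Rmin d1 d2 / 2). assert (Hh : 0 < h) by (unfold h; pose proof (Rmin_pos d1 d2 D1 D2); lra).
  pose proof (Rmin_l d1 d2). pose proof (Rmin_r d1 d2).
  set (u := (z + RtoC h)%C).
  assert (E : Cmod (u - z) = h).
  { unfold u. replace (z + RtoC h - z)%C with (RtoC h) by ring. rewrite Cmod_R, Rabs_pos_eq; lra. }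
  assert (N : u <> z). { intros Q. rewrite Q in E. unfold Cminus in E. rewrite Cplus_opp_r, Cmod_0 in E. lra. }
  specialize (K1 u ltac:(unfold h in *; lra)). specialize (K2 u ltac:(unfold h in *; lra)).
  rewrite Cslope_eq, Cslope_neq in K1, K2 by auto.
  pose proof (Cmod_triangle_via ((f u - f z) / (u - z)) l m) as T.
  rewrite (Cmod_minus_sym l ((f u - f z) / (u - z))) in T. lra.
Qed.

(* The third-order Taylor expansion at [a] gives the slope a first-order one. *)
Lemma Cslope_Cdiff (f : C -> C) (a l : C) (r : R) : 0 < r ->
  (forall z, Cmod (z - a) < r -> Cdiff f z) -> Cder f a l ->
  forall z, Cmod (z - a) < r -> Cdiff (Cslope f a l) z.
Proof.
  intros Hr Hf Hl z Hz. destruct (Ceq_dec z a) as [->|N]; [|apply Cdiff_Cslope_neq; auto].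
  destruct (holomorphic_power_series f a r (r / 2) ltac:(lra) Hf) as [b [K [Hb Hs]]].
  assert (HK : 0 <= K). { eapply Rle_trans; [|apply (Hb 0%nat)]. simpl. pose proof (Cmod_ge_0 (b 0%nat)). lra. }
  (* For |w| <= r/4 the ratio |w| / (r/2) is at most 1/2. The cases m = 1, 2, 3 identify the value,
     the derivative, and the derivative of the slope. *)
  assert (T : forall w m, Cmod w <= r / 4 ->
     Cmod (f (a + w) - csum (fun k => b k * w ^ k) m)%C <= 2 * K * (Cmod w / (r / 2)) ^ m).
  { intros w m Hw. apply csum_tail_bound; auto.
    - pose proof (Cmod_ge_0 w). split; [apply Rdiv_le_0_compat; lra|].
      apply Rmult_le_reg_r with (r / 2); [lra|]. unfold Rdiv at 1. rewrite Rmult_assoc, Rinv_l by lra. lra.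
    - intros k. rewrite Cmod_mult, Cmod_pow. unfold Rdiv at 1. rewrite Rpow_mult_distr, pow_inv.
      pose proof (pow_lt (r / 2) k ltac:(lra)) as P. pose proof (pow_le (Cmod w) k (Cmod_ge_0 w)).
      replace (Cmod (b k) * Cmod w ^ k) with (Cmod (b k) * (r / 2) ^ k * (Cmod w ^ k * / (r / 2) ^ k)) by (field; lra).
      apply Rmult_le_compat_r; [|apply Hb]. apply Rmult_le_pos; auto. left. apply Rinv_0_lt_compat; auto.
    - apply Hs. lra. }
  assert (E0 : f a = b 0%nat).
  { pose proof (T (RtoC 0) 1%nat) as T0. rewrite Cmod_0 in T0. specialize (T0 ltac:(lra)). simpl in T0.
    apply Cmod_minus_0_eq. apply Rle_antisym; [|apply Cmod_ge_0].
    replace (a + 0)%C with a in T0 by ring. replace (0 + b 0%nat * 1)%C with (b 0%nat) in T0 by ring.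
    eapply Rle_trans; [exact T0|]. right. unfold Rdiv. ring. }
  assert (D1 : Cder f a (b 1%nat)).
  { apply Cder_bound. intros eps He. set (B := 2 * K / (r / 2) ^ 2).
    assert (HB : 0 <= B) by (unfold B; apply Rdiv_le_0_compat; [lra|apply pow_lt; lra]).
    exists (Rmin (r / 4) (eps / (B + 1))). split; [apply Rmin_pos; [lra|apply Rdiv_lt_0_compat; lra]|].
    intros u Hu. pose proof (Rmin_l (r / 4) (eps / (B + 1))). pose proof (Rmin_r (r / 4) (eps / (B + 1))).
    specialize (T (u - a)%C 2%nat ltac:(lra)). simpl csum in T.
    replace (a + (u - a))%C with u in T by ring.
    rewrite E0. replace (f u - b 0%nat - b 1%nat * (u - a))%C with (f u - (0 + b 0%nat * (u - a) ^ 0 + b 1%nat * (u - a) ^ 1))%C by (simpl; ring).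
    eapply Rle_trans; [exact T|]. set (x := Cmod (u - a)) in *.
    assert (0 <= x) by apply Cmod_ge_0.
    replace (2 * K * (x / (r / 2)) ^ 2) with (B * x * x) by (unfold B; field; lra).
    apply Rmult_le_compat_r; auto.
    apply Rle_trans with (B * (eps / (B + 1))); [apply Rmult_le_compat_l; lra|].
    apply Rle_trans with ((B + 1) * (eps / (B + 1))); [|right; field; lra].
    apply Rmult_le_compat_r; [left; apply Rdiv_lt_0_compat|]; lra. }
  assert (El : l = b 1%nat) by (eapply Cder_unique; eauto).
  exists (b 2%nat). apply Cder_bound. intros eps He. set (B := 2 * K / (r / 2) ^ 3).
  assert (HB : 0 <= B) by (unfold B; apply Rdiv_le_0_compat; [lra|apply pow_lt; lra]).
  exists (Rmin (r / 4) (eps / (B + 1))). split; [apply Rmin_pos; [lra|apply Rdiv_lt_0_compat; lra]|].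
  intros u Hu. pose proof (Rmin_l (r / 4) (eps / (B + 1))). pose proof (Rmin_r (r / 4) (eps / (B + 1))).
  rewrite Cslope_eq. destruct (Ceq_dec u a) as [->|N].
  { rewrite Cslope_eq. replace (l - l - b 2%nat * (a - a))%C with (RtoC 0) by ring.
    unfold Cminus. rewrite Cplus_opp_r, !Cmod_0. lra. }
  rewrite Cslope_neq by auto. pose proof (Cminus_neq_0 _ _ N) as Nz.
  specialize (T (u - a)%C 3%nat ltac:(lra)). simpl csum in T.
  replace (a + (u - a))%C with u in T by ring.
  replace ((f u - f a) / (u - a) - l - b 2%nat * (u - a))%C
    with ((f u - (0 + b 0%nat * (u - a) ^ 0 + b 1%nat * (u - a) ^ 1 + b 2%nat * (u - a) ^ 2)) / (u - a))%C
    by (rewrite El, E0; simpl; field; auto).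
  rewrite Cmod_div by auto.
  assert (P : 0 < Cmod (u - a)) by (apply Cmod_gt_0; auto). set (x := Cmod (u - a)) in *.
  apply Rmult_le_reg_r with x; auto. unfold Rdiv. rewrite Rmult_assoc, Rinv_l, Rmult_1_r by lra.
  eapply Rle_trans; [exact T|].
  replace (2 * K * (x / (r / 2)) ^ 3) with (B * x * (x * x)) by (unfold B; field; lra).
  replace (eps * x * x) with (eps * (x * x)) by ring. apply Rmult_le_compat_r; [nra|].
  apply Rle_trans with (B * (eps / (B + 1))); [apply Rmult_le_compat_l; lra|].
  apply Rle_trans with ((B + 1) * (eps / (B + 1))); [|right; field; lra].
  apply Rmult_le_compat_r; [left; apply Rdiv_lt_0_compat|]; lra.
Qed.

Lemma Re_csum (u : nat -> C) (n : nat) : Re (csum u (S n)) = sum_n (fun k => Re (u k)) n.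
Proof.
  induction n as [|n IH].
  - rewrite sum_O. unfold Re. simpl. ring.
  - rewrite sum_Sn, <- IH. reflexivity.
Qed.

Lemma Im_csum (u : nat -> C) (n : nat) : Im (csum u (S n)) = sum_n (fun k => Im (u k)) n.
Proof.
  induction n as [|n IH].
  - rewrite sum_O. unfold Im. simpl. ring.
  - rewrite sum_Sn, <- IH. reflexivity.
Qed.

Lemma Ccv_is_series (u : nat -> C) (l : C) : Ccv (csum u) l ->
  is_series (fun k => Re (u k)) (Re l) /\ is_series (fun k => Im (u k)) (Im l).
Proof.
  intros H. split; apply filterlim_locally; intros eps; destruct (H eps (cond_pos eps)) as [N HN];
    exists N; intros n Hn; specialize (HN (S n) ltac:(lia)).
  - rewrite <- Re_csum. change (Rabs (Re (csum u (S n)) - Re l) < eps).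
    eapply Rle_lt_trans; [|exact HN]. exact (re_le_Cmod (csum u (S n) - l)).
  - rewrite <- Im_csum. change (Rabs (Im (csum u (S n)) - Im l) < eps).
    eapply Rle_lt_trans; [|exact HN]. exact (im_le_Cmod (csum u (S n) - l)).
Qed.

Lemma is_series_Ccv (u : nat -> C) (l : C) :
  is_series (fun k => Re (u k)) (Re l) -> is_series (fun k => Im (u k)) (Im l) -> Ccv (csum u) l.
Proof.
  intros H1 H2 eps He. assert (He' : 0 < eps / 2) by lra.
  destruct (proj1 (filterlim_locally _ _) H1 (mkposreal _ He')) as [N1 K1].
  destruct (proj1 (filterlim_locally _ _) H2 (mkposreal _ He')) as [N2 K2].
  exists (S (Nat.max N1 N2)). intros n Hn. destruct n as [|n]; [lia|].
  specialize (K1 n ltac:(lia)). specialize (K2 n ltac:(lia)).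
  rewrite <- Re_csum in K1. rewrite <- Im_csum in K2.
  change (Rabs (Re (csum u (S n)) - Re l) < eps / 2) in K1.
  change (Rabs (Im (csum u (S n)) - Im l) < eps / 2) in K2.
  eapply Rle_lt_trans; [apply Cmod_le_Re_Im|].
  change (Rabs (Re (csum u (S n)) - Re l) + Rabs (Im (csum u (S n)) - Im l) < eps). lra.
Qed.

Lemma CV_radius_pos_of_bounded (a : nat -> R) (rho K : R) : 0 < rho ->
  (forall k, Rabs (a k) * rho ^ k <= K) -> Rbar_lt 0 (CV_radius a).
Proof.
  intros Hr H. eapply Rbar_lt_le_trans with (y := Finite rho); [exact Hr|].
  apply (proj1 (CV_radius_bounded a)). exists K. intros n.
  rewrite Rabs_mult, (Rabs_pos_eq (rho ^ n)) by (apply pow_le; lra). apply H.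
Qed.

(** Along the real axis the real and imaginary parts of the coefficients form real power series, and
    the growth bounds make their radii positive; uniqueness of real power series then applies. *)
Lemma cps_unique (a b : nat -> C) (rho1 rho2 Ka Kb d : R) (f : R -> C) : 0 < rho1 -> 0 < rho2 -> 0 < d ->
  (forall k, Cmod (a k) * rho1 ^ k <= Ka) -> (forall k, Cmod (b k) * rho2 ^ k <= Kb) ->
  (forall x, Rabs x < d -> Ccv (csum (fun k => a k * RtoC x ^ k)%C) (f x)) ->
  (forall x, Rabs x < d -> Ccv (csum (fun k => b k * RtoC x ^ k)%C) (f x)) ->
  forall k, a k = b k.
Proof.
  intros H1 H2 Hd Ba Bb Sa Sb k.
  assert (R1 : forall (a : nat -> C) rho K, 0 < rho -> (forall k, Cmod (a k) * rho ^ k <= K) ->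
     Rbar_lt 0 (CV_radius (fun k => Re (a k))) /\ Rbar_lt 0 (CV_radius (fun k => Im (a k)))).
  { clear. intros a rho K Hr H. split; apply (CV_radius_pos_of_bounded _ rho K Hr); intros k;
    (eapply Rle_trans; [|apply (H k)]); (apply Rmult_le_compat_r; [apply pow_le; lra|]).
    - apply re_le_Cmod. - apply im_le_Cmod. }
  assert (S1 : forall (a : nat -> C) x l, Ccv (csum (fun k => a k * RtoC x ^ k)%C) l ->
     PSeries (fun k => Re (a k)) x = Re l /\ PSeries (fun k => Im (a k)) x = Im l).
  { clear. intros a x l H. apply Ccv_is_series in H. destruct H as [P Q].
    split; apply is_series_unique; [eapply is_series_ext; [|exact P]|eapply is_series_ext; [|exact Q]];
      intros k; cbv beta; rewrite <- RtoC_pow; unfold Re, Im; simpl; ring. }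
  assert (L : forall P : R -> Prop, (forall x, Rabs x < d -> P x) -> locally 0 P).
  { intros P HP. exists (mkposreal d Hd). intros x Hx. apply HP.
    change (Rabs (x - 0) < d) in Hx. rewrite Rminus_0_r in Hx. exact Hx. }
  destruct (R1 a rho1 Ka H1 Ba) as [A1 A2]. destruct (R1 b rho2 Kb H2 Bb) as [B1 B2].
  rewrite (surjective_pairing (a k)), (surjective_pairing (b k)). f_equal.
  - apply (PSeries_ext_recip (fun k => Re (a k)) (fun k => Re (b k)) k A1 B1).
    apply L. intros x Hx. rewrite (proj1 (S1 _ _ _ (Sa x Hx))), (proj1 (S1 _ _ _ (Sb x Hx))). reflexivity.
  - apply (PSeries_ext_recip (fun k => Im (a k)) (fun k => Im (b k)) k A2 B2).
    apply L. intros x Hx. rewrite (proj2 (S1 _ _ _ (Sa x Hx))), (proj2 (S1 _ _ _ (Sb x Hx))). reflexivity.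
Qed.

Lemma identity_ball (f : C -> C) (a : C) (r d : R) : 0 < d ->
  (forall z, Cmod (z - a) < r -> Cdiff f z) ->
  (forall x, Rabs x < d -> f (a + RtoC x)%C = 0%C) ->
  forall z, Cmod (z - a) < r -> f z = 0%C.
Proof.
  intros Hd Hf H0 z Hz. pose proof (Cmod_ge_0 (z - a)).
  set (rho := (Cmod (z - a) + r) / 2).
  destruct (holomorphic_power_series f a r rho ltac:(unfold rho; lra) Hf) as [b [K [Hb Hs]]].
  assert (E : forall k, b k = 0%C).
  { apply (cps_unique b (fun _ => 0%C) rho 1 K 0 (Rmin d rho) (fun _ => 0%C)); auto; try (unfold rho; lra).
    - apply Rmin_pos; unfold rho; lra.
    - intros k. rewrite Cmod_0. lra.
    - intros x Hx. rewrite <- (H0 x); [|eapply Rlt_le_trans; [exact Hx|apply Rmin_l]].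
      apply Hs. rewrite Cmod_R. eapply Rlt_le_trans; [exact Hx|apply Rmin_r].
    - intros x Hx eps He. exists 0%nat. intros n _.
      assert (E : csum (fun k => 0 * RtoC x ^ k)%C n = 0%C).
      { induction n as [|n IH]; simpl; [ring|]. rewrite IH. ring. }
      rewrite E. unfold Cminus. rewrite Cplus_opp_r, Cmod_0. exact He. }
  replace z with (a + (z - a))%C by ring.
  apply (Ccv_unique _ _ _ (Hs (z - a)%C ltac:(unfold rho; lra))).
  intros eps He. exists 0%nat. intros n _.
  assert (E' : csum (fun k => b k * (z - a) ^ k)%C n = 0%C).
  { induction n as [|n IH]; simpl; [ring|]. rewrite IH, E. ring. }
  rewrite E'. unfold Cminus. rewrite Cplus_opp_r, Cmod_0. exact He.
Qed.

Definition vanishes_near (G : C -> C) (z : C) : Prop :=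
  exists d, 0 < d /\ forall u, Cmod (u - z) < d -> G u = 0%C.

(** Let T be the supremum of the times up to which [G] vanishes near the path. Some good gam(t0)
    lies so close to gam(T) that a disc around it, on which [G] is differentiable, contains all
    gam(t) with t near T. The identity theorem in this disc makes those t good, so T = 1 is
    reached. *)
Lemma continuation (G : C -> C) (gam : R -> C) :
  (forall t, 0 <= t <= 1 -> pcont gam t) ->
  (forall t, 0 <= t <= 1 -> exists d, 0 < d /\ forall u, Cmod (u - gam t) < d -> Cdiff G u) ->
  vanishes_near G (gam 0) -> vanishes_near G (gam 1).
Proof.
  intros Hg HD H0.
  set (E := fun t => 0 <= t <= 1 /\ forall u, 0 <= u <= t -> vanishes_near G (gam u)).
  destruct (completeness E) as [T [Hub Hlub]].
  - exists 1. intros t [Ht _]. lra.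
  - exists 0. split; [lra|]. intros u Hu. replace u with 0 by lra. exact H0.
  - assert (HT : 0 <= T <= 1).
    { split; [apply Hub; split; [lra|]; intros u Hu; replace u with 0 by lra; exact H0|].
      apply Hlub. intros t [Ht _]. lra. }
    destruct (HD T HT) as [d [D Hd]].
    destruct (proj1 (pcont_iff gam T) (Hg T HT) (d / 8) ltac:(lra)) as [e [He Hcont]].
    assert (exists t0, E t0 /\ T - e < t0) as [t0 [[Ht0 Hv0] Hclose]].
    { apply NNPP. intros Hn. assert (T <= T - e); [|lra]. apply Hlub. intros t Ht.
      apply Rnot_lt_le. intros Hlt. apply Hn. exists t. split; auto. }
    assert (t0 <= T) by (apply Hub; split; auto).
    assert (Hd0 : Cmod (gam t0 - gam T) < d / 8) by (apply Hcont; apply Rabs_def1; lra).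
    assert (V : forall z, Cmod (z - gam t0) < d / 2 -> G z = 0%C).
    { destruct (Hv0 t0 ltac:(lra)) as [d1 [D1 K1]].
      apply (identity_ball G (gam t0) (d / 2) d1 D1).
      - intros z Hz. apply Hd. pose proof (Cmod_triangle_via (gam t0) z (gam T)). lra.
      - intros x Hx. apply K1. replace (gam t0 + RtoC x - gam t0)%C with (RtoC x) by ring.
        rewrite Cmod_R. exact Hx. }
    assert (W : forall t, Rabs (t - T) < e -> vanishes_near G (gam t)).
    { intros t Ht. specialize (Hcont t Ht). exists (d / 8). split; [lra|]. intros u Hu.
      apply V. pose proof (Cmod_triangle_via (gam t) u (gam t0)).
      pose proof (Cmod_triangle_via (gam T) (gam t) (gam t0)). rewrite (Cmod_minus_sym (gam T) (gam t0)) in H2.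
      lra. }
    apply W. assert (HE : E (Rmin 1 (T + e / 2))).
    { split; [split; [apply Rmin_glb; lra|apply Rmin_l]|]. intros u [U1 U2].
      destruct (Rle_dec u t0) as [Hu|Hu]; [apply Hv0; lra|].
      apply W. pose proof (Rmin_r 1 (T + e / 2)). apply Rabs_def1; lra. }
    apply Hub in HE. unfold Rmin in HE. destruct (Rle_dec 1 (T + e / 2)); apply Rabs_def1; lra.
Qed.

Lemma ball_avoids_list (S : list C) (z : C) : ~ In z S ->
  exists d, 0 < d /\ forall u, Cmod (u - z) < d -> ~ In u S.
Proof.
  induction S as [|s S IH]; intros N.
  - exists 1. split; [lra|]. intros u _ [].
  - destruct IH as [d [D Hd]]; [intros Q; apply N; right; auto|].
    assert (P : 0 < Cmod (s - z)) by (apply Cmod_gt_0, Cminus_neq_0; intros ->; apply N; left; auto).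
    exists (Rmin d (Cmod (s - z))). split; [apply Rmin_pos; auto|]. intros u Hu [Q|Q].
    + subst u. pose proof (Rmin_r d (Cmod (s - z))). lra.
    + pose proof (Rmin_l d (Cmod (s - z))). apply (Hd u); auto. lra.
Qed.

Lemma real_avoids_list (L : list R) : forall a b, a < b -> exists c, a < c < b /\ ~ In c L.
Proof.
  induction L as [|x L IH]; intros a b Hab.
  - exists ((a + b) / 2). split; [lra|]. intros [].
  - destruct (Rle_dec x ((a + b) / 2)) as [H|H].
    + destruct (IH ((a + b) / 2) b ltac:(lra)) as [c [Hc Nc]]. exists c. split; [lra|].
      intros [Q|Q]; [lra|auto].
    + destruct (IH a ((a + b) / 2) ltac:(lra)) as [c [Hc Nc]]. exists c. split; [lra|].
      intros [Q|Q]; [lra|auto].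
Qed.

(* The arcs [t |-> z (t + i c t (1 - t))], [0 < c < 1], stay in the disc of radius |z| and meet only
   at their end points, so all but finitely many of them avoid [S]. *)
Lemma identity_punctured_disc (G : C -> C) (S : list C) (r d : R) : 0 < d -> ~ In (RtoC 0) S ->
  (forall z, Cmod z < r -> ~ In z S -> Cdiff G z) ->
  (forall x, Rabs x < d -> G (RtoC x) = 0%C) ->
  forall z, Cmod z < r -> ~ In z S -> G z = 0%C.
Proof.
  intros Hd HS HG H0 z Hz Nz.
  destruct (Ceq_dec z 0) as [->|Z0]; [apply H0; rewrite Rabs_R0; auto|].
  (* If the arc with parameter c meets s at an interior time t, then s/z = t + i c t (1 - t), so c
     is the listed quotient; one c outside this finite list is chosen. *)
  destruct (real_avoids_list (map (fun s => Im (s / z) / (Re (s / z) * (1 - Re (s / z)))) S) 0 1 ltac:(lra))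
    as [c [Hc Nc]].
  set (gam := fun t : R => (z * (t, (c * (t * (1 - t)))%R))%C).
  assert (V : vanishes_near G (gam 1)).
  { apply (continuation G gam).
    - intros t _. apply pcont_mult; [apply pcont_const|].
      eapply pder_pcont. apply (is_derive_pder _ _ (1, c * (1 - 2 * t))); unfold Re, Im; simpl; auto_derive; auto; ring.
    - intros t Ht.
      assert (N : ~ In (gam t) S).
      { intros Q. destruct (Req_dec t 0) as [->|T0].
        - apply HS. replace (RtoC 0) with (gam 0); auto. unfold gam, Cmult, RtoC. simpl. f_equal; ring.
        - destruct (Req_dec t 1) as [->|T1].
          + apply Nz. replace z with (gam 1); auto. unfold gam, Cmult, RtoC. simpl.
            rewrite (surjective_pairing z) at 5. f_equal; simpl; ring.
          + apply Nc. apply in_map_iff. exists (gam t). split; auto.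
            assert (Ez : forall v : C, (z * v / z)%C = v) by (intros; field; auto).
            unfold gam. rewrite Ez.
            simpl. field. split; lra. }
      assert (B : Cmod (gam t) <= Cmod z).
      { unfold gam. rewrite Cmod_mult. rewrite <- (Rmult_1_r (Cmod z)) at 2.
        apply Rmult_le_compat_l; [apply Cmod_ge_0|].
        eapply Rle_trans; [apply Cmod_le_Re_Im|]. simpl.
        assert (0 <= t * (1 - t)) by nra.
        rewrite !Rabs_pos_eq; nra. }
      destruct (ball_avoids_list S (gam t) N) as [e [He Ha]].
      exists (Rmin e (r - Cmod z)). split; [apply Rmin_pos; lra|]. intros u Hu.
      pose proof (Rmin_l e (r - Cmod z)). pose proof (Rmin_r e (r - Cmod z)).
      apply HG; [|apply Ha; lra]. pose proof (Cmod_minus_ge u (gam t)). lra.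
    - replace (gam 0) with (RtoC 0) by (unfold gam, Cmult, RtoC; simpl; f_equal; ring).
      destruct (ball_avoids_list S 0 HS) as [e [He Ha]].
      assert (Hr : 0 < r) by (pose proof (Cmod_ge_0 z); lra).
      exists (Rmin e r). split; [apply Rmin_pos; lra|].
      pose proof (Rmin_l e r). pose proof (Rmin_r e r).
      apply (identity_ball G 0 (Rmin e r) d Hd).
      + intros u Hu. apply HG; [|apply Ha; lra]. replace (u - 0)%C with u in Hu by ring. lra.
      + intros x Hx. replace (0 + RtoC x)%C with (RtoC x) by ring. auto. }
  destruct V as [e [He V]]. apply V.
  replace (gam 1) with z. { unfold Cminus. rewrite Cplus_opp_r, Cmod_0. exact He. }
  unfold gam, Cmult. simpl. rewrite (surjective_pairing z) at 1. f_equal; ring.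
Qed.

(** A pole of order at most one with residue [c]; the value of [V] at [Z] itself is left free. *)
Definition pole_at (V : C -> C) (Z c : C) : Prop :=
  exists h d, 0 < d /\ (forall u, Cmod (u - Z) < d -> Cdiff h u) /\
    forall u, Cmod (u - Z) < d -> u <> Z -> V u = (c / (u - Z) + h u)%C.

(** Write f = g (u - Z) with g the slope, g(Z) = l. For c = P(Z) / l the function P - c g vanishes
    at Z, so its slope divided by g is the regular part of P / f. *)
Lemma quotient_pole (V P f : C -> C) (Z l : C) (d : R) : 0 < d ->
  (forall u, Cmod (u - Z) < d -> Cdiff P u) -> (forall u, Cmod (u - Z) < d -> Cdiff f u) ->
  f Z = 0%C -> Cder f Z l -> l <> 0%C ->
  (forall u, Cmod (u - Z) < d -> u <> Z -> (V u * f u = P u)%C) ->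
  pole_at V Z (P Z / l)%C.
Proof.
  intros Hd HP Hf f0 Hl Nl HV.
  set (g := Cslope f Z l). pose proof (Cslope_Cdiff f Z l d Hd Hf Hl) as Hg. fold g in Hg.
  assert (ZZ : forall e, 0 < e -> Cmod (Z - Z) < e) by (intros; unfold Cminus; rewrite Cplus_opp_r, Cmod_0; auto).
  assert (gZ : g Z = l) by apply Cslope_eq.
  set (c := (P Z / l)%C). set (n := fun u => (P u - c * g u)%C).
  assert (Hn : forall u, Cmod (u - Z) < d -> Cdiff n u).
  { intros u Hu. apply Cdiff_minus; auto. apply Cdiff_mult; [apply Cdiff_const|auto]. }
  assert (nZ : n Z = 0%C) by (unfold n; rewrite gZ; unfold c; field; auto).
  destruct (Hn Z (ZZ d Hd)) as [m Hm].
  pose proof (Cslope_Cdiff n Z m d Hd Hn Hm) as Hnn.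
  destruct (Cdiff_cont g Z (Hg Z (ZZ d Hd)) (Cmod l)) as [e [He Hge]]; [apply Cmod_gt_0; auto|].
  assert (Ng : forall u, Cmod (u - Z) < e -> g u <> 0%C).
  { intros u Hu Q. specialize (Hge u Hu). rewrite Q, gZ in Hge.
    replace (0 - l)%C with (- l)%C in Hge by ring. rewrite Cmod_opp in Hge. lra. }
  exists (fun u => Cslope n Z m u / g u)%C, (Rmin d e). split; [apply Rmin_pos; auto|].
  pose proof (Rmin_l d e). pose proof (Rmin_r d e). split.
  - intros u Hu. apply Cdiff_div; [apply Hnn; lra|apply Hg; lra|apply Ng; lra].
  - intros u Hu N. specialize (HV u ltac:(lra) N). specialize (Ng u ltac:(lra)).
    pose proof (Cminus_neq_0 _ _ N) as N'. rewrite Cslope_neq, nZ by auto.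
    assert (Ef : f u = (g u * (u - Z))%C).
    { rewrite (Cslope_spec f Z l u), f0. fold g. ring. }
    rewrite Ef in HV.
    replace (V u) with (V u * (g u * (u - Z)) / (g u * (u - Z)))%C by (field; auto).
    rewrite HV. unfold n. field. auto.
Qed.

Fixpoint polar_sum (L : list (C * C)) (u : C) : C :=
  match L with nil => 0%C | q :: L => (snd q / (u - fst q) + polar_sum L u)%C end.

Lemma remove_poles (L : list (C * C)) : forall (V : C -> C) (r : R), NoDup (map fst L) ->
  (forall z, Cmod z < r -> ~ In z (map fst L) -> Cdiff V z) ->
  (forall q, In q L -> pole_at V (fst q) (snd q)) ->
  exists H, (forall z, Cmod z < r -> Cdiff H z) /\
    forall z, ~ In z (map fst L) -> V z = (H z + polar_sum L z)%C.
Proof.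
  induction L as [|[Z c] L IH]; intros V r ND HV HL.
  - exists V. split; [intros z Hz; apply HV; auto|]. intros z _. simpl. ring.
  - simpl in ND. apply NoDup_cons_iff in ND. destruct ND as [NZ ND].
    destruct (HL (Z, c) (or_introl eq_refl)) as [h [d [Hd [Hh HVh]]]]. simpl in HVh, Hh.
    (* The value at [Z] is replaced by that of the regular part, which makes the difference
       differentiable there too. *)
    set (V1 := fun u => if Ceq_dec u Z then h Z else (V u - c / (u - Z))%C).
    assert (V1n : forall u, u <> Z -> V1 u = (V u - c / (u - Z))%C).
    { intros u N. unfold V1. destruct (Ceq_dec u Z); tauto. }
    assert (pol : forall u, u <> Z -> Cdiff (fun u => c / (u - Z))%C u).
    { intros u N. apply Cdiff_div; [apply Cdiff_const| |apply Cminus_neq_0; auto].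
      apply Cdiff_minus; [apply Cdiff_id|apply Cdiff_const]. }
    assert (away : forall u, u <> Z -> exists e, 0 < e /\ forall v, Cmod (v - u) < e -> v <> Z).
    { intros u N. exists (Cmod (Z - u)). split; [apply Cmod_gt_0, Cminus_neq_0; auto|].
      intros v Hv ->. lra. }
    destruct (IH V1 r ND) as [H [HH1 HH2]].
    + intros z Hz Nz. destruct (Ceq_dec z Z) as [->|N].
      * apply (Cdiff_ext_loc h _ _ d Hd); [|apply Hh; unfold Cminus; rewrite Cplus_opp_r, Cmod_0; auto].
        intros u Hu. unfold V1. destruct (Ceq_dec u Z) as [->|N]; auto.
        rewrite (HVh u Hu N). ring.
      * destruct (away z N) as [e [He Ha]].
        apply (Cdiff_ext_loc (fun u => V u - c / (u - Z))%C _ _ e He); [intros u Hu; symmetry; auto|].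
        apply Cdiff_minus; auto. apply HV; auto. simpl. intros [Q|Q]; auto.
    + intros q Hq. destruct (HL q (or_intror Hq)) as [k [e [He [Hk HVk]]]].
      assert (N : fst q <> Z). { intros Q. apply NZ. rewrite <- Q. apply in_map. exact Hq. }
      destruct (away _ N) as [e' [He' Ha]].
      exists (fun u => k u - c / (u - Z))%C, (Rmin e e'). split; [apply Rmin_pos; auto|].
      pose proof (Rmin_l e e'). pose proof (Rmin_r e e'). split.
      * intros u Hu. apply Cdiff_minus; [apply Hk; lra|]. apply pol. apply Ha. lra.
      * intros u Hu Nu. rewrite V1n by (apply Ha; lra). rewrite HVk by (auto; lra). ring.
    + exists H. split; auto. intros z Nz. simpl in Nz. simpl polar_sum.
      assert (z <> Z) by (intros ->; apply Nz; auto).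
      assert (~ In z (map fst L)) by (intros Q; apply Nz; auto).
      pose proof (HH2 z H1) as E. rewrite V1n in E by auto.
      replace (V z) with (V z - c / (z - Z) + c / (z - Z))%C by ring. rewrite E. ring.
Qed.

(** * Probability generating functions *)

Lemma Ccv_plus (u v : nat -> C) (l m : C) : Ccv u l -> Ccv v m -> Ccv (fun n => u n + v n)%C (l + m)%C.
Proof.
  intros H1 H2 eps He. destruct (H1 (eps / 2)) as [N1 K1]; [lra|]. destruct (H2 (eps / 2)) as [N2 K2]; [lra|].
  exists (Nat.max N1 N2). intros n Hn. specialize (K1 n ltac:(lia)). specialize (K2 n ltac:(lia)).
  replace (u n + v n - (l + m))%C with ((u n - l) + (v n - m))%C by ring.
  eapply Rle_lt_trans; [apply Cmod_triangle|]. lra.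
Qed.

Lemma Ccv_scal (c : C) (u : nat -> C) (l : C) : Ccv u l -> Ccv (fun n => c * u n)%C (c * l)%C.
Proof.
  intros H eps He. pose proof (Cmod_ge_0 c).
  destruct (H (eps / (Cmod c + 1))) as [N K]; [apply Rdiv_lt_0_compat; lra|].
  exists N. intros n Hn. specialize (K n Hn).
  replace (c * u n - c * l)%C with (c * (u n - l))%C by ring. rewrite Cmod_mult.
  pose proof (Cmod_ge_0 (u n - l)).
  apply Rle_lt_trans with ((Cmod c + 1) * Cmod (u n - l)); [nra|].
  replace eps with ((Cmod c + 1) * (eps / (Cmod c + 1))) by (field; lra).
  apply Rmult_lt_compat_l; lra.
Qed.

Lemma Ccv_ext (u v : nat -> C) (l : C) : (forall n, u n = v n) -> Ccv u l -> Ccv v l.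
Proof. intros E H eps He. destruct (H eps He) as [N K]. exists N. intros n Hn. rewrite <- E. auto. Qed.

Lemma csum_plus (u v : nat -> C) (n : nat) : csum (fun k => u k + v k)%C n = (csum u n + csum v n)%C.
Proof. induction n as [|n IH]; simpl; [ring|]. rewrite IH. ring. Qed.

Lemma csum_scal (c : C) (u : nat -> C) (n : nat) : csum (fun k => c * u k)%C n = (c * csum u n)%C.
Proof. induction n as [|n IH]; simpl; [ring|]. rewrite IH. ring. Qed.

Lemma csum_ext (u v : nat -> C) (n : nat) : (forall k, u k = v k) -> csum u n = csum v n.
Proof. intros H. induction n as [|n IH]; simpl; congruence. Qed.

Lemma csum_incr_1 (u : nat -> C) (n : nat) : csum u (S n) = (u 0%nat + csum (fun k => u (S k)) n)%C.
Proof. induction n as [|n IH]; [simpl; ring|]. simpl csum in *. rewrite IH. ring. Qed.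

Lemma Ccv_incr_1 (u : nat -> C) (l : C) : Ccv (fun n => u (S n)) l -> Ccv u l.
Proof.
  intros H eps He. destruct (H eps He) as [N K]. exists (S N). intros n Hn.
  destruct n as [|n]; [lia|]. apply K. lia.
Qed.

Lemma Ccv_csum_bound (u : nat -> C) (v : nat -> R) (l : C) :
  (forall k, Cmod (u k) <= v k) -> ex_series v -> Ccv (csum u) l -> Cmod l <= Series v.
Proof.
  intros Huv Hv Hu.
  assert (P : forall n, Cmod (csum u (S n)) <= Series v).
  { intros n. apply Rle_trans with (sum_n v n).
    - induction n as [|n IH].
      + rewrite sum_O. simpl. replace (0 + u 0%nat)%C with (u 0%nat) by ring. auto.
      + rewrite sum_Sn. change (csum u (S (S n))) with (csum u (S n) + u (S n))%C.
        eapply Rle_trans; [apply Cmod_triangle|]. apply Rplus_le_compat; auto.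
    - assert (is_lim_seq (sum_n v) (Series v)) by (apply Series_correct; auto).
      apply (is_lim_seq_incr_compare _ _ H). intros k. rewrite sum_Sn.
      specialize (Huv (S k)). pose proof (Cmod_ge_0 (u (S k))). unfold plus. simpl. lra. }
  apply le_epsilon. intros eps He. destruct (Hu eps He) as [N K]. specialize (K (S N) ltac:(lia)).
  specialize (P N). pose proof (Cmod_minus_ge l (csum u (S N))). rewrite Cmod_minus_sym in H. lra.
Qed.

Lemma CV_radius_ex_series (q : nat -> R) (x : R) : 0 <= x -> Rbar_lt x (CV_radius q) ->
  ex_series (fun k => Rabs (q k) * x ^ k).
Proof.
  intros Hx H. rewrite <- (Rabs_pos_eq x) in H by auto. apply CV_disk_inside in H.
  eapply ex_series_ext; [|exact H]. intros k. simpl.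
  rewrite Rabs_mult, (Rabs_pos_eq (x ^ k)); auto. apply pow_le; auto.
Qed.

(** The coefficients k q_k belong to x times the derivative of the series. *)
Lemma CV_radius_mult_INR (q : nat -> R) : CV_radius (fun k => INR k * q k) = CV_radius q.
Proof.
  rewrite <- (CV_radius_derive q), <- (CV_radius_incr_1 (PS_derive q)).
  apply CV_radius_ext. intros [|k]; [first [exact (Rmult_0_l _) | exact (eq_sym (Rmult_0_l _))]|]. reflexivity.
Qed.

Lemma ex_series_k2 (q : nat -> R) (x : R) : 0 <= x -> Rbar_lt x (CV_radius q) ->
  ex_series (fun k => INR k ^ 2 * Rabs (q k) * x ^ k).
Proof.
  intros Hx H. rewrite <- (CV_radius_mult_INR q), <- (CV_radius_mult_INR (fun k => INR k * q k)) in H.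
  apply CV_radius_ex_series in H; auto. eapply ex_series_ext; [|exact H].
  intros k. simpl. rewrite !Rabs_mult, (Rabs_pos_eq (INR k)) by apply pos_INR. ring.
Qed.

Lemma pgf_Ccv (q : nat -> R) (z : C) : Rbar_lt (Cmod z) (CV_radius q) ->
  Ccv (csum (fun k => RtoC (q k) * z ^ k)%C) (pgf q z).
Proof.
  intros H. pose proof (CV_radius_ex_series q _ (Cmod_ge_0 z) H) as Hs.
  apply is_series_Ccv; simpl.
  - apply is_series_ext with (fun k => q k * Re (z ^ k)%C).
    { intros k. unfold Re, RtoC. simpl. ring. }
    apply Series_correct. apply (ex_series_le (V:=R_CompleteNormedModule) _ (fun k => Rabs (q k) * Cmod z ^ k)); auto.
    intros k. change (Rabs (q k * Re (z ^ k)%C) <= Rabs (q k) * Cmod z ^ k).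
    rewrite Rabs_mult, <- Cmod_pow. apply Rmult_le_compat_l; [apply Rabs_pos|apply re_le_Cmod].
  - apply is_series_ext with (fun k => q k * Im (z ^ k)%C).
    { intros k. unfold Im, RtoC. simpl. ring. }
    apply Series_correct. apply (ex_series_le (V:=R_CompleteNormedModule) _ (fun k => Rabs (q k) * Cmod z ^ k)); auto.
    intros k. change (Rabs (q k * Im (z ^ k)%C) <= Rabs (q k) * Cmod z ^ k).
    rewrite Rabs_mult, <- Cmod_pow. apply Rmult_le_compat_l; [apply Rabs_pos|apply im_le_Cmod].
Qed.

Lemma pgf_conj (q : nat -> R) (z : C) : pgf q (Cconj z) = Cconj (pgf q z).
Proof.
  unfold pgf, Cconj at 3. simpl. f_equal.
  - apply Series_ext. intros k. rewrite <- Cpow_conj, re_conj. reflexivity.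
  - rewrite <- Series_opp. apply Series_ext. intros k. rewrite <- Cpow_conj, im_conj. ring.
Qed.

Lemma pgf_real (q : nat -> R) (x : R) : pgf q (RtoC x) = RtoC (PSeries q x).
Proof.
  unfold pgf, RtoC at 3. f_equal.
  - apply Series_ext. intros k. rewrite <- RtoC_pow. reflexivity.
  - rewrite <- (Rmult_0_l (Series (fun k => 1))) at 1. rewrite <- Series_scal_l. apply Series_ext.
    intros k. rewrite <- RtoC_pow. unfold Im, RtoC. simpl. ring.
Qed.

(** Both sides carry rho^2 so that the exponent k - 2 does not occur. The remainder E_k satisfies
    E_(k+1) = z E_k + k v^(k-1) (z - v)^2, and k^2 + k <= (k+1)^2 closes the induction. *)
Lemma Cpow_taylor (z v : C) (rho : R) (k : nat) : 0 < rho -> Cmod z <= rho -> Cmod v <= rho ->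
  Cmod (z ^ k - v ^ k - INR k * v ^ pred k * (z - v)) * rho ^ 2 <= INR k ^ 2 * rho ^ k * Cmod (z - v) ^ 2.
Proof.
  intros Hr Hz Hv. induction k as [|k IH].
  - simpl. replace (1 - 1 - 0 * 1 * (z - v))%C with (RtoC 0) by ring. rewrite Cmod_0. lra.
  - set (E := (z ^ k - v ^ k - INR k * v ^ pred k * (z - v))%C) in *.
    assert (Eq : (z ^ S k - v ^ S k - INR (S k) * v ^ pred (S k) * (z - v))%C
       = (z * E + INR k * v ^ pred k * ((z - v) * (z - v)))%C).
    { unfold E. rewrite !Cpow_S, S_INR, RtoC_plus. destruct k as [|k]; [simpl; ring|].
      simpl pred. rewrite !Cpow_S. ring. }
    rewrite Eq. set (h := Cmod (z - v)) in *.
    assert (A : Cmod (z * E + INR k * v ^ pred k * ((z - v) * (z - v))) <=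
       rho * Cmod E + INR k * Cmod v ^ pred k * h ^ 2).
    { eapply Rle_trans; [apply Cmod_triangle|]. rewrite !Cmod_mult, Cmod_R, Cmod_pow, Rabs_pos_eq by apply pos_INR.
      fold h. apply Rplus_le_compat; [apply Rmult_le_compat_r; [apply Cmod_ge_0|auto]|]. simpl. lra. }
    assert (B : INR k * Cmod v ^ pred k * rho ^ 2 <= INR k * rho ^ S k).
    { destruct k as [|k]; [simpl; lra|]. simpl pred.
      rewrite Rmult_assoc. apply Rmult_le_compat_l; [apply pos_INR|].
      replace (rho ^ S (S k)) with (rho ^ k * rho ^ 2) by (simpl; ring).
      apply Rmult_le_compat_r; [apply pow2_ge_0|]. apply pow_incr. split; [apply Cmod_ge_0|auto]. }
    pose proof (pos_INR k). pose proof (pow2_ge_0 rho). pose proof (pow2_ge_0 h).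
    pose proof (pow_lt rho (S k) Hr).
    rewrite S_INR.
    apply Rle_trans with (rho * (INR k ^ 2 * rho ^ k * h ^ 2) + INR k * rho ^ S k * h ^ 2).
    + apply Rle_trans with ((rho * Cmod E + INR k * Cmod v ^ pred k * h ^ 2) * rho ^ 2); [apply Rmult_le_compat_r; auto|].
      replace ((rho * Cmod E + INR k * Cmod v ^ pred k * h ^ 2) * rho ^ 2)
        with (rho * (Cmod E * rho ^ 2) + (INR k * Cmod v ^ pred k * rho ^ 2) * h ^ 2) by ring.
      apply Rplus_le_compat; [apply Rmult_le_compat_l; lra|apply Rmult_le_compat_r; auto].
    + replace (rho * (INR k ^ 2 * rho ^ k * h ^ 2) + INR k * rho ^ S k * h ^ 2)
        with ((INR k ^ 2 + INR k) * (rho ^ S k * h ^ 2)) by (simpl; ring).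
      rewrite Rmult_assoc. apply Rmult_le_compat_r; [apply Rmult_le_pos; lra|]. nra.
Qed.

(** The constant obtained by summing [Cpow_taylor] against |q_k|: a bound for the second-order
    Taylor remainder, uniform on the disc of radius [rho]. *)
Definition pgf_C2 (q : nat -> R) (rho : R) : R := Series (fun k => INR k ^ 2 * Rabs (q k) * rho ^ k) / rho ^ 2.

Lemma pgf_C2_pos (q : nat -> R) (rho : R) : 0 < rho -> Rbar_lt rho (CV_radius q) -> 0 <= pgf_C2 q rho.
Proof.
  intros Hr H. apply Rdiv_le_0_compat; [|apply pow_lt; auto].
  rewrite <- (Rmult_0_l (Series (fun _ => 0))), <- Series_scal_l. apply Series_le.
  - intros k. split; [lra|]. rewrite Rmult_0_l. apply Rmult_le_pos; [|apply pow_le; lra].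
    apply Rmult_le_pos; [apply pow2_ge_0|apply Rabs_pos].
  - apply ex_series_k2; auto; lra.
Qed.

Lemma pgf_taylor (q : nat -> R) (z v : C) (rho : R) : 0 < rho -> Rbar_lt rho (CV_radius q) ->
  Cmod z <= rho -> Cmod v <= rho ->
  Cmod (pgf q z - pgf q v - pgf (PS_derive q) v * (z - v)) <= pgf_C2 q rho * Cmod (z - v) ^ 2.
Proof.
  intros Hr HR Hz Hv.
  assert (Hz' : Rbar_lt (Cmod z) (CV_radius q)) by (eapply Rbar_le_lt_trans; [|exact HR]; exact Hz).
  assert (Hv' : Rbar_lt (Cmod v) (CV_radius q)) by (eapply Rbar_le_lt_trans; [|exact HR]; exact Hv).
  assert (Hd : Ccv (csum (fun k => RtoC (q k) * (INR k * v ^ pred k))%C) (pgf (PS_derive q) v)).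
  { apply Ccv_incr_1.
    apply (Ccv_ext (csum (fun k => RtoC (PS_derive q k) * v ^ k)%C)).
    - intros n. rewrite csum_incr_1. simpl (INR 0).
      replace (RtoC (q 0%nat) * (0 * v ^ pred 0))%C with (RtoC 0) by ring. rewrite Cplus_0_l.
      apply csum_ext. intros k. unfold PS_derive. simpl pred. rewrite RtoC_mult. ring.
    - apply pgf_Ccv. rewrite CV_radius_derive. exact Hv'. }
  unfold pgf_C2.
  assert (S : Ccv (csum (fun k => RtoC (q k) * (z ^ k - v ^ k - INR k * v ^ pred k * (z - v)))%C)
     (pgf q z - pgf q v - pgf (PS_derive q) v * (z - v))%C).
  { replace (pgf q z - pgf q v - pgf (PS_derive q) v * (z - v))%C
      with (pgf q z + (-(1) * pgf q v + -(z - v) * pgf (PS_derive q) v))%C by ring.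
    eapply Ccv_ext; [|apply Ccv_plus; [apply (pgf_Ccv q z Hz')|apply Ccv_plus;
      [apply (Ccv_scal (-(1))%C _ _ (pgf_Ccv q v Hv'))|apply (Ccv_scal (-(z - v))%C _ _ Hd)]]].
    intros n. cbv beta. rewrite <- !csum_scal, <- !csum_plus. apply csum_ext. intros k. ring. }
  set (h := Cmod (z - v)).
  pose proof (pow_lt rho 2 Hr) as P2.
  replace (Series (fun k => INR k ^ 2 * Rabs (q k) * rho ^ k) / rho ^ 2 * h ^ 2)
    with (Series (fun k => (h ^ 2 / rho ^ 2) * (INR k ^ 2 * Rabs (q k) * rho ^ k))).
  2:{ rewrite Series_scal_l. field. lra. }
  refine (Ccv_csum_bound _ _ _ _ _ S).
  - intros k. rewrite Cmod_mult, Cmod_R.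
    pose proof (Cpow_taylor z v rho k Hr Hz Hv) as T. fold h in T.
    replace (h ^ 2 / rho ^ 2 * (INR k ^ 2 * Rabs (q k) * rho ^ k))
      with (Rabs (q k) * (INR k ^ 2 * rho ^ k * h ^ 2 / rho ^ 2)) by (field; lra).
    apply Rmult_le_compat_l; [apply Rabs_pos|].
    apply Rmult_le_reg_r with (rho ^ 2); auto.
    replace (INR k ^ 2 * rho ^ k * h ^ 2 / rho ^ 2 * rho ^ 2) with (INR k ^ 2 * rho ^ k * h ^ 2) by (field; lra).
    exact T.
  - apply (ex_series_scal (V:=R_NormedModule)). apply ex_series_k2; auto; lra.
Qed.

Lemma pgf_Cder (q : nat -> R) (z : C) : Rbar_lt (Cmod z) (CV_radius q) ->
  Cder (pgf q) z (pgf (PS_derive q) z).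
Proof.
  intros H.
  assert (exists rho, Cmod z < rho /\ Rbar_lt rho (CV_radius q)) as [rho [H1 H2]].
  { destruct (CV_radius q) as [R0| |]; simpl in H.
    - exists ((Cmod z + R0) / 2). simpl. lra.
    - exists (Cmod z + 1). simpl. split; [lra|auto].
    - contradiction. }
  pose proof (Cmod_ge_0 z).
  apply Cder_bound. intros eps He. pose proof (pgf_C2_pos q rho ltac:(lra) H2) as HB.
  set (B := pgf_C2 q rho) in *.
  exists (Rmin (rho - Cmod z) (eps / (B + 1))). split; [apply Rmin_pos; [lra|apply Rdiv_lt_0_compat; lra]|].
  intros u Hu. pose proof (Rmin_l (rho - Cmod z) (eps / (B + 1))). pose proof (Rmin_r (rho - Cmod z) (eps / (B + 1))).
  pose proof (Cmod_minus_ge u z).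
  eapply Rle_trans; [apply (pgf_taylor q u z rho); auto; lra|]. fold B.
  set (x := Cmod (u - z)) in *. assert (0 <= x) by apply Cmod_ge_0.
  replace (B * x ^ 2) with (B * x * x) by ring. apply Rmult_le_compat_r; auto.
  apply Rle_trans with (B * (eps / (B + 1))); [apply Rmult_le_compat_l; lra|].
  apply Rle_trans with ((B + 1) * (eps / (B + 1))); [|right; field; lra].
  apply Rmult_le_compat_r; [left; apply Rdiv_lt_0_compat|]; lra.
Qed.

(** * The functional equation of the stationary distribution *)

Ltac R_ring := match goal with |- @eq _ ?a ?b => change (@eq R a b) end; unfold plus; simpl;
  repeat match goal with |- context [sum_n ?u ?n] => let x := fresh in set (x := sum_n u n : R); clearbody x end; ring.

Lemma sum_n_pos (u : nat -> R) (n : nat) : (forall k, 0 <= u k) -> 0 <= sum_n u n.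
Proof.
  intros H. induction n as [|n IH]; [rewrite sum_O; auto|].
  rewrite sum_Sn. unfold plus. simpl. specialize (H (S n)). lra.
Qed.

Lemma sum_n_le_series (u : nat -> R) (l : R) (n : nat) : (forall k, 0 <= u k) -> is_series u l -> sum_n u n <= l.
Proof.
  intros H Hl. apply (is_lim_seq_incr_compare (sum_n u) l Hl). intros k. rewrite sum_Sn.
  unfold plus. simpl. specialize (H (S k)). lra.
Qed.

Lemma term_le_sum_n (u : nat -> R) (n k : nat) : (forall k, 0 <= u k) -> (k <= n)%nat -> u k <= sum_n u n.
Proof.
  intros H Hk. induction Hk as [|n Hk IH].
  - destruct k as [|k]; [rewrite sum_O; lra|]. rewrite sum_Sn. unfold plus. simpl.
    pose proof (sum_n_pos u k H). lra.
  - rewrite sum_Sn. unfold plus. simpl. specialize (H (S n)). lra.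
Qed.

Lemma term_le_series (u : nat -> R) (l : R) (k : nat) : (forall k, 0 <= u k) -> is_series u l -> u k <= l.
Proof.
  intros H Hl. eapply Rle_trans; [apply (term_le_sum_n u k k H); auto|]. apply sum_n_le_series; auto.
Qed.

Lemma pmf_le_1 (p : nat -> R) (k : nat) : is_pmf p -> 0 <= p k <= 1.
Proof. intros [H1 H2]. split; auto. apply term_le_series; auto. Qed.

Lemma is_series_finite (u : nat -> R) (l : R) (N : nat) :
  (forall k, (N < k)%nat -> u k = 0) -> is_series u l -> l = sum_n u N.
Proof.
  intros H Hl. symmetry. apply (f_equal real (x := Finite (sum_n u N)) (y := Finite l)).
  rewrite <- (is_lim_seq_unique (sum_n u) l Hl).
  symmetry. apply is_lim_seq_unique.
  apply is_lim_seq_ext_loc with (fun _ => sum_n u N); [|apply is_lim_seq_const].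
  exists N. intros n Hn. induction Hn as [|n Hn IH]; auto.
  rewrite sum_Sn, <- IH, H by lia. R_ring.
Qed.

Lemma conv_bounds (p q : nat -> R) (m : nat) : is_pmf p -> (forall k, 0 <= q k <= 1) -> 0 <= conv p q m <= 1.
Proof.
  intros Hp Hq. unfold conv. split.
  - apply sum_n_pos. intros k. apply Rmult_le_pos; [apply Hp|apply Hq].
  - apply Rle_trans with (sum_n p m); [|apply sum_n_le_series; apply Hp].
    apply sum_n_m_le. intros k. pose proof (proj1 Hp k). pose proof (Hq (m - k)%nat). nra.
Qed.

Lemma convpow_bounds (p : nat -> R) (n : nat) : is_pmf p -> forall m, 0 <= convpow p n m <= 1.
Proof.
  intros Hp. induction n as [|n IH]; intros m; simpl.
  - destruct (Nat.eqb m 0); lra.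
  - apply conv_bounds; auto.
Qed.

Lemma CV_radius_bounded_1 (q : nat -> R) (x : R) : (forall k, 0 <= q k <= 1) -> Rabs x < 1 ->
  Rbar_lt (Rabs x) (CV_radius q).
Proof.
  intros H Hx. eapply Rbar_lt_le_trans with (y := Finite 1); [exact Hx|].
  apply (proj1 (CV_radius_bounded q)). exists 1. intros n.
  rewrite pow1, Rmult_1_r, Rabs_pos_eq; apply H.
Qed.

Lemma PSeries_conv (p q : nat -> R) (x : R) : (forall k, 0 <= p k <= 1) -> (forall k, 0 <= q k <= 1) ->
  Rabs x < 1 -> PSeries (conv p q) x = PSeries p x * PSeries q x.
Proof.
  intros Hp Hq Hx. rewrite <- PSeries_mult by (apply CV_radius_bounded_1; auto).
  apply PSeries_ext. intros m. unfold conv, PS_mult. apply sum_n_Reals.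
Qed.

Lemma PSeries_convpow (p : nat -> R) (n : nat) (x : R) : is_pmf p -> Rabs x < 1 ->
  PSeries (convpow p n) x = PSeries p x ^ n.
Proof.
  intros Hp Hx. induction n as [|n IH]; simpl.
  - unfold PSeries. rewrite (Series_ext _ (fun k => if Nat.eqb k 0 then 1 else 0)).
    + apply is_series_unique.
      apply (is_lim_seq_ext (fun _ => 1) (sum_n _) 1); [|apply is_lim_seq_const].
      intros k. induction k as [|k IH]; [rewrite sum_O; auto|]. rewrite sum_Sn, <- IH. R_ring.
    + intros [|k]; simpl; ring.
  - rewrite PSeries_conv, IH; auto; intros k; [apply pmf_le_1; auto|apply convpow_bounds; auto].
Qed.

Lemma sum_n_conv (p q : nat -> R) (t : nat) :
  sum_n (fun i => p i * sum_n q (t - i)) t = sum_n (conv p q) t.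
Proof.
  induction t as [|t IH].
  - rewrite !sum_O. unfold conv. rewrite !sum_O. reflexivity.
  - rewrite (sum_Sn (conv p q) t), <- IH. unfold conv. rewrite !sum_Sn, Nat.sub_diag, sum_O.
    rewrite (sum_n_ext_loc _ (fun i => plus (p i * sum_n q (t - i)) (p i * q (S t - i)%nat)) t).
    { rewrite sum_n_plus. R_ring. }
    intros i Hi. rewrite Nat.sub_succ_l by auto. rewrite sum_Sn. R_ring.
Qed.

Section FunctionalEquation.
Variables (a pi : nat -> R) (s : nat).
Hypothesis Ha : forall k, 0 <= a k <= 1.
Hypothesis Hpi : stationary a s pi.

(** The law of Q + A, before [s] is subtracted and the result truncated at 0. *)
Let b := conv pi a.

Lemma stationary_S (j : nat) : pi (S j) = b (S j + s)%nat.
Proof.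
  destruct Hpi as [_ H]. specialize (H (S j)). apply (is_series_finite _ _ (S j + s)) in H.
  - rewrite H. unfold b, conv. apply sum_n_ext_loc. intros i Hi. unfold step.
    replace (Nat.eqb (S j) 0) with false by auto.
    rewrite (proj2 (Nat.leb_le i (S j + s)) Hi). reflexivity.
  - intros i Hi. unfold step. replace (Nat.eqb (S j) 0) with false by auto.
    destruct (Nat.leb_spec i (S j + s)); [lia|]. ring.
Qed.

Lemma stationary_0 : pi 0%nat = sum_n b s.
Proof.
  destruct Hpi as [_ H]. specialize (H 0%nat). apply (is_series_finite _ _ s) in H.
  - rewrite H. transitivity (sum_n (fun i => pi i * sum_n a (s - i)) s).
    + apply sum_n_ext_loc. intros i Hi. unfold step. simpl Nat.eqb. cbv iota.
      rewrite (proj2 (Nat.leb_le i s) Hi). reflexivity.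
    + apply sum_n_conv.
  - intros i Hi. unfold step. simpl Nat.eqb. cbv iota. destruct (Nat.leb_spec i s); [lia|]. ring.
Qed.

(** The polynomial P, with weights w_m = P(Q + A = m): it collects the values below s, where the
    truncation acts. *)
Definition numer (b : nat -> R) (s : nat) (z : C) : C :=
  csum (fun m => RtoC (b m) * (z ^ s - z ^ m))%C s.

Lemma b_bounds (k : nat) : 0 <= b k <= 1.
Proof. apply conv_bounds; auto. apply Hpi. Qed.

(** Stationarity reads x^s Q(x) = sum over m <= s of b_m x^s plus sum over m > s of b_m x^m.
    Subtracting Q(x) A(x), the full sum of b_m x^m, leaves only the indices m <= s. *)
Lemma functional_equation (x : R) : Rabs x < 1 ->
  RtoC (PSeries pi x * (x ^ s - PSeries a x)) = numer b s (RtoC x).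
Proof.
  intros Hx.
  assert (Hpib : forall k, 0 <= pi k <= 1) by (intros; apply pmf_le_1, Hpi).
  assert (E1 : PSeries pi x = pi 0%nat + x * PSeries (PS_decr_1 pi) x).
  { apply PSeries_decr_1. apply CV_disk_correct, CV_disk_inside, CV_radius_bounded_1; auto. }
  assert (E2 : PSeries b x = sum_f_R0 (fun k => b k * x ^ k) s + x ^ S s * PSeries (PS_decr_n b (S s)) x).
  { apply PSeries_decr_n. apply CV_disk_correct, CV_disk_inside, CV_radius_bounded_1; auto. apply b_bounds. }
  assert (E3 : PSeries (PS_decr_1 pi) x = PSeries (PS_decr_n b (S s)) x).
  { apply PSeries_ext. intros k. unfold PS_decr_1, PS_decr_n. rewrite stationary_S. f_equal. lia. }
  assert (E4 : PSeries b x = PSeries pi x * PSeries a x) by (apply PSeries_conv; auto).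
  replace (PSeries pi x * (x ^ s - PSeries a x)) with (x ^ s * PSeries pi x - PSeries b x) by (rewrite E4; ring).
  rewrite E2, E1, E3, stationary_0, sum_n_Reals. unfold numer.
  match goal with |- RtoC ?X = _ => replace X with (x ^ s * sum_f_R0 b s - sum_f_R0 (fun k => b k * x ^ k) s)
    by (rewrite <- tech_pow_Rmult; ring) end.
  assert (K : forall t, RtoC (x ^ s * sum_f_R0 b t - sum_f_R0 (fun k => b k * x ^ k) t)
     = csum (fun m => RtoC (b m) * (RtoC x ^ s - RtoC x ^ m))%C (S t)).
  { induction t as [|t IH].
    - simpl. rewrite RtoC_minus, !RtoC_mult, RtoC_pow. ring.
    - change (csum (fun m => RtoC (b m) * (RtoC x ^ s - RtoC x ^ m))%C (S (S t)))
        with (csum (fun m => RtoC (b m) * (RtoC x ^ s - RtoC x ^ m))%C (S t)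
          + RtoC (b (S t)) * (RtoC x ^ s - RtoC x ^ S t))%C.
      rewrite <- IH. simpl sum_f_R0. rewrite !RtoC_minus, !RtoC_mult, !RtoC_plus, !RtoC_mult, !RtoC_pow. rewrite (Cpow_S (RtoC x) t). ring. }
  (* The summand of index s vanishes, which reconciles the sum over m <= s with the sum over m < s
     in [numer]. *)
  rewrite K. simpl csum. ring.
Qed.
End FunctionalEquation.

Lemma numer_Cdiff (b : nat -> R) (s : nat) (z : C) : Cdiff (numer b s) z.
Proof.
  (* Only the length of the sum is generalised; the exponent [s] stays fixed during the
     induction. *)
  unfold numer. generalize s at 2 as t. induction t as [|t IH].
  - simpl. apply Cdiff_const.
  - simpl. apply Cdiff_plus; auto. apply Cdiff_mult; [apply Cdiff_const|].
    apply Cdiff_minus; apply Cdiff_pow, Cdiff_id.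
Qed.

Lemma numer_conj (b : nat -> R) (s : nat) (z : C) : numer b s (Cconj z) = Cconj (numer b s z).
Proof.
  unfold numer. generalize s at 2 4 as t. induction t as [|t IH]; simpl.
  - unfold Cconj, RtoC. simpl. f_equal. ring.
  - rewrite IH, Cplus_conj, Cmult_conj, Cminus_conj, !Cpow_conj. do 2 f_equal.
    unfold Cconj, RtoC. simpl. f_equal. ring.
Qed.

(* Outside the closed unit disc the leading term dominates. *)
Lemma numer_neq_0 (b : nat -> R) (s : nat) (z : C) : (forall k, 0 <= b k) -> 1 < Cmod z ->
  (exists m, (m < s)%nat /\ 0 < b m) -> numer b s z <> 0%C.
Proof.
  intros Hb Hz Hpos E. unfold numer in E.
  assert (K : forall t, csum (fun m => RtoC (b m) * (z ^ s - z ^ m))%C (S t)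
     = (RtoC (sum_f_R0 b t) * z ^ s - csum (fun m => RtoC (b m) * z ^ m) (S t))%C).
  { induction t as [|t IH]; [simpl; ring|].
    change (csum (fun m => RtoC (b m) * (z ^ s - z ^ m))%C (S (S t))) with
      (csum (fun m => RtoC (b m) * (z ^ s - z ^ m))%C (S t) + RtoC (b (S t)) * (z ^ s - z ^ S t))%C.
    rewrite IH. change (csum (fun m => RtoC (b m) * z ^ m)%C (S (S t))) with
      (csum (fun m => RtoC (b m) * z ^ m)%C (S t) + RtoC (b (S t)) * z ^ S t)%C.
    simpl sum_f_R0. rewrite RtoC_plus. ring. }
  assert (B : forall t, Cmod (csum (fun m => RtoC (b m) * z ^ m)%C (S t)) <= sum_f_R0 b t * Cmod z ^ t).
  { induction t as [|t IH].
    - simpl. replace (0 + RtoC (b 0%nat) * 1)%C with (RtoC (b 0%nat)) by ring.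
      rewrite Cmod_R, Rabs_pos_eq by auto. lra.
    - change (csum (fun m => RtoC (b m) * z ^ m)%C (S (S t))) with
        (csum (fun m => RtoC (b m) * z ^ m)%C (S t) + RtoC (b (S t)) * z ^ S t)%C.
      eapply Rle_trans; [apply Cmod_triangle|]. rewrite Cmod_mult, Cmod_R, Cmod_pow, Rabs_pos_eq by auto.
      simpl sum_f_R0. rewrite Rmult_plus_distr_r. apply Rplus_le_compat_r.
      eapply Rle_trans; [exact IH|].
      assert (0 <= sum_f_R0 b t) by (rewrite <- sum_n_Reals; apply sum_n_pos; auto).
      apply Rmult_le_compat_l; auto. simpl. pose proof (pow_lt (Cmod z) t ltac:(lra)). nra. }
  destruct s as [|t]; [destruct Hpos as [m [Hm _]]; lia|].
  rewrite K in E.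
  assert (P : 0 < sum_f_R0 b t).
  { destruct Hpos as [m [Hm Hp]]. rewrite <- sum_n_Reals.
    eapply Rlt_le_trans; [exact Hp|]. apply term_le_sum_n; auto; lia. }
  specialize (B t).
  replace (csum (fun m => RtoC (b m) * z ^ m) (S t))%C with (RtoC (sum_f_R0 b t) * z ^ S t)%C in B.
  2:{ match type of E with (?x - ?y)%C = _ => replace x with (x - y + y)%C by ring end. rewrite E. ring. }
  rewrite Cmod_mult, Cmod_R, Cmod_pow, Rabs_pos_eq in B by lra.
  apply Rmult_le_reg_l in B; auto. simpl in B. pose proof (pow_lt (Cmod z) t ltac:(lra)). nra.
Qed.

Lemma bernoulli_lower (x : R) (n : nat) : 0 <= x <= 1 -> 1 - INR n * (1 - x) <= x ^ n.
Proof.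
  intros Hx. induction n as [|n IH]; [simpl; lra|]. rewrite S_INR. simpl.
  pose proof (pos_INR n). pose proof (pow_le x n ltac:(lra)).
  assert (x * (1 - INR n * (1 - x)) <= x * x ^ n) by (apply Rmult_le_compat_l; lra).
  assert (0 <= INR n * ((1 - x) * (1 - x))) by (apply Rmult_le_pos; nra). nra.
Qed.

(** A generating function lies above its tangent at 1; termwise this is Bernoulli's inequality. *)
Lemma PSeries_pgf_lower (p : nat -> R) (x : R) : is_pmf p -> Rbar_lt 1 (CV_radius p) -> 0 <= x <= 1 ->
  1 - pgf_mean p * (1 - x) <= PSeries p x.
Proof.
  intros Hp Hr Hx.
  assert (Hm : ex_series (fun k => INR k * p k)).
  { rewrite <- (CV_radius_mult_INR p) in Hr. apply CV_radius_ex_series in Hr; [|lra].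
    eapply ex_series_ext; [|exact Hr]. intros k. simpl. rewrite pow1, Rabs_pos_eq; [ring|].
    apply Rmult_le_pos; [apply pos_INR|apply Hp]. }
  assert (H1 : ex_series p) by (exists 1; apply Hp).
  assert (H2 : ex_series (fun k => p k * x ^ k)).
  { apply (ex_series_le (V:=R_CompleteNormedModule) _ p); auto. intros k.
    change (Rabs (p k * x ^ k) <= p k). pose proof (proj1 Hp k). pose proof (pow_le x k ltac:(lra)).
    assert (x ^ k <= 1) by (rewrite <- (pow1 k); apply pow_incr; lra).
    rewrite Rabs_pos_eq; nra. }
  unfold PSeries, pgf_mean.
  assert (E : 0 <= Series (fun k => p k * x ^ k + (1 - x) * (INR k * p k) - p k)).
  { rewrite <- (Rmult_0_l (Series p)), <- Series_scal_l. apply Series_le.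
    - intros k. split; [lra|]. pose proof (bernoulli_lower x k Hx). pose proof (proj1 Hp k). nra.
    - apply (ex_series_minus (V:=R_NormedModule) (fun k => p k * x ^ k + (1 - x) * (INR k * p k)) p); auto.
      apply (ex_series_plus (V:=R_NormedModule)); auto. apply (ex_series_scal (V:=R_NormedModule)); auto. }
  rewrite Series_minus, Series_plus, Series_scal_l, (is_series_unique p 1 (proj2 Hp)) in E; auto.
  - lra.
  - apply (ex_series_scal (V:=R_NormedModule) (1 - x)); auto.
  - apply (ex_series_plus (V:=R_NormedModule) (fun k => p k * x ^ k)); auto.
    apply (ex_series_scal (V:=R_NormedModule) (1 - x)); auto.
Qed.

Lemma pmf_exists_pos (p : nat -> R) : is_pmf p -> exists k, 0 < p k.
Proof.
  intros Hp. apply NNPP. intros N. assert (E : is_series p 0).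
  { apply (is_lim_seq_ext (fun _ => 0) (sum_n _) 0); [|apply is_lim_seq_const]. intros n.
    assert (Z : forall k, p k = 0).
    { intros k. pose proof (proj1 Hp k). destruct (Req_dec (p k) 0); auto. exfalso. apply N. exists k. lra. }
    induction n as [|n IH]; [rewrite sum_O, Z; auto|]. rewrite sum_Sn, <- IH, Z. R_ring. }
  pose proof (is_series_unique _ _ E). pose proof (is_series_unique _ _ (proj2 Hp)). lra.
Qed.

Lemma PSeries_pmf_pos (pi : nat -> R) (x : R) : is_pmf pi -> 0 < x < 1 -> 0 < PSeries pi x.
Proof.
  intros Hp Hx.
  destruct (pmf_exists_pos pi Hp) as [k Hk].
  apply Rlt_le_trans with (pi k * x ^ k).
  - apply Rmult_lt_0_compat; auto. apply pow_lt; lra.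
  - apply (term_le_series (fun k => pi k * x ^ k)).
    + intros i. apply Rmult_le_pos; [apply Hp|apply pow_le; lra].
    + apply Series_correct. apply (ex_series_le (V:=R_CompleteNormedModule) _ pi); [|exists 1; apply Hp].
      intros i. change (Rabs (pi i * x ^ i) <= pi i). pose proof (proj1 Hp i). pose proof (pow_le x i ltac:(lra)).
      assert (x ^ i <= 1) by (rewrite <- (pow1 i); apply pow_incr; lra).
      rewrite Rabs_pos_eq; nra.
Qed.

(* If all the weights vanished, [x ^ s] and [X(x) ^ n] would agree on (0,1),
   against the drift condition at [x = 1]. *)
Lemma stationary_weight_pos (p pi : nat -> R) (n s : nat) : is_pmf p -> Rbar_lt 1 (CV_radius p) ->
  0 < pgf_mean p -> INR n * pgf_mean p < INR s -> stationary (convpow p n) s pi ->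
  exists m, (m < s)%nat /\ 0 < conv pi (convpow p n) m.
Proof.
  intros Hp Hr Hmu Hst Hpi. apply NNPP. intros N.
  assert (Hb : forall m, 0 <= conv pi (convpow p n) m <= 1).
  { intros m. apply conv_bounds; [apply Hpi|]. apply convpow_bounds; auto. }
  assert (Z : forall z, numer (conv pi (convpow p n)) s z = 0%C).
  { intros z. unfold numer. assert (K : forall t, (t <= s)%nat -> csum (fun m => RtoC (conv pi (convpow p n) m) * (z ^ s - z ^ m))%C t = 0%C).
    { induction t as [|t IH]; intros Ht; simpl; [ring|]. rewrite IH by lia.
      replace (conv pi (convpow p n) t) with 0; [ring|].
      destruct (Hb t) as [[H|H] _]; auto. exfalso. apply N. exists t. split; [lia|auto]. }
    apply K. lia. }
  assert (E : forall x, 0 < x < 1 -> x ^ s = PSeries p x ^ n).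
  { intros x Hx. assert (Hx' : Rabs x < 1) by (rewrite Rabs_pos_eq; lra).
    pose proof (functional_equation _ _ _ (convpow_bounds p n Hp) Hpi x Hx') as F.
    rewrite Z in F. apply RtoC_inj in F. rewrite PSeries_convpow in F by auto.
    pose proof (PSeries_pmf_pos pi x (proj1 Hpi) Hx). nra. }
  set (mu := pgf_mean p) in *. pose proof (pos_INR n) as Pn.
  assert (Ps : 0 < INR s) by nra.
  (* At x = 1 - e Bernoulli gives 1 - n mu e <= X(x)^n = x^s <= 1 / (1 + s e), hence s - n mu <= n
     mu s e <= e s^2. The third bound on e makes this at most (s - n mu) / 2, a contradiction; the
     first two keep the bases in [0,1]. *)
  set (e := Rmin (1 / 2) (Rmin (/ (2 * mu)) ((INR s - INR n * mu) / (2 * (INR s * INR s))))).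
  assert (He : 0 < e).
  { unfold e. repeat apply Rmin_pos; try lra.
    - apply Rinv_0_lt_compat; lra.
    - apply Rdiv_lt_0_compat; nra. }
  assert (E1 : e <= 1 / 2) by apply Rmin_l.
  assert (E2 : e * mu <= 1 / 2).
  { apply Rle_trans with (/ (2 * mu) * mu); [|right; field; lra]. apply Rmult_le_compat_r; [lra|].
    unfold e. eapply Rle_trans; [apply Rmin_r|apply Rmin_l]. }
  assert (E3 : e * (INR s * INR s) <= (INR s - INR n * mu) / 2).
  { apply Rle_trans with ((INR s - INR n * mu) / (2 * (INR s * INR s)) * (INR s * INR s)); [|right; field; nra].
    apply Rmult_le_compat_r; [nra|]. unfold e. eapply Rle_trans; [apply Rmin_r|apply Rmin_r]. }
  clearbody e.
  specialize (E (1 - e) ltac:(lra)).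
  pose proof (PSeries_pgf_lower p (1 - e) Hp Hr ltac:(lra)) as L. fold mu in L.
  replace (1 - (1 - e)) with e in L by ring.
  assert (L2 : (1 - mu * e) ^ n <= PSeries p (1 - e) ^ n) by (apply pow_incr; lra).
  pose proof (bernoulli_lower (1 - mu * e) n ltac:(nra)) as L3.
  assert (U : (1 - e) ^ s * (1 + INR s * e) <= 1).
  { apply Rle_trans with ((1 - e) ^ s * (1 + e) ^ s).
    - apply Rmult_le_compat_l; [apply pow_le; lra|]. clear - He. induction s as [|s IH]; [simpl; lra|].
      rewrite S_INR. simpl. pose proof (pos_INR s). nra.
    - rewrite <- Rpow_mult_distr. apply Rle_trans with (1 ^ s); [apply pow_incr; nra|rewrite pow1; lra]. }
  assert (A : 1 - INR n * mu * e <= (1 - e) ^ s) by lra.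
  assert (0 < 1 + INR s * e) by nra.
  assert ((1 - INR n * mu * e) * (1 + INR s * e) <= 1) by nra.
  assert (0 < INR s * e) by nra.
  assert (INR n * mu * INR s * e <= e * (INR s * INR s)) by nra.
  nra.
Qed.

(** * Tails from poles *)

(** On a circle of radius eps the polar part contributes exactly 2 pi i c0 and the regular part
    O(eps). Since the integral is 2 pi i c for every small eps, letting eps tend to 0 identifies the
    two numbers. *)
Lemma is_residue_pole (V : C -> C) (Z c c0 : C) : pole_at V Z c0 -> is_residue V Z c -> c = c0.
Proof.
  intros [h [d [Hd [Hh HV]]]] [e0 [He0 Hres]]. pose proof PI_RGT_0 as HPI.
  destruct (Cdiff_cont h Z) with (eps := 1) as [d1 [D1 Hb]]; [|lra|].
  { apply Hh. unfold Cminus. rewrite Cplus_opp_r, Cmod_0. auto. }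
  set (M := Cmod (h Z) + 1). assert (HM : 0 < M) by (unfold M; pose proof (Cmod_ge_0 (h Z)); lra).
  assert (HhM : forall u, Cmod (u - Z) < d1 -> Cmod (h u) <= M).
  { intros u Hu. specialize (Hb u Hu). pose proof (Cmod_minus_ge (h u) (h Z)). unfold M. lra. }
  assert (K : forall eps, 0 < eps < Rmin e0 (Rmin d d1) ->
     Cmod (RtoC (2 * PI) * Ci * (c - c0)) <= 2 * (eps * M) * (2 * PI)).
  { intros eps [E1 E2].
    pose proof (Rmin_l e0 (Rmin d d1)). pose proof (Rmin_r e0 (Rmin d d1)).
    pose proof (Rmin_l d d1). pose proof (Rmin_r d d1).
    specialize (Hres eps ltac:(lra)).
    set (g := fun t => (V (Z + RtoC eps * cexpi t) * (RtoC eps * Ci * cexpi t))%C) in Hres.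
    assert (Hg : Cint g 0 (2 * PI) = (2 * PI * Ci * c)%C).
    { unfold Cint. rewrite (surjective_pairing (2 * PI * Ci * c)%C).
      f_equal; apply is_RInt_unique.
      - exact (is_RInt_fct_extend_fst g 0 (2 * PI) _ Hres).
      - exact (is_RInt_fct_extend_snd g 0 (2 * PI) _ Hres). }
    assert (Hm : forall t, Cmod (Z + circ eps t - Z) = eps).
    { intros t. replace (Z + circ eps t - Z)%C with (circ eps t) by ring. apply Cmod_circ. lra. }
    assert (Pc : forall t, pcont (fun t => (Ci * circ eps t) * h (Z + circ eps t))%C t).
    { intros t. apply pcont_mult; [apply pcont_mult; [apply pcont_const|apply pcont_circ]|].
      apply (pcont_comp (fun u => h (Z + u)%C)); [apply pcont_circ|].
      destruct (Hh (Z + circ eps t)%C) as [l Hl]; [rewrite Hm; lra|].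
      eapply Cder_cont. apply Cder_shift. exact Hl. }
    assert (Eg : Cint g 0 (2 * PI) = (Ci * c0 * RtoC (2 * PI) + Cint (fun t => (Ci * circ eps t) * h (Z + circ eps t))%C 0 (2 * PI))%C).
    { rewrite (Cint_ext g (fun t => Ci * c0 + (Ci * circ eps t) * h (Z + circ eps t))%C).
      - rewrite Cint_plus, Cint_const; [|intros t _; apply pcont_const|intros t _; apply Pc].
        rewrite Rminus_0_r. reflexivity.
      - intros t _. unfold g. fold (circ eps t).
        assert (N : circ eps t <> 0%C) by (apply circ_neq_0; lra).
        rewrite HV.
        + replace (Z + circ eps t - Z)%C with (circ eps t) by ring.
          replace (RtoC eps * Ci * cexpi t)%C with (Ci * circ eps t)%C by (unfold circ; ring).
          field. auto.
        + rewrite Hm. lra.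
        + intros Q. apply N. replace (circ eps t) with (Z + circ eps t - Z)%C by ring. rewrite Q. ring. }
    rewrite Hg in Eg.
    replace (RtoC (2 * PI) * Ci * (c - c0))%C with (Cint (fun t => (Ci * circ eps t) * h (Z + circ eps t))%C 0 (2 * PI)).
    2:{ match type of Eg with _ = (?x + ?y)%C => replace y with (x + y - x)%C by ring end.
        rewrite <- Eg, RtoC_mult. ring. }
    replace (2 * PI) with (Rabs (2 * PI - 0)) at 2 by (rewrite Rabs_pos_eq; lra).
    apply Cint_bound; [intros t _; apply Pc|]. intros t _.
    rewrite !Cmod_mult, Cmod_Ci, Cmod_circ by lra. rewrite Rmult_1_l. apply Rmult_le_compat_l; [lra|].
    apply HhM. rewrite Hm. lra. }
  set (v := Cmod (RtoC (2 * PI) * Ci * (c - c0))) in *.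
  assert (Hv : v <= 0).
  { apply Rnot_lt_le. intros Hpos. set (e1 := Rmin e0 (Rmin d d1)) in *.
    assert (P1 : 0 < e1) by (unfold e1; repeat apply Rmin_pos; auto).
    assert (P2 : 0 < v / (8 * PI * M)) by (apply Rdiv_lt_0_compat; nra).
    set (eps := Rmin (e1 / 2) (v / (8 * PI * M))).
    assert (P3 : 0 < eps) by (apply Rmin_pos; lra).
    assert (P4 : eps <= e1 / 2) by apply Rmin_l.
    assert (P5 : eps <= v / (8 * PI * M)) by apply Rmin_r.
    specialize (K eps ltac:(lra)).
    assert (2 * (eps * M) * (2 * PI) <= v / 2); [|lra].
    apply Rle_trans with (2 * (v / (8 * PI * M) * M) * (2 * PI)); [|right; field; lra].
    apply Rmult_le_compat_r; [lra|]. apply Rmult_le_compat_l; [lra|]. apply Rmult_le_compat_r; lra. }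
  unfold v in Hv. rewrite !Cmod_mult, Cmod_Ci, Cmod_R, Rabs_pos_eq in Hv by lra.
  apply Cmod_minus_0_eq. pose proof (Cmod_ge_0 (c - c0)). nra.
Qed.

(** Taylor coefficients at 0 of minus the polar sum, because -c / (x - Z) is the sum of c x^k /
    Z^(k+1). *)
Fixpoint polar_coef (L : list (C * C)) (k : nat) : C :=
  match L with nil => 0%C | q :: L => (snd q * (/ fst q) ^ S k + polar_coef L k)%C end.

Fixpoint term_sum (L : list (C * C)) (N : nat) : C :=
  match L with nil => 0%C | q :: L => (term (snd q) (fst q) N + term_sum L N)%C end.

Lemma csum_S (u : nat -> C) (n : nat) : csum u (S n) = (csum u n + u n)%C.
Proof. reflexivity. Qed.

Lemma geom_Ccv (Z x c : C) : Cmod x < Cmod Z ->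
  Ccv (csum (fun k => c * (/ Z) ^ S k * x ^ k)%C) (- (c / (x - Z)))%C.
Proof.
  intros H. pose proof (Cmod_ge_0 x).
  assert (NZ : Z <> 0%C) by (apply Cmod_gt_0; lra).
  assert (Nx : (x - Z)%C <> 0%C) by (apply Cminus_neq_0; intros ->; lra).
  assert (E : forall n, csum (fun k => c * (/ Z) ^ S k * x ^ k)%C n = (- (c / (x - Z)) + c / (x - Z) * (x / Z) ^ n)%C).
  { induction n as [|n IH]; [simpl; ring|]. rewrite csum_S, IH.
    unfold Cdiv at 3 5. rewrite (Cpow_S (x * / Z)), !Cpow_mult_l, Cpow_S. field. auto. }
  apply (Ccv_geom _ _ (Cmod (c / (x - Z))) (Cmod x / Cmod Z)).
  - split; [apply Rdiv_le_0_compat; lra|]. apply Rmult_lt_reg_r with (Cmod Z); [lra|].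
    unfold Rdiv. rewrite Rmult_assoc, Rinv_l; lra.
  - intros n. rewrite E.
    match goal with |- Cmod (?a + ?b - ?a) <= _ => replace (a + b - a)%C with b by ring end.
    rewrite Cmod_mult, Cmod_pow, (Cmod_div x Z) by auto. lra.
Qed.

Lemma polar_coef_Ccv (L : list (C * C)) (x : C) : (forall q, In q L -> Cmod x < Cmod (fst q)) ->
  Ccv (csum (fun k => polar_coef L k * x ^ k)%C) (- polar_sum L x)%C.
Proof.
  induction L as [|q L IH]; intros H; simpl.
  - intros eps He. exists 0%nat. intros n _.
    rewrite (csum_ext _ (fun _ => 0 * 0)%C) by (intros; ring). rewrite csum_scal.
    replace (0 * csum (fun _ => 0%C) n - - 0)%C with (RtoC 0) by ring. rewrite Cmod_0. auto.
  - replace (- (snd q / (x - fst q) + polar_sum L x))%C with (- (snd q / (x - fst q)) + - polar_sum L x)%C by ring.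
    eapply Ccv_ext; [|apply Ccv_plus; [apply (geom_Ccv (fst q) x (snd q)); apply H; left; auto|apply IH; intros; apply H; right; auto]].
    intros n. cbv beta. rewrite <- csum_plus. apply csum_ext. intros k. rewrite Cpow_S. ring.
Qed.

Lemma polar_coef_bound (L : list (C * C)) : (forall q, In q L -> 1 < Cmod (fst q)) ->
  exists B, forall k, Cmod (polar_coef L k) <= B.
Proof.
  induction L as [|q L IH]; intros H.
  - exists 0. intros k. simpl. rewrite Cmod_0. lra.
  - destruct IH as [B HB]; [intros; apply H; right; auto|]. exists (Cmod (snd q) + B). intros k.
    change (Cmod (snd q * (/ fst q) ^ S k + polar_coef L k) <= Cmod (snd q) + B).
    eapply Rle_trans; [apply Cmod_triangle|]. apply Rplus_le_compat; auto.
    specialize (H q (or_introl eq_refl)).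
    rewrite Cmod_mult, Cmod_pow, Cmod_inv by (apply Cmod_gt_0; lra).
    rewrite <- (Rmult_1_r (Cmod (snd q))) at 2. apply Rmult_le_compat_l; [apply Cmod_ge_0|].
    rewrite <- (pow1 (S k)). apply pow_incr. split; [left; apply Rinv_0_lt_compat; lra|].
    rewrite <- Rinv_1. apply Rinv_le_contravar; lra.
Qed.

Lemma term_neq_0 (Z : C) : 1 < Cmod Z -> Z <> 0%C /\ (1 - Z)%C <> 0%C.
Proof.
  intros H. split; [apply Cmod_gt_0; lra|]. apply Cminus_neq_0. intros E. rewrite <- E, Cmod_1 in H. lra.
Qed.

(** The factor 1 / (1 - Z) in [term] is what summation of a geometric tail produces: [term_sum]
    stands to -[polar_coef] as the tail probability stands to the point masses. *)
Lemma term_sum_step (L : list (C * C)) (N : nat) : (forall q, In q L -> 1 < Cmod (fst q)) ->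
  (term_sum L N - term_sum L (S N) = - polar_coef L (S N))%C.
Proof.
  induction L as [|q L IH]; intros H; simpl term_sum; [simpl; ring|].
  change (polar_coef (q :: L) (S N)) with (snd q * (/ fst q) ^ S (S N) + polar_coef L (S N))%C.
  replace (term (snd q) (fst q) N + term_sum L N - (term (snd q) (fst q) (S N) + term_sum L (S N)))%C
    with ((term (snd q) (fst q) N - term (snd q) (fst q) (S N)) + (term_sum L N - term_sum L (S N)))%C by ring.
  rewrite IH by (intros; apply H; right; auto).
  destruct (term_neq_0 (fst q) (H q (or_introl eq_refl))) as [N1 N2].
  unfold term. rewrite !Nat.add_1_r. rewrite Cpow_inv by auto. rewrite !(Cpow_S (fst q)).
  field. repeat split; auto. apply Cpow_nz; auto.
Qed.

Lemma Cmod_term (c Z : C) (N : nat) : 1 < Cmod Z ->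
  Cmod (term c Z N) = Cmod c / (Cmod (1 - Z) * Cmod Z) * / Cmod Z ^ N.
Proof.
  intros H. destruct (term_neq_0 Z H) as [N1 N2]. unfold term.
  rewrite Cmod_div by (apply Cmult_neq_0; auto; apply Cpow_nz; auto).
  rewrite Cmod_mult, Cmod_pow, Nat.add_1_r. simpl. field.
  assert (0 < Cmod (1 - Z)) by (apply Cmod_gt_0; auto).
  repeat split; try lra. apply pow_nonzero. lra.
Qed.

Lemma term_sum_lim (L : list (C * C)) : (forall q, In q L -> 1 < Cmod (fst q)) -> Ccv (term_sum L) 0%C.
Proof.
  induction L as [|q L IH]; intros H.
  - intros eps He. exists 0%nat. intros n _. simpl. replace (0 - 0)%C with (RtoC 0) by ring. rewrite Cmod_0. auto.
  - replace (RtoC 0) with (0 + 0)%C by ring. apply (Ccv_plus (fun N => term (snd q) (fst q) N)).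
    + specialize (H q (or_introl eq_refl)).
      apply (Ccv_geom _ _ (Cmod (snd q) / (Cmod (1 - fst q) * Cmod (fst q))) (/ Cmod (fst q))).
      * split; [left; apply Rinv_0_lt_compat; lra|]. rewrite <- Rinv_1. apply Rinv_lt_contravar; lra.
      * intros N. replace (term (snd q) (fst q) N - 0)%C with (term (snd q) (fst q) N) by ring.
        rewrite Cmod_term by auto. rewrite pow_inv. lra.
    + apply IH. intros; apply H; right; auto.
Qed.

Lemma tailP_step (pi : nat -> R) (N : nat) : is_pmf pi -> tailP pi N = pi (S N) + tailP pi (S N).
Proof.
  intros [_ Hs]. unfold tailP. rewrite Series_incr_1.
  - f_equal; [f_equal; lia|]. apply Series_ext. intros k. f_equal. lia.
  - rewrite <- (ex_series_incr_n pi (N + 1)). exists 1. exact Hs.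
Qed.

Lemma tailP_lim (pi : nat -> R) : is_pmf pi -> forall eps, 0 < eps ->
  exists N0, forall N, (N0 <= N)%nat -> Rabs (tailP pi N) < eps.
Proof.
  intros [_ Hs] eps He.
  destruct (proj1 (filterlim_locally _ _) Hs (mkposreal _ He)) as [N0 HN]. exists N0. intros N H.
  specialize (HN N H). change (Rabs (sum_n pi N - 1) < eps) in HN.
  assert (E : Series pi = sum_n pi N + tailP pi N).
  { rewrite (Series_incr_n pi (N + 1)); [|lia|exists 1; exact Hs].
    rewrite Nat.add_1_r. simpl pred. rewrite sum_n_Reals. f_equal. unfold tailP. apply Series_ext. intros k. f_equal. lia. }
  rewrite (is_series_unique _ _ Hs) in E.
  replace (tailP pi N) with (- (sum_n pi N - 1)) by lra. rewrite Rabs_Ropp. exact HN.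
Qed.

(** Removing the polar parts leaves H with Taylor coefficients h_k = pi_k + [polar_coef] k, and
    Cauchy's estimate gives |h_k| <= K rho^-k. The difference D of the tail and [term_sum] satisfies
    D(N) - D(N+1) = Re h_(N+1) and tends to 0, so it is bounded by a geometric tail. *)
Lemma tail_expansion (pi : nat -> R) (V : C -> C) (L : list (C * C)) (rho r : R) :
  is_pmf pi -> (forall z, Cmod z < 1 -> V z = pgf pi z) -> NoDup (map fst L) ->
  (forall q, In q L -> 1 < Cmod (fst q)) ->
  (forall z, Cmod z < r -> ~ In z (map fst L) -> Cdiff V z) ->
  (forall q, In q L -> pole_at V (fst q) (snd q)) -> 1 < rho < r ->
  exists K, 0 <= K /\ forall N, Rabs (tailP pi N - Re (term_sum L N)) <= K * / rho ^ N.
Proof.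
  intros Hpi HV ND HL Hhol Hpol Hrho.
  destruct (remove_poles L V r ND Hhol Hpol) as [H [HH1 HH2]].
  destruct (holomorphic_power_series_0 H r rho ltac:(lra) HH1) as [h [K [Hh Hs]]].
  assert (Hpib : forall k, 0 <= pi k <= 1) by (intros; apply pmf_le_1; auto).
  destruct (polar_coef_bound L HL) as [B HB].
  assert (E : forall k, h k = (RtoC (pi k) + polar_coef L k)%C).
  { apply (cps_unique _ _ rho 1 K (1 + B) 1 (fun x => H (RtoC x))); auto; try lra.
    - intros k. rewrite pow1, Rmult_1_r. eapply Rle_trans; [apply Cmod_triangle|].
      rewrite Cmod_R, Rabs_pos_eq by apply Hpib. apply Rplus_le_compat; [apply Hpib|auto].
    - intros x Hx. apply Hs. rewrite Cmod_R. lra.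
    - intros x Hx. assert (Hx' : Cmod (RtoC x) < 1) by (rewrite Cmod_R; auto).
      assert (Nx : ~ In (RtoC x) (map fst L)).
      { intros Q. apply in_map_iff in Q. destruct Q as [q [Q1 Q2]]. specialize (HL q Q2). rewrite Q1 in HL. lra. }
      replace (H (RtoC x)) with (pgf pi (RtoC x) + - polar_sum L (RtoC x))%C
        by (rewrite <- HV, (HH2 _ Nx) by auto; ring).
      eapply Ccv_ext; [|apply Ccv_plus; [apply pgf_Ccv|apply polar_coef_Ccv]].
      + intros n. cbv beta. rewrite <- csum_plus. apply csum_ext. intros k. ring.
      + rewrite Cmod_R. apply CV_radius_bounded_1; auto.
      + intros q Hq. specialize (HL q Hq). lra. }
  assert (HK : 0 <= K). { eapply Rle_trans; [|apply (Hh 0%nat)]. simpl. pose proof (Cmod_ge_0 (h 0%nat)). lra. }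
  set (D := fun N => tailP pi N - Re (term_sum L N)).
  assert (Hstep : forall N, Rabs (D N) <= Rabs (D (S N)) + K * / rho ^ S N).
  { intros N. unfold D. rewrite (tailP_step pi N Hpi).
    assert (Er : Re (term_sum L N) = Re (term_sum L (S N)) - Re (polar_coef L (S N))).
    { pose proof (f_equal Re (term_sum_step L N HL)) as Q. unfold Re in *. simpl in Q. simpl. lra. }
    rewrite Er.
    assert (Eh : pi (S N) + Re (polar_coef L (S N)) = Re (h (S N))).
    { rewrite E. unfold Re. simpl. ring. }
    replace (pi (S N) + tailP pi (S N) - (Re (term_sum L (S N)) - Re (polar_coef L (S N))))
      with (tailP pi (S N) - Re (term_sum L (S N)) + Re (h (S N))) by lra.
    eapply Rle_trans; [apply Rabs_triang|]. apply Rplus_le_compat_l.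
    eapply Rle_trans; [apply re_le_Cmod|]. pose proof (pow_lt rho (S N) ltac:(lra)).
    apply Rmult_le_reg_r with (rho ^ S N); auto. rewrite Rmult_assoc, Rinv_l by lra. rewrite Rmult_1_r. auto. }
  (* The sum of K rho^-i over i > N is K' rho^-N. *)
  set (K' := K / (rho - 1)). assert (HK' : 0 <= K') by (unfold K'; apply Rdiv_le_0_compat; lra).
  exists K'. split; auto. intros N. fold (D N).
  (* In this form the excess of |D| over the bound never decreases with the index, so a positive
     excess would contradict the convergence of D to 0. *)
  assert (Hi : forall i, Rabs (D N) - K' * / rho ^ N <= Rabs (D (N + i)%nat) - K' * / rho ^ (N + i)).
  { induction i as [|i IH]; [rewrite Nat.add_0_r; lra|].
    eapply Rle_trans; [exact IH|]. rewrite Nat.add_succ_r. specialize (Hstep (N + i)%nat).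
    pose proof (pow_lt rho (N + i) ltac:(lra)) as P.
    assert (Q : K * / rho ^ S (N + i) = K' * / rho ^ (N + i) - K' * / rho ^ S (N + i)).
    { unfold K'. simpl. field. repeat split; lra. }
    lra. }
  apply Rnot_lt_le. intros Hlt.
  destruct (tailP_lim pi Hpi ((Rabs (D N) - K' * / rho ^ N) / 4)) as [N1 T1]; [lra|].
  destruct (term_sum_lim L HL ((Rabs (D N) - K' * / rho ^ N) / 4)) as [N2 T2]; [lra|].
  specialize (Hi (Nat.max N1 N2)). specialize (T1 (N + Nat.max N1 N2)%nat ltac:(lia)).
  specialize (T2 (N + Nat.max N1 N2)%nat ltac:(lia)).
  set (n := (N + Nat.max N1 N2)%nat) in *.
  replace (term_sum L n - 0)%C with (term_sum L n) in T2 by ring.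
  pose proof (re_le_Cmod (term_sum L n)).
  assert (Rabs (D n) <= Rabs (tailP pi n) + Rabs (Re (term_sum L n))).
  { unfold D, Rminus. eapply Rle_trans; [apply Rabs_triang|]. rewrite Rabs_Ropp. lra. }
  assert (0 <= K' * / rho ^ n).
  { apply Rmult_le_pos; auto. left. apply Rinv_0_lt_compat, pow_lt. lra. }
  lra.
Qed.

(** * Zeros near 1 *)

Lemma csum_delta (c : C) (k n : nat) : csum (fun i => if Nat.eqb i k then c else 0%C) n
  = if Nat.ltb k n then c else 0%C.
Proof.
  induction n as [|n IH]; [reflexivity|]. rewrite csum_S, IH.
  destruct (Nat.eqb_spec n k), (Nat.ltb_spec k n), (Nat.ltb_spec k (S n)); try lia; ring.
Qed.

Lemma Ccv_delta (c : C) (k : nat) : Ccv (csum (fun i => if Nat.eqb i k then c else 0%C)) c.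
Proof.
  intros eps He. exists (S k). intros n Hn. rewrite csum_delta.
  destruct (Nat.ltb_spec k n); [|lia]. unfold Cminus. rewrite Cplus_opp_r, Cmod_0. auto.
Qed.

Lemma is_series_delta (c : R) (k : nat) : is_series (fun i => if Nat.eqb i k then c else 0) c.
Proof.
  pose proof (proj1 (Ccv_is_series _ _ (Ccv_delta (RtoC c) k))) as H. simpl in H.
  eapply is_series_ext; [|exact H]. intros i. simpl. destruct (Nat.eqb i k); reflexivity.
Qed.

(** Two atoms are kept to exhibit cancellation, and all the others are estimated by their masses. *)
Lemma pgf_two_terms (p : nat -> R) (e : C) (k l : nat) : is_pmf p -> Rbar_lt 1 (CV_radius p) ->
  Cmod e = 1 -> k <> l ->
  Cmod (pgf p e) <= Cmod (RtoC (p k) * e ^ k + RtoC (p l) * e ^ l) + (1 - p k - p l).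
Proof.
  intros Hp Hr He Hkl.
  set (q := fun i => p i - (if Nat.eqb i k then p k else 0) - (if Nat.eqb i l then p l else 0)).
  assert (Hq : forall i, 0 <= q i).
  { intros i. unfold q. pose proof (proj1 Hp i).
    destruct (Nat.eqb_spec i k), (Nat.eqb_spec i l); subst; try lia; lra. }
  assert (Sq : is_series q (1 - p k - p l)).
  { apply (is_series_minus (V:=R_NormedModule)); [|apply is_series_delta].
    apply (is_series_minus (V:=R_NormedModule)); [apply Hp|apply is_series_delta]. }
  assert (Cq : Ccv (csum (fun i => RtoC (q i) * e ^ i)%C)
     (pgf p e + (-(1) * (RtoC (p k) * e ^ k) + -(1) * (RtoC (p l) * e ^ l)))%C).
  { eapply Ccv_ext; [|apply Ccv_plus; [apply (pgf_Ccv p e); rewrite He; exact Hr|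
      apply Ccv_plus; apply Ccv_scal; [apply (Ccv_delta (RtoC (p k) * e ^ k)%C k)|apply (Ccv_delta (RtoC (p l) * e ^ l)%C l)]]].
    intros n. cbv beta. rewrite <- !csum_scal, <- !csum_plus. apply csum_ext. intros i. unfold q.
    rewrite !RtoC_minus. destruct (Nat.eqb_spec i k), (Nat.eqb_spec i l); subst; ring. }
  assert (B : Cmod (pgf p e + (-(1) * (RtoC (p k) * e ^ k) + -(1) * (RtoC (p l) * e ^ l))) <= 1 - p k - p l).
  { rewrite <- (is_series_unique _ _ Sq). refine (Ccv_csum_bound _ _ _ _ _ Cq).
    - intros i. rewrite Cmod_mult, Cmod_pow, He, pow1, Cmod_R, Rabs_pos_eq by auto. lra.
    - eexists; exact Sq. }
  pose proof (Cmod_triangle (pgf p e + (-(1) * (RtoC (p k) * e ^ k) + -(1) * (RtoC (p l) * e ^ l)))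
    (RtoC (p k) * e ^ k + RtoC (p l) * e ^ l)) as T.
  replace (pgf p e + (-(1) * (RtoC (p k) * e ^ k) + -(1) * (RtoC (p l) * e ^ l)) + (RtoC (p k) * e ^ k + RtoC (p l) * e ^ l))%C
    with (pgf p e) in T by ring. lra.
Qed.

Lemma cexpi_plus (a b : R) : cexpi (a + b) = (cexpi a * cexpi b)%C.
Proof. unfold cexpi, Cmult. simpl. rewrite cos_plus, sin_plus. f_equal; ring. Qed.

Lemma cexpi_pow (t : R) (n : nat) : (cexpi t ^ n)%C = cexpi (INR n * t).
Proof.
  induction n as [|n IH].
  - simpl. unfold cexpi. rewrite Rmult_0_l, cos_0, sin_0. reflexivity.
  - rewrite S_INR, Cpow_S, IH. replace ((INR n + 1) * t) with (t + INR n * t) by ring.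
    rewrite cexpi_plus. reflexivity.
Qed.

Lemma sin_ge_half (x : R) : 0 <= x <= 1 -> x / 2 <= sin x.
Proof.
  intros Hx.
  destruct (MVT_gen sin 0 x cos) as [c [Hc E]].
  - intros t _. apply is_derive_sin.
  - intros t _. apply continuity_sin.
  - rewrite Rmin_left, Rmax_right in Hc by lra. rewrite sin_0 in E.
    assert (1 / 2 <= cos c).
    { rewrite <- cos_PI3. pose proof PI2_3_2. apply cos_decr_1; lra. }
    nra.
Qed.

Lemma one_minus_cos_ge (x : R) : Rabs x <= 1 -> x ^ 2 / 8 <= 1 - cos x.
Proof.
  intros Hx. assert (K : forall x, 0 <= x <= 1 -> x ^ 2 / 8 <= 1 - cos x).
  { clear x Hx. intros x Hx. replace x with (2 * (x / 2)) at 2 by field. rewrite cos_2a_sin.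
    pose proof (sin_ge_half (x / 2) ltac:(lra)). nra. }
  unfold Rabs in Hx. destruct (Rcase_abs x).
  - rewrite <- cos_neg. replace (x ^ 2) with ((- x) ^ 2) by ring. apply K; lra.
  - apply K; lra.
Qed.

Lemma Cmod_cexpi_minus_1 (t : R) : 0 <= t -> Cmod (cexpi t - 1) <= t.
Proof.
  intros Ht. apply Rsqr_incr_0_var; auto. rewrite !Rsqr_pow2, Cmod2_alt.
  unfold cexpi, Re, Im. simpl fst. simpl snd.
  assert (E : (cos t + - (1)) ^ 2 + (sin t + - 0) ^ 2 = 4 * (sin (t / 2) * sin (t / 2))).
  { pose proof (sin2_cos2 t) as S. unfold Rsqr in S.
    assert (C2 : cos t = 1 - 2 * sin (t / 2) * sin (t / 2)).
    { rewrite <- cos_2a_sin. f_equal. field. }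
    replace ((cos t + - (1)) ^ 2 + (sin t + - 0) ^ 2) with (sin t * sin t + cos t * cos t + 1 - 2 * cos t) by ring.
    rewrite S, C2. ring. }
  rewrite E.
  assert (B : Rabs (sin (t / 2)) <= t / 2).
  { destruct (Req_dec t 0) as [->|N]; [unfold Rdiv; rewrite Rmult_0_l, sin_0, Rabs_R0; lra|].
    apply Rabs_le. pose proof (sin_lt_x (t / 2) ltac:(lra)).
    destruct (Rle_dec 1 (t / 2)); [pose proof (SIN_bound (t / 2)); lra|].
    pose proof (sin_ge_half (t / 2) ltac:(lra)). lra. }
  assert (0 <= Rabs (sin (t / 2))) by apply Rabs_pos.
  replace (sin (t / 2) * sin (t / 2)) with (Rabs (sin (t / 2)) * Rabs (sin (t / 2)))
    by (rewrite <- Rabs_mult; apply Rabs_pos_eq; nra).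
  nra.
Qed.

Lemma unit_circle_param (e : C) : Cmod e = 1 ->
  exists t, 0 <= t <= PI /\ (e = cexpi t \/ Cconj e = cexpi t).
Proof.
  intros He. assert (H2 : Re e ^ 2 + Im e ^ 2 = 1) by (rewrite <- Cmod2_alt, He; ring).
  assert (HR : -1 <= Re e <= 1) by nra.
  exists (acos (Re e)). split; [apply acos_bound|].
  unfold cexpi. rewrite cos_acos, sin_acos by auto.
  replace (1 - (Re e)²) with ((Im e)²) by (unfold Rsqr; nra).
  destruct (Rle_dec 0 (Im e)).
  - left. rewrite sqrt_Rsqr by auto. apply surjective_pairing.
  - right. rewrite Rsqr_neg, sqrt_Rsqr by lra. reflexivity.
Qed.

Section Local.
Variable p : nat -> R.
Hypothesis Hp : is_pmf p.
Hypothesis Hr : Rbar_lt 1 (CV_radius p).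
Hypothesis Haper : forall z, Cmod z = 1 -> z <> 1%C -> Cmod (pgf p z) < 1.

(** A law concentrated in one point would have |X(-1)| = 1, against aperiodicity. *)
Lemma two_atoms : exists k l, (k < l)%nat /\ 0 < p k /\ 0 < p l.
Proof.
  destruct (pmf_exists_pos p Hp) as [k Hk].
  assert (exists l, l <> k /\ 0 < p l) as [l [Hl Hpl]].
  { apply NNPP. intros N.
    assert (Z : forall l, l <> k -> p l = 0).
    { intros l Hl. pose proof (proj1 Hp l). destruct (Req_dec (p l) 0); auto. exfalso. apply N. exists l. split; auto. lra. }
    assert (E1 : p k = 1).
    { rewrite <- (is_series_unique p 1 (proj2 Hp)).
      rewrite <- (is_series_unique _ _ (is_series_delta (p k) k)). apply Series_ext.
      intros i. destruct (Nat.eqb_spec i k); subst; auto. symmetry; auto. }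
    assert (E2 : pgf p (-(1))%C = (RtoC (p k) * (-(1)) ^ k)%C).
    { assert (M1 : Rbar_lt (Cmod (-(1))) (CV_radius p)) by (rewrite Cmod_opp, Cmod_1; exact Hr).
      apply (Ccv_unique _ _ _ (pgf_Ccv p (-(1))%C M1)).
      eapply Ccv_ext; [|apply (Ccv_delta (RtoC (p k) * (-(1)) ^ k)%C k)].
      intros n. apply csum_ext. intros i. destruct (Nat.eqb_spec i k); subst; auto. rewrite Z by auto. ring. }
    assert (Hne : (-(1))%C <> 1%C). { intros Q. apply (f_equal Re) in Q. unfold Re in Q. simpl in Q. lra. }
    assert (Hm : Cmod (-(1)) = 1) by (rewrite Cmod_opp, Cmod_1; auto).
    pose proof (Haper (-(1))%C Hm Hne) as Q.
    rewrite E2, Cmod_mult, Cmod_pow, Hm, pow1, E1, Cmod_1 in Q. lra. }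
  destruct (Nat.lt_ge_cases k l); [exists k, l; auto|]. exists l, k. repeat split; auto. lia.
Qed.

Lemma pgf_at_1 : pgf p 1%C = 1%C.
Proof.
  rewrite pgf_real. f_equal. unfold PSeries. rewrite (Series_ext _ p) by (intros k; rewrite pow1; ring).
  apply is_series_unique, Hp.
Qed.

Lemma pgf_unit_cont (t : R) : pcont (fun t => pgf p (cexpi t)) t.
Proof.
  apply (pcont_comp (pgf p)).
  - apply (Ccont_ext_loc (fun z => circ 1 (Re z)) _ _ 1); [lra| |apply pcont_circ].
    intros u _. unfold circ. ring.
  - eapply Cder_cont. apply pgf_Cder. rewrite Cmod_cexpi. exact Hr.
Qed.

(** A quadratic gap is what turns equality of moduli at a zero into z - 1 = O(1 / sqrt s). For small
    angles it comes from the phase difference of two atoms, for the remaining angles from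
    compactness and aperiodicity. *)
Lemma pgf_unit_circle_gap : exists kappa, 0 < kappa /\
  forall e, Cmod e = 1 -> Cmod (pgf p e) <= 1 - kappa * Cmod (e - 1) ^ 2.
Proof.
  destruct two_atoms as [k [l [Hkl [Hk Hl]]]].
  set (d := INR (l - k)). assert (Hd : 1 <= d).
  { unfold d. change 1 with (INR 1). apply le_INR. lia. }
  set (kap1 := p k * p l / (8 * (p k + p l))).
  assert (Hk1 : 0 < kap1) by (unfold kap1; apply Rdiv_lt_0_compat; nra).
  assert (Near : forall t, 0 <= t <= / d -> Cmod (pgf p (cexpi t)) <= 1 - kap1 * t ^ 2).
  { intros t Ht. eapply Rle_trans; [apply (pgf_two_terms p (cexpi t) k l); auto; [apply Cmod_cexpi|lia]|].
    replace (cexpi t ^ l)%C with (cexpi t ^ k * cexpi (d * t))%C.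
    2:{ unfold d. rewrite <- cexpi_pow, <- Cpow_add_r. f_equal. lia. }
    replace (RtoC (p k) * cexpi t ^ k + RtoC (p l) * (cexpi t ^ k * cexpi (d * t)))%C
      with (cexpi t ^ k * (RtoC (p k) + RtoC (p l) * cexpi (d * t)))%C by ring.
    rewrite Cmod_mult, Cmod_pow, Cmod_cexpi, pow1, Rmult_1_l.
    assert (Hdt : 0 <= d * t <= 1).
    { split; [nra|]. apply Rle_trans with (d * / d); [apply Rmult_le_compat_l; lra|right; field; lra]. }
    pose proof (one_minus_cos_ge (d * t) ltac:(rewrite Rabs_pos_eq; lra)) as C1.
    assert (C2 : t ^ 2 <= (d * t) ^ 2) by (apply pow_incr; nra).
    set (A := p k + p l). assert (HA : 0 < A) by (unfold A; lra).
    set (y := 1 - cos (d * t)) in *.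
    assert (Hy : 0 <= y <= 2) by (unfold y; pose proof (COS_bound (d * t)); lra).
    (* The squared modulus is A^2 - 2 p_k p_l y, and the square of the right-hand side exceeds it by
       the completed square. *)
    assert (Q : Cmod (RtoC (p k) + RtoC (p l) * cexpi (d * t)) <= A - p k * p l * y / A).
    { apply Rsqr_incr_0_var.
      - rewrite !Rsqr_pow2, Cmod2_alt. unfold cexpi, Re, Im. simpl fst. simpl snd.
        assert (E : (p k + (p l * cos (d * t) - 0 * sin (d * t))) ^ 2 + (0 + (p l * sin (d * t) + 0 * cos (d * t))) ^ 2
           = A ^ 2 - 2 * (p k * p l) * y).
        { pose proof (sin2_cos2 (d * t)) as S. unfold Rsqr in S. unfold A, y.
          replace ((p k + (p l * cos (d * t) - 0 * sin (d * t))) ^ 2 + (0 + (p l * sin (d * t) + 0 * cos (d * t))) ^ 2)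
            with (p k ^ 2 + 2 * p k * p l * cos (d * t) + p l ^ 2 * (sin (d * t) * sin (d * t) + cos (d * t) * cos (d * t))) by ring.
          rewrite S. ring. }
        rewrite E.
        replace ((A - p k * p l * y / A) ^ 2) with (A ^ 2 - 2 * (p k * p l) * y + (p k * p l * y / A) ^ 2) by (field; lra).
        pose proof (pow2_ge_0 (p k * p l * y / A)). lra.
      - cut (p k * p l * y / A <= A); [lra|]. apply Rmult_le_reg_r with A; auto.
        replace (p k * p l * y / A * A) with (p k * p l * y) by (field; lra).
        unfold A. apply Rle_trans with (p k * p l * 2); [apply Rmult_le_compat_l; nra|nra]. }
    apply Rle_trans with (A - p k * p l * y / A + (1 - p k - p l)); [lra|].
    replace (A - p k * p l * y / A + (1 - p k - p l)) with (1 - p k * p l * y / A) by (unfold A; ring).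
    assert (kap1 * t ^ 2 <= p k * p l * y / A); [|lra].
    unfold kap1. fold A. replace (p k * p l / (8 * A) * t ^ 2) with (p k * p l * (t ^ 2 / 8) / A) by (field; lra).
    apply Rmult_le_compat_r; [left; apply Rinv_0_lt_compat; auto|]. apply Rmult_le_compat_l; nra. }
  assert (Hid : 0 < / d) by (apply Rinv_0_lt_compat; lra).
  assert (Hid1 : / d <= 1) by (rewrite <- Rinv_1; apply Rinv_le_contravar; lra).
  pose proof PI2_3_2 as HPI.
  destruct (continuity_ab_maj (fun t => Cmod (pgf p (cexpi t))) (/ d) PI) as [tm [Hmax Htm]]; [lra| |].
  { intros t Ht. apply continuity_pt_filterlim. apply continuous_eps_delta. intros eps He.
    destruct (proj1 (pcont_iff _ _) (pgf_unit_cont t) eps He) as [del [D Hdel]]. exists del. split; auto.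
    intros u Hu. specialize (Hdel u Hu). eapply Rle_lt_trans; [|exact Hdel]. apply Rabs_le.
    pose proof (Cmod_minus_ge (pgf p (cexpi u)) (pgf p (cexpi t))) as A1.
    pose proof (Cmod_minus_ge (pgf p (cexpi t)) (pgf p (cexpi u))) as A2.
    rewrite (Cmod_minus_sym (pgf p (cexpi t))) in A2. lra. }
  assert (Hlt : Cmod (pgf p (cexpi tm)) < 1).
  { apply Haper; [apply Cmod_cexpi|]. intros E. apply (f_equal Re) in E. unfold cexpi, Re in E. simpl in E.
    assert (cos tm < cos 0); [|rewrite cos_0 in *; lra]. apply cos_decreasing_1; lra. }
  set (ep := 1 - Cmod (pgf p (cexpi tm))).
  (* Away from 1 the gap is at least [ep], while |e - 1|^2 <= 4. *)
  exists (Rmin kap1 (ep / 4)). split; [apply Rmin_pos; unfold ep; lra|].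
  assert (G : forall t, 0 <= t <= PI -> Cmod (pgf p (cexpi t)) <= 1 - Rmin kap1 (ep / 4) * Cmod (cexpi t - 1) ^ 2).
  { intros t Ht. pose proof (Rmin_l kap1 (ep / 4)) as M1. pose proof (Rmin_r kap1 (ep / 4)) as M2.
    assert (M0 : 0 < Rmin kap1 (ep / 4)) by (apply Rmin_pos; unfold ep; lra).
    set (m := Rmin kap1 (ep / 4)) in *.
    pose proof (Cmod_ge_0 (cexpi t - 1)) as P0. pose proof (Cmod_cexpi_minus_1 t ltac:(lra)) as P1.
    set (x := Cmod (cexpi t - 1)) in *.
    destruct (Rle_dec t (/ d)) as [Hn|Hf].
    - specialize (Near t ltac:(lra)). assert (m * x ^ 2 <= kap1 * t ^ 2); [|lra].
      apply Rmult_le_compat; try lra; [apply pow2_ge_0|apply pow_incr; lra].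
    - specialize (Hmax t ltac:(lra)). simpl in Hmax.
      assert (x <= 2). { unfold x. eapply Rle_trans; [apply Cmod_triangle_minus|]. rewrite Cmod_cexpi, Cmod_1. lra. }
      assert (m * x ^ 2 <= ep / 4 * 4); [|unfold ep in *; lra].
      apply Rmult_le_compat; try lra; [apply pow2_ge_0|nra]. }
  intros e He. destruct (unit_circle_param e He) as [t [Ht [->|E]]]; [apply G; auto|].
  rewrite <- (Cmod_conj (pgf p e)), <- pgf_conj, E.
  rewrite <- (Cmod_conj (e - 1)), Cminus_conj, E.
  replace (Cconj 1) with (RtoC 1) by (unfold Cconj, RtoC; simpl; f_equal; ring). apply G; auto.
Qed.

(** The increment along a radius has terms p_k (rho^k - 1) e^k with nonnegative p_k (rho^k - 1), so
    its modulus is largest in the direction 1. *)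
Lemma pgf_radial (rho : R) (e : C) : 1 <= rho -> Rbar_lt rho (CV_radius p) -> Cmod e = 1 ->
  Cmod (pgf p (RtoC rho * e)) <= PSeries p rho - 1 + Cmod (pgf p e).
Proof.
  intros H1 H2 He.
  assert (Hz : Cmod (RtoC rho * e) = rho) by (rewrite Cmod_mult, He, Cmod_R, Rabs_pos_eq; lra).
  assert (C1 : Ccv (csum (fun k => RtoC (p k) * ((RtoC rho * e) ^ k - e ^ k))%C) (pgf p (RtoC rho * e) + -(1) * pgf p e)%C).
  { eapply Ccv_ext; [|apply Ccv_plus; [apply (pgf_Ccv p (RtoC rho * e)%C); rewrite Hz; auto|
      apply Ccv_scal; apply (pgf_Ccv p e); rewrite He; exact Hr]].
    intros n. cbv beta. rewrite <- csum_scal, <- csum_plus. apply csum_ext. intros k. ring. }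
  assert (Sr : is_series (fun k => p k * rho ^ k) (PSeries p rho)).
  { apply Series_correct. pose proof (CV_radius_ex_series p rho ltac:(lra) H2) as H.
    eapply ex_series_ext; [|exact H]. intros k. simpl. rewrite Rabs_pos_eq; auto. apply Hp. }
  assert (Sd : is_series (fun k => p k * rho ^ k - p k) (PSeries p rho - 1)).
  { apply (is_series_minus (V:=R_NormedModule)); [exact Sr|apply Hp]. }
  assert (B : Cmod (pgf p (RtoC rho * e) + -(1) * pgf p e) <= PSeries p rho - 1).
  { rewrite <- (is_series_unique _ _ Sd). refine (Ccv_csum_bound _ _ _ _ _ C1); [|eexists; exact Sd].
    intros k. replace ((RtoC rho * e) ^ k - e ^ k)%C with ((RtoC (rho ^ k) - 1) * e ^ k)%C
      by (rewrite Cpow_mult_l, RtoC_pow; ring).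
    rewrite !Cmod_mult, Cmod_pow, He, pow1, <- RtoC_minus, !Cmod_R.
    rewrite (Rabs_pos_eq (p k)) by apply Hp. rewrite Rabs_pos_eq by (pose proof (pow_R1_Rle rho k H1); lra). lra. }
  pose proof (Cmod_triangle (pgf p (RtoC rho * e) + -(1) * pgf p e) (pgf p e)) as T.
  replace (pgf p (RtoC rho * e) + -(1) * pgf p e + pgf p e)%C with (pgf p (RtoC rho * e)) in T by ring. lra.
Qed.
End Local.

(* The principal logarithm on the half-plane [0 < Re c] (elsewhere a junk value). *)
Definition Clog (c : C) : C := (ln (Re c ^ 2 + Im c ^ 2) / 2, atan (Im c / Re c)).

(** The derivative is spelled out as the real part of the product of (dx, dy) with the inverse of
    (x, y), so that it matches [d / g t] in [pder_Clog] by conversion; likewise for the argument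
    below. *)
Lemma is_derive_ln_mod (x y : R -> R) (t dx dy : R) : is_derive x t dx -> is_derive y t dy -> 0 < x t ->
  is_derive (fun u => ln (x u ^ 2 + y u ^ 2) / 2) t
    (dx * (x t / (x t ^ 2 + y t ^ 2)) - dy * (- y t / (x t ^ 2 + y t ^ 2))).
Proof.
  intros D1 D2 Hpos. assert (P : 0 < x t ^ 2 + y t ^ 2) by (pose proof (pow2_ge_0 (y t)); nra).
  auto_derive.
  - repeat split; [eexists; exact D1|eexists; exact D2|]. simpl in P. lra.
  - replace (Derive (fun u => x u) t) with dx by (symmetry; apply is_derive_unique; exact D1).
    replace (Derive (fun u => y u) t) with dy by (symmetry; apply is_derive_unique; exact D2).
    field. simpl in P. lra.
Qed.

Lemma is_derive_arg (x y : R -> R) (t dx dy : R) : is_derive x t dx -> is_derive y t dy -> 0 < x t ->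
  is_derive (fun u => atan (y u / x u)) t
    (dx * (- y t / (x t ^ 2 + y t ^ 2)) + dy * (x t / (x t ^ 2 + y t ^ 2))).
Proof.
  intros D1 D2 Hpos. assert (P : 0 < x t ^ 2 + y t ^ 2) by (pose proof (pow2_ge_0 (y t)); nra).
  auto_derive.
  - repeat split; [eexists; exact D2|eexists; exact D1|lra].
  - replace (Derive (fun u => x u) t) with dx by (symmetry; apply is_derive_unique; exact D1).
    replace (Derive (fun u => y u) t) with dy by (symmetry; apply is_derive_unique; exact D2).
    field. simpl in P. repeat split; try lra; nra.
Qed.

Lemma pder_Clog (g : R -> C) (t : R) (d : C) : pder g t d -> 0 < Re (g t) ->
  pder (fun u => Clog (g u)) t (d / g t)%C.
Proof.
  intros Hg Hpos. destruct (pder_is_derive _ _ _ Hg) as [D1 D2].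
  apply is_derive_pder.
  - exact (is_derive_ln_mod _ _ _ _ _ D1 D2 Hpos).
  - exact (is_derive_arg _ _ _ _ _ D1 D2 Hpos).
Qed.

Lemma Clog_polar (c : C) : 0 < Re c ->
  c = (RtoC (Cmod c) * cexpi (Im (Clog c)))%C /\ ln (Cmod c) = Re (Clog c).
Proof.
  intros H. assert (P : 0 < Re c ^ 2 + Im c ^ 2) by (pose proof (pow2_ge_0 (Im c)); nra).
  assert (M : 0 < Cmod c) by (apply Cmod_gt_0; intros E; rewrite E in H; unfold Re in H; simpl in H; lra).
  split.
  - unfold Clog, cexpi. simpl Im. rewrite cos_atan, sin_atan.
    assert (E : sqrt (1 + (Im c / Re c)²) = Cmod c / Re c).
    { replace (1 + (Im c / Re c)²) with ((Cmod c / Re c)²).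
      - apply sqrt_Rsqr. apply Rdiv_le_0_compat; lra.
      - unfold Rsqr. replace (Cmod c / Re c * (Cmod c / Re c)) with (Cmod c ^ 2 / Re c ^ 2) by (field; lra).
        rewrite Cmod2_alt. field. lra. }
    rewrite E. rewrite (surjective_pairing c) at 1. unfold Cmult, RtoC. simpl.
    change (fst c) with (Re c). change (snd c) with (Im c). f_equal; field; lra.
  - change (Re (Clog c)) with (ln (Re c ^ 2 + Im c ^ 2) / 2).
    rewrite <- Cmod2_alt. simpl. rewrite Rmult_1_r, ln_mult by auto. field.
Qed.

Lemma cos_eq_1_Z (x : R) : cos x = 1 -> exists k : Z, x = 2 * PI * IZR k.
Proof.
  intros H. assert (S : sin (x / 2) = 0).
  { replace x with (2 * (x / 2)) in H by field. rewrite cos_2a_sin in H. nra. }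
  destruct (sin_eq_0_0 _ S) as [k Hk]. exists k. lra.
Qed.

(** Equal moduli make the real part zero, and equal directions make the imaginary part a multiple of
    2 pi; this integer is the level of a zero. *)
Lemma Clog_pow_eq (z y : C) (s n : nat) : 0 < Re z -> 0 < Re y -> (z ^ s = y ^ n)%C ->
  exists k : Z, (INR s * Clog z - INR n * Clog y)%C = (0, 2 * PI * IZR k).
Proof.
  intros Hz Hy E.
  destruct (Clog_polar z Hz) as [Pz Lz]. destruct (Clog_polar y Hy) as [Py Ly].
  assert (Mz : 0 < Cmod z) by (apply Cmod_gt_0; intros Q; rewrite Q in Hz; unfold Re in Hz; simpl in Hz; lra).
  assert (My : 0 < Cmod y) by (apply Cmod_gt_0; intros Q; rewrite Q in Hy; unfold Re in Hy; simpl in Hy; lra).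
  assert (EM : Cmod z ^ s = Cmod y ^ n) by (rewrite <- !Cmod_pow, E; auto).
  set (a := Im (Clog z)) in *. set (b := Im (Clog y)) in *.
  assert (EA : cexpi (INR s * a) = cexpi (INR n * b)).
  { rewrite Pz, Py, !Cpow_mult_l, <- !RtoC_pow, !cexpi_pow in E. rewrite <- EM in E.
    pose proof (pow_lt (Cmod z) s Mz) as P.
    assert (N : RtoC (Cmod z ^ s) <> 0%C) by (intros Q; apply RtoC_inj in Q; lra).
    replace (cexpi (INR s * a)) with (RtoC (Cmod z ^ s) * cexpi (INR s * a) / RtoC (Cmod z ^ s))%C by (field; auto).
    rewrite E. field. auto. }
  assert (EC : cos (INR s * a - INR n * b) = 1).
  { injection EA as E1 E2. rewrite cos_minus, E1, E2. pose proof (sin2_cos2 (INR n * b)) as S. unfold Rsqr in S. lra. }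
  destruct (cos_eq_1_Z _ EC) as [k Hk]. exists k.
  assert (EL : INR s * Re (Clog z) = INR n * Re (Clog y)).
  { rewrite <- Lz, <- Ly, <- !ln_pow by auto. rewrite EM. reflexivity. }
  rewrite (surjective_pairing (INR s * Clog z - INR n * Clog y)%C). 
  unfold Re, Im in *. f_equal.
  - transitivity (INR s * fst (Clog z) - INR n * fst (Clog y)); [|lra]. 
    unfold Cminus, Cmult, Cplus, Copp, RtoC. cbv [fst snd]. ring.
  - transitivity (INR s * a - INR n * b); [|exact Hk].
    unfold a, b, Cminus, Cmult, Cplus, Copp, RtoC. cbv [fst snd]. ring.
Qed.

(** The mean value theorem is applied to the real and imaginary parts separately, whence the factor
    2. *)
Lemma Cmean_value (M : R -> C) (dM : R -> C) (B : R) :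
  (forall t, 0 <= t <= 1 -> pder M t (dM t)) -> (forall t, 0 <= t <= 1 -> Cmod (dM t) <= B) ->
  Cmod (M 1 - M 0) <= 2 * B.
Proof.
  intros Hd Hb.
  assert (K : forall (f df : R -> R), (forall t, 0 <= t <= 1 -> is_derive f t (df t)) ->
     (forall t, 0 <= t <= 1 -> Rabs (df t) <= B) -> Rabs (f 1 - f 0) <= B).
  { intros f df H1 H2. destruct (MVT_gen f 0 1 df) as [c [Hc E]].
    - intros x Hx. rewrite Rmin_left, Rmax_right in Hx by lra. apply H1; lra.
    - intros x Hx. rewrite Rmin_left, Rmax_right in Hx by lra. apply continuity_pt_filterlim.
      apply (ex_derive_continuous (V:=R_NormedModule)). eexists. apply H1; lra.
    - rewrite Rmin_left, Rmax_right in Hc by lra. rewrite E. replace (df c * (1 - 0)) with (df c) by ring. auto. }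
  eapply Rle_trans; [apply Cmod_le_Re_Im|].
  assert (Rabs (Re (M 1) - Re (M 0)) <= B).
  { apply (K (fun t => Re (M t)) (fun t => Re (dM t))).
    - intros t Ht. apply (pder_is_derive _ _ _ (Hd t Ht)).
    - intros t Ht. eapply Rle_trans; [apply re_le_Cmod|auto]. }
  assert (Rabs (Im (M 1) - Im (M 0)) <= B).
  { apply (K (fun t => Im (M t)) (fun t => Im (dM t))).
    - intros t Ht. apply (pder_is_derive _ _ _ (Hd t Ht)).
    - intros t Ht. eapply Rle_trans; [apply im_le_Cmod|auto]. }
  change (Re (M 1 - M 0)) with (Re (M 1) - Re (M 0)). change (Im (M 1 - M 0)) with (Im (M 1) - Im (M 0)). lra.
Qed.

(** The bound log(1 + t) >= t - t^2, obtained from exp(-x) >= 1 - x; it bounds |z|^s from below in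
    [zeros_near_1]. *)
Lemma exp_minus_sq_le (t : R) : 0 <= t <= 1 / 2 -> exp (t - t ^ 2) <= 1 + t.
Proof.
  intros Ht. assert (P : 0 < 1 - (t - t ^ 2)) by nra.
  pose proof (exp_ineq1_le (- (t - t ^ 2))) as H. rewrite exp_Ropp in H.
  pose proof (exp_pos (t - t ^ 2)) as E.
  assert (Q : (1 - (t - t ^ 2)) * exp (t - t ^ 2) <= 1).
  { apply Rle_trans with (/ exp (t - t ^ 2) * exp (t - t ^ 2)); [apply Rmult_le_compat_r; lra|].
    right. field. lra. }
  apply Rmult_le_reg_l with (1 - (t - t ^ 2)); auto.
  eapply Rle_trans; [exact Q|]. nra.
Qed.

Lemma exp_INR_mult (n : nat) (x : R) : exp (INR n * x) = exp x ^ n.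
Proof.
  induction n as [|n IH]; [simpl; rewrite Rmult_0_l, exp_0; auto|].
  rewrite S_INR. simpl. rewrite <- IH, <- exp_plus. f_equal. ring.
Qed.

(** * Zeros at distance 1 / sqrt s from 1 and the quadratic model of the logarithm *)

Section Asymptotics.
Variables (p : nat -> R) (R1 : R).
Hypothesis Hp : is_pmf p.
Hypothesis HR1 : 1 < R1.
Hypothesis HR1r : Rbar_lt R1 (CV_radius p).
Hypothesis Haper : forall z, Cmod z = 1 -> z <> 1%C -> Cmod (pgf p z) < 1.
Let mu := pgf_mean p.
Let v := pgf_var p.
Hypothesis Hmu : 0 < mu.
Hypothesis Hv : 0 < v.
Variable ghi : R.

Let X := pgf p.
Let X1 := pgf (PS_derive p).

Let Hr : Rbar_lt 1 (CV_radius p).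
Proof. eapply Rbar_lt_trans; [|exact HR1r]. exact HR1. Qed.

Lemma Series_shift_mult (q : nat -> R) : Rbar_lt 1 (CV_radius q) ->
  Series (fun k => INR (S k) * q (S k)) = Series (fun k => INR k * q k).
Proof.
  intros H. rewrite (Series_incr_1 (fun k => INR k * q k)); [simpl (INR 0); rewrite Rmult_0_l, Rplus_0_l; auto|].
  rewrite <- (CV_radius_mult_INR q) in H. apply CV_radius_ex_series in H; [|lra].
  apply ex_series_Rabs. eapply ex_series_ext; [|exact H]. intros k. simpl. rewrite pow1. ring.
Qed.

Lemma pgf_derive_at_1 : X1 1%C = RtoC mu.
Proof.
  unfold X1. rewrite pgf_real. f_equal. unfold PSeries, mu, pgf_mean.
  rewrite <- (Series_shift_mult p Hr). apply Series_ext. intros k. unfold PS_derive. rewrite pow1. ring.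
Qed.

Lemma pgf_derive2_at_1 : pgf (PS_derive (PS_derive p)) 1%C = RtoC (v + mu ^ 2 - mu).
Proof.
  rewrite pgf_real. f_equal. unfold v, pgf_var, mu. ring_simplify. unfold PSeries, pgf_fact2.
  rewrite (Series_ext _ (fun k => INR (S k) * PS_derive p (S k))).
  2:{ intros k. rewrite pow1. unfold PS_derive at 1. ring. }
  rewrite (Series_shift_mult (PS_derive p)) by (rewrite CV_radius_derive; exact Hr).
  rewrite (Series_ext _ (fun k => INR (S k) * (INR k * p (S k)))).
  2:{ intros k. unfold PS_derive. ring. }
  assert (HC : Rbar_lt 1 (CV_radius (fun k => (INR k - 1) * p k))).
  { eapply Rbar_lt_le_trans; [exact Hr|].
    assert (E : CV_radius (fun k => (INR k - 1) * p k) = CV_radius (PS_plus (fun k => INR k * p k) (PS_opp p))).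
    { apply CV_radius_ext. intros k. unfold PS_plus, PS_opp, plus, opp. simpl. ring. }
    rewrite E. eapply Rbar_le_trans; [|apply CV_radius_plus].
    rewrite CV_radius_opp, CV_radius_mult_INR.
    unfold Rbar_min. destruct (CV_radius p); simpl; try lra. rewrite Rmin_left; lra. }
  transitivity (Series (fun k => INR k * ((INR k - 1) * p k))); [|apply Series_ext; intros k; ring].
  rewrite <- (Series_shift_mult _ HC). apply Series_ext. intros k. rewrite !S_INR. ring.
Qed.

Lemma pgf_expand_at_1 : exists K, 0 <= K /\ forall z, Cmod z <= R1 ->
  Cmod (X z - 1 - RtoC mu * (z - 1)) <= K * Cmod (z - 1) ^ 2 /\
  Cmod (X1 z - RtoC mu - RtoC (v + mu ^ 2 - mu) * (z - 1)) <= K * Cmod (z - 1) ^ 2.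
Proof.
  assert (HD : Rbar_lt R1 (CV_radius (PS_derive p))) by (rewrite CV_radius_derive; exact HR1r).
  pose proof (pgf_C2_pos p R1 ltac:(lra) HR1r) as P1.
  pose proof (pgf_C2_pos (PS_derive p) R1 ltac:(lra) HD) as P2.
  exists (pgf_C2 p R1 + pgf_C2 (PS_derive p) R1). split; [lra|]. intros z Hz.
  assert (H1 : Cmod 1 <= R1) by (rewrite Cmod_1; lra).
  pose proof (pgf_taylor p z 1%C R1 ltac:(lra) HR1r Hz H1) as T1.
  pose proof (pgf_taylor (PS_derive p) z 1%C R1 ltac:(lra) HD Hz H1) as T2.
  rewrite pgf_at_1 in T1 by auto. fold X1 in T1, T2. rewrite pgf_derive_at_1 in T1, T2.
  rewrite pgf_derive2_at_1 in T2. fold X in T1.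
  pose proof (pow2_ge_0 (Cmod (z - 1))). split; nra.
Qed.

(* [h] stands for the square root of [s]. *)
Definition traffic (n s : nat) (gam h : R) : Prop :=
  0 < h /\ INR s = h ^ 2 /\ INR n * mu = h ^ 2 - gam * h /\ 0 < gam <= ghi.

(* Taking moduli in z^s = X(z)^n and using the gap 1 - |X| on the unit circle. *)
Lemma zeros_near_1 (C1 : R) : 0 < C1 -> exists C5 h0, 0 < h0 /\ forall n s gam h z,
  traffic n s gam h -> h0 <= h -> 1 < Cmod z <= 1 + C1 / h -> (z ^ s = X z ^ n)%C ->
  Cmod (z - 1) <= C5 / h.
Proof.
  intros HC1. destruct pgf_expand_at_1 as [K [HK Hexp]].
  destruct (pgf_unit_circle_gap p Hp Hr Haper) as [kap [Hkap Hgap]].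
  (* [E] will bound the square of h |z/|z| - 1|, see [B6]; with h (|z| - 1) <= C1 this yields the
     constant C1 + (1 + E). *)
  set (E := 2 * (K + mu) * C1 ^ 2 / kap).
  assert (HE : 0 <= E).
  { unfold E. apply Rdiv_le_0_compat; auto. apply Rmult_le_pos; [lra|apply pow2_ge_0]. }
  (* The lower bounds on h ensure in turn h >= 1, n mu >= h^2 / 2, |z| - 1 <= 1/2 and |z| <= R1. *)
  exists (C1 + (1 + E)), (Rmax 1 (Rmax (2 * ghi) (Rmax (2 * C1) (C1 / (R1 - 1))))).
  split; [eapply Rlt_le_trans; [|apply Rmax_l]; lra|].
  intros n s gam h z [Hh [Es [En Hg]]] Hh0 Hz Ez.
  assert (G1 : 1 <= h) by (eapply Rle_trans; [apply Rmax_l|exact Hh0]).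
  assert (G2 : 2 * ghi <= h) by (eapply Rle_trans; [|exact Hh0]; eapply Rle_trans; [|apply Rmax_r]; apply Rmax_l).
  assert (G3 : 2 * C1 <= h) by (eapply Rle_trans; [|exact Hh0]; eapply Rle_trans; [|apply Rmax_r]; eapply Rle_trans; [|apply Rmax_r]; apply Rmax_l).
  assert (G4 : C1 / (R1 - 1) <= h) by (eapply Rle_trans; [|exact Hh0]; eapply Rle_trans; [|apply Rmax_r]; eapply Rle_trans; [|apply Rmax_r]; apply Rmax_r).
  clear Hh0.
  assert (I1 : C1 / h <= 1 / 2).
  { apply Rmult_le_reg_r with h; auto. unfold Rdiv at 1. rewrite Rmult_assoc, Rinv_l by lra. lra. }
  assert (I2 : C1 / h <= R1 - 1).
  { apply Rmult_le_reg_r with h; auto. unfold Rdiv at 1. rewrite Rmult_assoc, Rinv_l by lra.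
    apply Rmult_le_reg_r with (/ (R1 - 1)); [apply Rinv_0_lt_compat; lra|].
    replace ((R1 - 1) * h * / (R1 - 1)) with h by (field; lra). unfold Rdiv in G4. lra. }
  set (rho := Cmod z) in *. set (t := rho - 1).
  assert (Ht : 0 < t <= C1 / h) by (unfold t; lra).
  assert (Hrho : 1 <= rho <= R1) by (unfold t in Ht; lra).
  assert (Nrho : RtoC rho <> 0%C) by (intros Q; apply RtoC_inj in Q; lra).
  set (e := (z / RtoC rho)%C).
  assert (He : Cmod e = 1).
  { unfold e. rewrite Cmod_div, Cmod_R, Rabs_pos_eq by (auto; lra). fold rho. field. lra. }
  assert (Eze : z = (RtoC rho * e)%C) by (unfold e; field; auto).
  assert (HX : Cmod (X z) <= 1 + mu * t + K * t ^ 2 - kap * Cmod (e - 1) ^ 2).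
  { unfold X. rewrite Eze. eapply Rle_trans; [apply pgf_radial; auto; [lra|]|].
    - eapply Rbar_le_lt_trans; [|exact HR1r]. simpl. lra.
    - pose proof (Hgap e He) as G.
      destruct (Hexp (RtoC rho)) as [T _]; [rewrite Cmod_R, Rabs_pos_eq; lra|].
      unfold X in T. rewrite pgf_real in T. rewrite <- !RtoC_minus, <- RtoC_mult, <- RtoC_minus, !Cmod_R in T.
      fold t in T. rewrite (Rabs_pos_eq t) in T by lra.
      pose proof (Rle_abs (PSeries p rho - 1 - mu * t)). lra. }
  set (ep := Cmod (e - 1)) in *.
  assert (Hep : 0 <= ep) by apply Cmod_ge_0.
  set (Y := mu * t + K * t ^ 2 - kap * ep ^ 2) in *.
  (* The left side is at most s log|z| and the right side at least n log|X(z)|; the comparison is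
     made after exponentiation. *)
  assert (Ineq : INR s * (t - t ^ 2) <= INR n * Y).
  { apply Rnot_lt_le. intros Hlt. apply exp_increasing in Hlt. rewrite !exp_INR_mult in Hlt.
    assert (A1 : exp (t - t ^ 2) ^ s <= rho ^ s).
    { apply pow_incr. split; [left; apply exp_pos|]. replace rho with (1 + t) by (unfold t; ring).
      apply exp_minus_sq_le. lra. }
    assert (A2 : rho ^ s <= exp Y ^ n).
    { unfold rho. rewrite <- Cmod_pow, Ez, Cmod_pow. apply pow_incr. split; [apply Cmod_ge_0|].
      pose proof (exp_ineq1_le Y). unfold Y in *. lra. }
    lra. }
  assert (En2 : h ^ 2 / 2 <= INR n * mu) by (rewrite En; nra).
  assert (En3 : INR n * mu <= h ^ 2) by (rewrite En; nra).
  (* Since n mu <= s = h^2, the terms linear in t cancel up to a favourable sign and only quadratic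
     terms remain. *)
  assert (B1 : INR n * (kap * ep ^ 2) <= INR n * (K * t ^ 2) + h ^ 2 * t ^ 2).
  { assert (INR n * Y = INR n * mu * t + INR n * (K * t ^ 2) - INR n * (kap * ep ^ 2)) by (unfold Y; ring).
    rewrite Es in Ineq. assert (INR n * mu * t <= h ^ 2 * t) by (apply Rmult_le_compat_r; lra). nra. }
  assert (B2 : h * t <= C1).
  { apply Rle_trans with (h * (C1 / h)); [apply Rmult_le_compat_l; lra|right; field; lra]. }
  assert (B3 : h ^ 2 * t ^ 2 <= C1 ^ 2).
  { replace (h ^ 2 * t ^ 2) with ((h * t) ^ 2) by ring. apply pow_incr. split; [apply Rmult_le_pos; lra|auto]. }
  assert (B4 : (INR n * mu) * (kap * ep ^ 2) <= (INR n * mu) * (K * t ^ 2) + mu * (h ^ 2 * t ^ 2)) by nra.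
  assert (Kt : 0 <= K * t ^ 2) by (apply Rmult_le_pos; [auto|apply pow2_ge_0]).
  assert (Ke : 0 <= kap * ep ^ 2) by (apply Rmult_le_pos; [lra|apply pow2_ge_0]).
  assert (B5 : (h ^ 2 / 2) * (kap * ep ^ 2) <= h ^ 2 * (K * t ^ 2) + mu * (h ^ 2 * t ^ 2)).
  { eapply Rle_trans; [apply Rmult_le_compat_r; [exact Ke|exact En2]|].
    eapply Rle_trans; [exact B4|]. apply Rplus_le_compat_r. apply Rmult_le_compat_r; auto. }
  assert (B6 : (h * ep) ^ 2 <= E).
  { unfold E. apply Rmult_le_reg_r with (kap / 2); [lra|].
    replace (2 * (K + mu) * C1 ^ 2 / kap * (kap / 2)) with ((K + mu) * C1 ^ 2) by (field; lra).
    replace ((h * ep) ^ 2 * (kap / 2)) with (h ^ 2 / 2 * (kap * ep ^ 2)) by field.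
    eapply Rle_trans; [exact B5|].
    replace (h ^ 2 * (K * t ^ 2) + mu * (h ^ 2 * t ^ 2)) with ((K + mu) * (h ^ 2 * t ^ 2)) by ring.
    apply Rmult_le_compat_l; lra. }
  assert (B7 : h * ep <= 1 + E) by nra.
  apply Rle_trans with (t + ep).
  - replace (z - 1)%C with (RtoC t * e + (e - 1))%C by (rewrite Eze; unfold t; rewrite RtoC_minus; ring).
    eapply Rle_trans; [apply Cmod_triangle|]. rewrite Cmod_mult, He, Cmod_R, Rabs_pos_eq by lra. unfold ep. lra.
  - apply Rmult_le_reg_r with h; auto. unfold Rdiv. rewrite (Rmult_assoc _ (/ h) h), Rinv_l by lra. lra.
Qed.

(** The logarithmic derivative of z^s / X(z)^n. *)
Definition logder (n s : nat) (z : C) : C := (INR s / z - INR n * (X1 z / X z))%C.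

(** With w = z - 1, 1/z = 1 - w + O(w^2) and X'/X = mu + (v - mu) w + O(w^2). The constant term is s
    - n mu = gam h. The coefficient of w is -h^2 v / mu plus gam h (v - mu) / mu, and this last part
    as well as h^2 w^2 is O(1) because w = O(1/h). The three main summands of [C'] bound these
    errors; its summand 1 keeps it positive. *)
Lemma logder_expand (Cw : R) : 0 < Cw -> exists C' h0, 0 < C' /\ 0 < h0 /\ forall n s gam h z,
  traffic n s gam h -> h0 <= h -> Cmod (z - 1) <= Cw / h ->
  0 < Re z /\ 0 < Re (X z) /\ Cmod z <= R1 /\
  Cmod (logder n s z - (RtoC (gam * h) - RtoC (h ^ 2 * (v / mu)) * (z - 1))) <= C'.
Proof.
  intros HCw. destruct pgf_expand_at_1 as [K [HK Hexp]].
  set (b := Rabs (v - mu)). assert (Hb : 0 <= b) by apply Rabs_pos.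
  set (CE := K + (mu + b) * K + mu * b).
  assert (HCE : 0 <= CE) by (unfold CE; repeat apply Rplus_le_le_0_compat; try apply Rmult_le_pos; lra).
  set (C' := 2 * Cw ^ 2 + 2 * CE * Cw ^ 2 / mu + Rabs ghi * (b / mu) * Cw + 1).
  assert (HC' : 0 < C').
  { unfold C'. pose proof (pow2_ge_0 Cw). pose proof (Rabs_pos ghi).
    assert (0 <= 2 * CE * Cw ^ 2 / mu) by (apply Rdiv_le_0_compat; auto; apply Rmult_le_pos; lra).
    assert (0 <= b / mu) by (apply Rdiv_le_0_compat; auto).
    assert (0 <= Rabs ghi * (b / mu) * Cw) by (apply Rmult_le_pos; [apply Rmult_le_pos; auto|lra]). lra. }
  exists C', (Rmax 1 (Cw * (2 + 2 * mu + 2 * K + / (R1 - 1)))). split; auto.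
  split; [eapply Rlt_le_trans; [|apply Rmax_l]; lra|].
  intros n s gam h z [Hh [Es [En Hg]]] Hh0 Hw.
  assert (G1 : 1 <= h) by (eapply Rle_trans; [apply Rmax_l|exact Hh0]).
  assert (G2 : Cw * (2 + 2 * mu + 2 * K + / (R1 - 1)) <= h) by (eapply Rle_trans; [apply Rmax_r|exact Hh0]).
  assert (Hq : 0 < / (R1 - 1)) by (apply Rinv_0_lt_compat; lra).
  set (w := (z - 1)%C) in *. set (x := Cmod w) in *. assert (Hx : 0 <= x) by apply Cmod_ge_0.
  assert (Hxh : x * h <= Cw).
  { apply Rle_trans with (Cw / h * h); [apply Rmult_le_compat_r; lra|right; field; lra]. }
  assert (Hsmall : x * (2 + 2 * mu + 2 * K + / (R1 - 1)) <= 1).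
  { apply Rmult_le_reg_r with h; auto. set (S := 2 + 2 * mu + 2 * K + / (R1 - 1)) in *.
    assert (0 < S) by (unfold S; lra). nra. }
  assert (x1 : x <= 1 / 2) by nra. assert (xmu : x * mu <= 1 / 2) by nra. assert (xK : x * K <= 1 / 2) by nra.
  assert (xmK : x * mu + x * K <= 1 / 2 - x) by nra.
  assert (xR : x <= R1 - 1).
  { assert (x * / (R1 - 1) <= 1) by nra. apply Rmult_le_reg_r with (/ (R1 - 1)); auto.
    rewrite Rinv_r by lra. auto. }
  assert (Ez : z = (1 + w)%C) by (unfold w; ring).
  assert (Hz1 : Cmod z <= R1).
  { rewrite Ez. eapply Rle_trans; [apply Cmod_triangle|]. rewrite Cmod_1. fold x. lra. }
  destruct (Hexp z Hz1) as [T1 T2]. fold w in T1, T2. fold x in T1, T2.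
  assert (Hre : 1 / 2 <= Re z).
  { rewrite Ez. pose proof (re_le_Cmod w) as Q. fold x in Q. apply Rabs_le_between in Q.
    change (Re (1 + w)%C) with (1 + Re w). lra. }
  assert (Hxm : Cmod (X z - 1) <= 1 / 2).
  { replace (X z - 1)%C with ((X z - 1 - RtoC mu * w) + RtoC mu * w)%C by ring.
    eapply Rle_trans; [apply Cmod_triangle|]. rewrite Cmod_mult, Cmod_R, Rabs_pos_eq by lra. fold x.
    assert (K * x ^ 2 <= K * x).
    { apply Rmult_le_compat_l; auto. nra. }
    lra. }
  assert (HreX : 1 / 2 <= Re (X z)).
  { pose proof (re_le_Cmod (X z - 1)) as Q. apply Rabs_le_between in Q.
    change (Re (X z - 1)%C) with (Re (X z) - 1) in Q. lra. }
  repeat split; try lra.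
  assert (Hzm : 1 / 2 <= Cmod z).
  { eapply Rle_trans; [exact Hre|]. eapply Rle_trans; [apply Rle_abs|apply re_le_Cmod]. }
  assert (HXm : 1 / 2 <= Cmod (X z)).
  { eapply Rle_trans; [exact HreX|]. eapply Rle_trans; [apply Rle_abs|apply re_le_Cmod]. }
  assert (Nz : z <> 0%C) by (apply Cmod_gt_0; lra).
  assert (NX : X z <> 0%C) by (apply Cmod_gt_0; lra).
  (* The error in the expansion of X'/X, multiplied by X so that it is a combination of the two
     Taylor remainders and w^2. *)
  set (Er := (X1 z - (RtoC mu + RtoC (v - mu) * w) * X z)%C).
  assert (HEr : Cmod Er <= CE * x ^ 2).
  { replace Er with ((X1 z - RtoC mu - RtoC (v + mu ^ 2 - mu) * w)
       - (RtoC mu + RtoC (v - mu) * w) * (X z - 1 - RtoC mu * w) - RtoC mu * RtoC (v - mu) * (w * w))%C.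
    2:{ unfold Er. rewrite !RtoC_minus, !RtoC_plus. replace (mu ^ 2) with (mu * mu) by ring. rewrite RtoC_mult. ring. }
    eapply Rle_trans; [apply Cmod_triangle_minus|].
    eapply Rle_trans; [apply Rplus_le_compat_r, Cmod_triangle_minus|].
    rewrite !Cmod_mult, !Cmod_R, (Rabs_pos_eq mu) by lra. fold b. fold x.
    assert (Q1 : Cmod (RtoC mu + RtoC (v - mu) * w) <= mu + b).
    { eapply Rle_trans; [apply Cmod_triangle|]. rewrite Cmod_mult, !Cmod_R, Rabs_pos_eq by lra. fold b. fold x. nra. }
    assert (Q2 : Cmod (RtoC mu + RtoC (v - mu) * w) * Cmod (X z - 1 - RtoC mu * w) <= (mu + b) * (K * x ^ 2)).
    { apply Rmult_le_compat; auto; apply Cmod_ge_0. }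
    unfold CE. nra. }
  replace (logder n s z - (RtoC (gam * h) - RtoC (h ^ 2 * (v / mu)) * w))%C
    with (RtoC (h ^ 2) * (w * w) / z - RtoC (INR n) * Er / X z + RtoC (gam * h * ((v - mu) / mu)) * w)%C.
  2:{ unfold logder.
      assert (F1 : (INR s / z)%C = (RtoC (h ^ 2) * (1 - w) + RtoC (h ^ 2) * (w * w) / z)%C).
      { rewrite Es. unfold w. field. auto. }
      assert (F2 : (INR n * (X1 z / X z))%C = (RtoC (INR n * mu) * (1 + RtoC ((v - mu) / mu) * w) + RtoC (INR n) * Er / X z)%C).
      { unfold Er. rewrite RtoC_mult. rewrite (RtoC_div (v - mu) mu) by lra. field. split; auto.
        intros Q. apply RtoC_inj in Q. lra. }
      rewrite F1, F2, En.
      replace (v / mu) with (1 + (v - mu) / mu) by (field; lra).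
      set (q := (v - mu) / mu). rewrite !RtoC_mult, !RtoC_minus, !RtoC_plus, !RtoC_mult. ring. }
  assert (xh2 : h ^ 2 * x ^ 2 <= Cw ^ 2).
  { replace (h ^ 2 * x ^ 2) with ((x * h) ^ 2) by ring. apply pow_incr. split; [apply Rmult_le_pos; lra|auto]. }
  eapply Rle_trans; [apply Cmod_triangle|].
  eapply Rle_trans; [apply Rplus_le_compat_r, Cmod_triangle_minus|].
  unfold C'.
  assert (T3 : Cmod (RtoC (h ^ 2) * (w * w) / z) <= 2 * Cw ^ 2).
  { rewrite Cmod_div, !Cmod_mult, Cmod_R, (Rabs_pos_eq (h ^ 2)) by (auto; apply pow2_ge_0). fold x.
    apply Rmult_le_reg_r with (Cmod z); [lra|]. unfold Rdiv. rewrite Rmult_assoc, Rinv_l by lra.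
    pose proof (pow2_ge_0 Cw). nra. }
  assert (T4 : Cmod (RtoC (INR n) * Er / X z) <= 2 * CE * Cw ^ 2 / mu).
  { rewrite Cmod_div, Cmod_mult, Cmod_R, (Rabs_pos_eq (INR n)) by (auto; apply pos_INR).
    apply Rmult_le_reg_r with (Cmod (X z) * mu); [nra|].
    replace (INR n * Cmod Er / Cmod (X z) * (Cmod (X z) * mu)) with (INR n * mu * Cmod Er) by (field; lra).
    replace (2 * CE * Cw ^ 2 / mu * (Cmod (X z) * mu)) with (2 * CE * Cw ^ 2 * Cmod (X z)) by (field; lra).
    assert (A1 : INR n * mu <= h ^ 2) by (rewrite En; nra).
    apply Rle_trans with (h ^ 2 * (CE * x ^ 2)).
    - apply Rmult_le_compat; auto; [|apply Cmod_ge_0]. apply Rmult_le_pos; [apply pos_INR|lra].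
    - replace (h ^ 2 * (CE * x ^ 2)) with (CE * (h ^ 2 * x ^ 2)) by ring.
      assert (A2 : CE * (h ^ 2 * x ^ 2) <= CE * Cw ^ 2) by (apply Rmult_le_compat_l; auto).
      assert (0 <= CE * Cw ^ 2) by (apply Rmult_le_pos; [auto|apply pow2_ge_0]). nra. }
  assert (T5 : Cmod (RtoC (gam * h * ((v - mu) / mu)) * w) <= Rabs ghi * (b / mu) * Cw).
  { unfold Rdiv at 1. rewrite Cmod_mult, Cmod_R, !Rabs_mult, Rabs_inv. fold b. fold x.
    rewrite (Rabs_pos_eq gam), (Rabs_pos_eq h), (Rabs_pos_eq mu) by lra.
    replace (gam * h * (b * / mu) * x) with (gam * (b / mu) * (x * h)) by (unfold Rdiv; ring).
    pose proof (Rle_abs ghi). assert (0 <= b / mu) by (apply Rdiv_le_0_compat; auto).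
    apply Rmult_le_compat; auto.
    - apply Rmult_le_pos; lra.
    - apply Rmult_le_pos; lra.
    - apply Rmult_le_compat_r; lra. }
  lra.
Qed.

Definition loggap (n s : nat) (z : C) : C := (INR s * Clog z - INR n * Clog (X z))%C.

(** The antiderivative, vanishing at 0, of the affine approximation of [logder] in
    [logder_expand]. *)
Definition quad (gam h : R) (w : C) : C := (RtoC (gam * h) * w - RtoC (h ^ 2 * (v / (2 * mu))) * (w * w))%C.

(** The difference has derivative bounded by [C'] on the disc, and the segment between two points of
    the disc stays in it. On the scale 1/h of the zeros this is a Lipschitz constant O(1/h). *)
Lemma loggap_lipschitz (n s : nat) (gam h C' D : R) :
  (forall z, Cmod (z - 1) <= D -> 0 < Re z /\ 0 < Re (X z) /\ Cmod z <= R1 /\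
    Cmod (logder n s z - (RtoC (gam * h) - RtoC (h ^ 2 * (v / mu)) * (z - 1))) <= C') ->
  forall z z', Cmod (z - 1) <= D -> Cmod (z' - 1) <= D ->
  Cmod ((loggap n s z - quad gam h (z - 1)) - (loggap n s z' - quad gam h (z' - 1))) <= 2 * C' * Cmod (z - z').
Proof.
  intros HD z z' Hz Hz'.
  set (g := fun t : R => (z' + RtoC t * (z - z'))%C).
  set (M := fun t => (loggap n s (g t) - quad gam h (g t - 1))%C).
  replace z with (g 1) at 1 2 by (unfold g; ring). replace z' with (g 0) at 1 2 by (unfold g; ring).
  fold (M 1). fold (M 0). rewrite Rmult_assoc.
  assert (Dg : forall t, pder g t (z - z')%C).
  { intros t. exists (fun _ => (z - z')%C). split; [apply pcont_const|]. split; auto.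
    intros u. unfold g. rewrite RtoC_minus. ring. }
  assert (Bg : forall t, 0 <= t <= 1 -> Cmod (g t - 1) <= D).
  { intros t Ht. replace (g t - 1)%C with (RtoC t * (z - 1) + RtoC (1 - t) * (z' - 1))%C
      by (unfold g; rewrite RtoC_minus; ring).
    eapply Rle_trans; [apply Cmod_triangle|]. rewrite !Cmod_mult, !Cmod_R, !Rabs_pos_eq by lra. nra. }
  apply (Cmean_value M (fun t => (logder n s (g t) - (RtoC (gam * h) - RtoC (h ^ 2 * (v / mu)) * (g t - 1))) * (z - z'))%C).
  - intros t Ht. destruct (HD (g t) (Bg t Ht)) as [P1 [P2 [P3 _]]].
    assert (PX : pder (fun u => X (g u)) t (X1 (g t) * (z - z'))%C).
    { apply (pder_comp X g); [|apply Dg]. apply pgf_Cder. eapply Rbar_le_lt_trans; [|exact HR1r]. exact P3. }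
    pose proof (pder_Clog g t _ (Dg t) P1) as L1. pose proof (pder_Clog (fun u => X (g u)) t _ PX P2) as L2.
    assert (Nz : g t <> 0%C) by (intros Q; rewrite Q in P1; unfold Re in P1; simpl in P1; lra).
    assert (NX : X (g t) <> 0%C) by (intros Q; rewrite Q in P2; unfold Re in P2; simpl in P2; lra).
    destruct L1 as [f1 [c1 [e1 h1]]]. destruct L2 as [f2 [c2 [e2 h2]]].
    (* The slope is assembled from those of the two logarithms and the exact slope of the quadratic
       polynomial. *)
    exists (fun u => INR s * f1 u - INR n * f2 u
       - (RtoC (gam * h) - RtoC (h ^ 2 * (v / (2 * mu))) * ((g u - 1) + (g t - 1))) * (z - z'))%C.
    split; [|split].
    + apply pcont_minus.
      * apply pcont_minus; apply pcont_mult; auto using pcont_const.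
      * apply pcont_mult; [|apply pcont_const]. apply pcont_minus; [apply pcont_const|].
        apply pcont_mult; [apply pcont_const|]. apply pcont_plus; [|apply pcont_const].
        apply pcont_minus; [eapply pder_pcont, Dg|apply pcont_const].
    + rewrite e1, e2. unfold logder.
      replace (h ^ 2 * (v / mu)) with (h ^ 2 * (v / (2 * mu)) + h ^ 2 * (v / (2 * mu))) by (field; lra).
      rewrite RtoC_plus. field. auto.
    + intros u. unfold M, loggap. rewrite (h1 u), (h2 u). unfold quad.
      assert (Eg : g u = (g t + (z - z') * RtoC (u - t))%C) by (unfold g; rewrite RtoC_minus; ring).
      rewrite Eg. ring.
  - intros t Ht. destruct (HD (g t) (Bg t Ht)) as [_ [_ [_ P4]]]. rewrite Cmod_mult.
    apply Rmult_le_compat_r; [apply Cmod_ge_0|auto].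
Qed.

Lemma loggap_at_1 (n s : nat) : loggap n s 1%C = 0%C.
Proof.
  unfold loggap, X. rewrite pgf_at_1 by auto. unfold Clog, Re, Im. simpl.
  replace (1 * (1 * 1) + 0 * (0 * 1)) with 1 by ring. rewrite ln_1.
  replace (0 / 1) with 0 by field. rewrite atan_0. replace (0 / 2) with 0 by field.
  change (0, 0) with (RtoC 0). ring.
Qed.
End Asymptotics.

(** * Classification of the zeros *)

Lemma csqrt_sq (w : C) : (csqrt w * csqrt w)%C = w.
Proof.
  pose proof (re_le_Cmod w) as H. apply Rabs_le_between in H.
  assert (A : 0 <= (Cmod w + Re w) / 2) by lra. assert (B : 0 <= (Cmod w - Re w) / 2) by lra.
  pose proof (sqrt_sqrt _ A) as SA. pose proof (sqrt_sqrt _ B) as SB.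
  assert (P : sqrt ((Cmod w + Re w) / 2) * sqrt ((Cmod w - Re w) / 2) = Rabs (Im w) / 2).
  { rewrite <- sqrt_mult by auto.
    replace ((Cmod w + Re w) / 2 * ((Cmod w - Re w) / 2)) with ((Rabs (Im w) / 2)²).
    - apply sqrt_Rsqr. pose proof (Rabs_pos (Im w)). lra.
    - pose proof (Cmod2_alt w) as M. unfold Rsqr.
      replace (Rabs (Im w) / 2 * (Rabs (Im w) / 2)) with (Rabs (Im w) ^ 2 / 4) by field.
      rewrite pow2_abs. replace (Im w ^ 2) with (Cmod w ^ 2 - Re w ^ 2) by lra. field. }
  unfold csqrt. set (a := sqrt ((Cmod w + Re w) / 2)) in *. set (b := sqrt ((Cmod w - Re w) / 2)) in *.
  rewrite (surjective_pairing w) at 3. unfold Cmult. simpl.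
  change (fst w) with (Re w). change (snd w) with (Im w).
  destruct (Rlt_dec (Im w) 0) as [N|N].
  - rewrite Rabs_left in P by auto. f_equal; nra.
  - rewrite Rabs_pos_eq in P by lra. f_equal; nra.
Qed.

Definition rt (b y : R) : C := csqrt (RtoC (b ^ 2) - RtoC y * Ci)%C.

(** The modulus of b^2 - i y, written so that its monotonicity in |y| is visible; it determines the
    real part of [rt] through [Re_rt]. *)
Definition rtm (b y : R) : R := sqrt (b ^ 4 + y ^ 2).

Lemma rt_arg (b y : R) : (RtoC (b ^ 2) - RtoC y * Ci)%C = (b ^ 2, - y).
Proof. unfold RtoC, Ci, Cminus, Cplus, Copp, Cmult. simpl. f_equal; ring. Qed.

Lemma Cmod_rt_arg (b y : R) : Cmod (b ^ 2, - y) = rtm b y.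
Proof. unfold Cmod, rtm. simpl. f_equal. ring. Qed.

Lemma rtm_bounds (b y : R) : b ^ 2 <= rtm b y <= b ^ 2 + Rabs y.
Proof.
  pose proof (Cmod_rt_arg b y) as E. rewrite <- E. pose proof (pow2_ge_0 b). split.
  - pose proof (re_le_Cmod (b ^ 2, - y)) as H0. simpl in H0. eapply Rle_trans; [|exact H0]. apply Rle_abs.
  - eapply Rle_trans; [apply Cmod_le_Re_Im|]. simpl. rewrite Rabs_Ropp, Rabs_pos_eq; simpl in *; lra.
Qed.

Lemma rt_sq (b y : R) : (rt b y * rt b y)%C = (RtoC (b ^ 2) - RtoC y * Ci)%C.
Proof. apply csqrt_sq. Qed.

Lemma Re_rt (b y : R) : Re (rt b y) = sqrt ((rtm b y + b ^ 2) / 2).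
Proof. unfold rt. rewrite rt_arg. unfold csqrt. rewrite Cmod_rt_arg. reflexivity. Qed.

Lemma Cmod_rt_sq (b y : R) : Cmod (rt b y) * Cmod (rt b y) = rtm b y.
Proof. rewrite <- Cmod_mult, rt_sq, rt_arg. apply Cmod_rt_arg. Qed.

Lemma Re_rt_ge (b y : R) : 0 < b -> b <= Re (rt b y).
Proof.
  intros Hb. rewrite Re_rt. rewrite <- (sqrt_Rsqr b) at 1 by lra. apply sqrt_le_1_alt.
  pose proof (rtm_bounds b y). unfold Rsqr. lra.
Qed.

Lemma Cmod_rt_ge (b y : R) : 0 < b -> b <= Cmod (rt b y).
Proof.
  intros Hb. eapply Rle_trans; [apply (Re_rt_ge b y Hb)|]. eapply Rle_trans; [apply Rle_abs|apply re_le_Cmod].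
Qed.

Lemma Cmod_rt_le (b y : R) : Cmod (rt b y) <= 1 + b ^ 2 + Rabs y.
Proof.
  pose proof (Cmod_rt_sq b y). pose proof (rtm_bounds b y). pose proof (Cmod_ge_0 (rt b y)).
  pose proof (Rabs_pos y). pose proof (pow2_ge_0 b). nra.
Qed.

Lemma Re_rt_mono (b y y' : R) : Rabs y <= Rabs y' -> Re (rt b y) <= Re (rt b y').
Proof.
  intros H. rewrite !Re_rt. apply sqrt_le_1_alt. unfold rtm.
  assert (sqrt (b ^ 4 + y ^ 2) <= sqrt (b ^ 4 + y' ^ 2)); [|lra].
  apply sqrt_le_1_alt. apply Rsqr_le_abs_1 in H. unfold Rsqr in H. lra.
Qed.

Lemma rt_0 (b : R) : 0 < b -> rt b 0 = RtoC b.
Proof.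
  intros Hb. unfold rt. rewrite rt_arg. unfold csqrt. rewrite Cmod_rt_arg.
  assert (E : rtm b 0 = b ^ 2).
  { unfold rtm. replace (b ^ 4 + 0 ^ 2) with ((b ^ 2)²) by (unfold Rsqr; ring). apply sqrt_Rsqr. apply pow2_ge_0. }
  rewrite E. change (Re (b ^ 2, - 0)) with (b ^ 2). change (Im (b ^ 2, - 0)) with (- 0).
  replace ((b ^ 2 + b ^ 2) / 2) with (b²) by (unfold Rsqr; field). replace ((b ^ 2 - b ^ 2) / 2) with 0 by field.
  rewrite sqrt_Rsqr, sqrt_0 by lra. unfold RtoC. f_equal. ring.
Qed.

(** The gap must be uniform in b because gamma varies with the model. With m the modulus and a the
    real part, y'^2 - y^2 = (m' - m) (m' + m) and m' - m = 2 (a' - a) (a' + a); the sums are at most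
    2 mm and 2 (1 + mm), which gives the denominator 8 mm (1 + mm). *)
Lemma Re_rt_gap (B Y y y' : R) : 0 < B -> 0 <= y < y' -> y' <= Y ->
  exists del, 0 < del /\ forall b, 0 < b <= B -> Re (rt b y) + del <= Re (rt b y').
Proof.
  intros HB Hy HY. set (mm := B ^ 2 + Y). pose proof (pow2_ge_0 B).
  assert (Hmm : 0 < mm) by (unfold mm; lra).
  exists ((y' ^ 2 - y ^ 2) / (8 * mm * (1 + mm))). split; [apply Rdiv_lt_0_compat; nra|].
  intros b Hb. rewrite !Re_rt.
  assert (HbB : b ^ 2 <= B ^ 2) by (apply pow_incr; lra).
  pose proof (rtm_bounds b y) as M1. pose proof (rtm_bounds b y') as M2.
  rewrite Rabs_pos_eq in M1, M2 by lra.
  set (m := rtm b y) in *. set (m' := rtm b y') in *.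
  assert (Hb2 : 0 < b ^ 2) by (apply pow_lt; lra).
  assert (Em : m * m = b ^ 4 + y ^ 2).
  { apply sqrt_sqrt. pose proof (pow2_ge_0 y). pose proof (pow_lt b 4 ltac:(lra)). lra. }
  assert (Em' : m' * m' = b ^ 4 + y' ^ 2).
  { apply sqrt_sqrt. pose proof (pow2_ge_0 y'). pose proof (pow_lt b 4 ltac:(lra)). lra. }
  assert (P1 : 0 <= (m + b ^ 2) / 2) by lra. assert (P2 : 0 <= (m' + b ^ 2) / 2) by lra.
  pose proof (sqrt_sqrt _ P1) as S1. pose proof (sqrt_sqrt _ P2) as S2.
  pose proof (sqrt_pos ((m + b ^ 2) / 2)) as Q1. pose proof (sqrt_pos ((m' + b ^ 2) / 2)) as Q2.
  set (a := sqrt ((m + b ^ 2) / 2)) in *. set (a' := sqrt ((m' + b ^ 2) / 2)) in *.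
  set (g := y' ^ 2 - y ^ 2) in *.
  assert (Hg : 0 < g) by (unfold g; nra).
  assert (Ba : a <= 1 + mm) by (unfold mm in *; nra). assert (Ba' : a' <= 1 + mm) by (unfold mm in *; nra).
  assert (Dm : (m' - m) * (m' + m) = g) by (unfold g; nra).
  assert (Da : 2 * ((a' - a) * (a' + a)) = m' - m) by nra.
  assert (m' + m <= 2 * mm) by (unfold mm; lra).
  assert (0 < m' + m) by lra.
  assert (Hm : 0 < m' - m) by nra.
  assert (0 < a' + a) by nra.
  assert (Ha : 0 < a' - a) by nra.
  assert (K1 : g <= (m' - m) * (2 * mm)) by nra.
  assert (K2 : m' - m <= 2 * ((a' - a) * (2 * (1 + mm)))) by nra.
  assert (g / (8 * mm * (1 + mm)) <= a' - a); [|lra].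
  apply Rmult_le_reg_r with (8 * mm * (1 + mm)); [nra|].
  replace (g / (8 * mm * (1 + mm)) * (8 * mm * (1 + mm))) with g by (field; lra). nra.
Qed.

Lemma Cmod_one_plus_sq (w : C) : Cmod (1 + w) ^ 2 = 1 + 2 * Re w + Cmod w ^ 2.
Proof. rewrite !Cmod2_alt. unfold Re, Im. simpl. ring. Qed.

Section Classification.
Variables (p : nat -> R) (R1 : R).
Hypothesis Hp : is_pmf p.
Hypothesis HR1 : 1 < R1.
Hypothesis HR1r : Rbar_lt R1 (CV_radius p).
Hypothesis Haper : forall z, Cmod z = 1 -> z <> 1%C -> Cmod (pgf p z) < 1.
Let mu := pgf_mean p.
Let v := pgf_var p.
Hypothesis Hmu : 0 < pgf_mean p.
Hypothesis Hv : 0 < pgf_var p.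
Variables glo ghi : R.
Hypothesis Hglo : 0 < glo.
Let a0 := sqrt (2 * pgf_mean p) / sqrt (pgf_var p).
Definition heavy (n s : nat) (gam h : R) : Prop := traffic p ghi n s gam h /\ glo <= gam.

Lemma a0_pos : 0 < a0.
Proof. unfold a0. apply Rdiv_lt_0_compat; apply sqrt_lt_R0; lra. Qed.

(** This is what singles out [a0]: after rescaling, the coefficient of eta^2 in the model is -1 and
    that of eta is 2 b0 with b0 = gam a0 / 2. *)
Lemma a0_sq : v / (2 * mu) = / (a0 * a0).
Proof.
  pose proof a0_pos. unfold a0, v, mu.
  replace (sqrt (2 * pgf_mean p) / sqrt (pgf_var p) * (sqrt (2 * pgf_mean p) / sqrt (pgf_var p)))
    with ((sqrt (2 * pgf_mean p) * sqrt (2 * pgf_mean p)) / (sqrt (pgf_var p) * sqrt (pgf_var p))).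
  - rewrite !sqrt_sqrt by lra. field. lra.
  - field. apply Rgt_not_eq, sqrt_lt_R0. lra.
Qed.

Definition zero_at (n s : nat) (z : C) : Prop := 1 < Cmod z /\ (z ^ s = pgf p z ^ n)%C.

(* Inverse to the rescaling [z = 1 + (a0 / h) * eta]. *)
Definition eta (h : R) (z : C) : C := (RtoC (h / a0) * (z - 1))%C.

Lemma eta_inv (h : R) (z : C) : 0 < h -> (z - 1)%C = (RtoC (a0 / h) * eta h z)%C.
Proof.
  intros Hh. pose proof a0_pos. unfold eta.
  rewrite Cmult_assoc, <- RtoC_mult. replace (a0 / h * (h / a0)) with 1 by (field; lra). ring.
Qed.

Lemma quad_eta (gam h : R) (z : C) : 0 < h ->
  quad p gam h (z - 1) = (RtoC (2 * (gam * a0 / 2)) * eta h z - eta h z * eta h z)%C.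
Proof.
  intros Hh. pose proof a0_pos. unfold quad. fold v. fold mu. rewrite a0_sq.
  rewrite (eta_inv h z Hh). set (e := eta h z).
  replace (RtoC (gam * h) * (RtoC (a0 / h) * e))%C with (RtoC (gam * h * (a0 / h)) * e)%C by (rewrite RtoC_mult; ring).
  replace (RtoC (h ^ 2 * / (a0 * a0)) * (RtoC (a0 / h) * e * (RtoC (a0 / h) * e)))%C
    with (RtoC (h ^ 2 * / (a0 * a0) * (a0 / h * (a0 / h))) * (e * e))%C by (rewrite !RtoC_mult; ring).
  replace (h ^ 2 * / (a0 * a0) * (a0 / h * (a0 / h))) with 1 by (field; lra).
  replace (gam * h * (a0 / h)) with (2 * (gam * a0 / 2)) by (field; lra). ring.
Qed.

Definition level (n s : nat) (z : C) (k : Z) : Prop := loggap p n s z = (0, 2 * PI * IZR k).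

(** At a zero of level k the model gives (eta - (b + q)) (eta - (b - q)) = O(1/h) with q^2 = b^2 - 2
    pi i k. The moduli of the factors add up to at least 2|q| >= 2b, so one factor is at least b and
    the other is O(1/h). The lower bound |q| >= b is also what keeps the zero simple and alone on
    its level. *)
Lemma classify (Cw : R) : 0 < Cw -> exists C3 h0, 0 < C3 /\ 0 < h0 /\ forall n s gam h z z',
  heavy n s gam h -> h0 <= h ->
  zero_at n s z -> Cmod (z - 1) <= Cw / h -> zero_at n s z' -> Cmod (z' - 1) <= Cw / h ->
  0 < Re z /\ 0 < Re (pgf p z) /\ logder p n s z <> 0%C /\
  (exists k, level n s z k) /\
  (forall k, level n s z k -> Cmod (eta h z - (RtoC (gam * a0 / 2) + rt (gam * a0 / 2) (2 * PI * IZR k))) <= C3 / h) /\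
  (forall k, level n s z k -> level n s z' k -> z = z').
Proof.
  intros HCw. pose proof a0_pos as Ha. pose proof PI_RGT_0 as HPI.
  destruct (logder_expand p R1 Hp HR1 HR1r Hmu ghi Cw HCw) as [C' [h1 [HC' [Hh1 Hexp]]]].
  set (blo := glo * a0 / 2). set (bhi := Rabs ghi * a0 / 2 + 1).
  assert (Hblo : 0 < blo) by (unfold blo; nra).
  assert (Hbhi : 0 < bhi) by (unfold bhi; pose proof (Rabs_pos ghi); nra).
  (* For |k| >= 1 the real part of the square root exceeds its value b at k = 0 by at least
     [kap]. *)
  destruct (Re_rt_gap bhi (2 * PI) 0 (2 * PI) Hbhi ltac:(lra) ltac:(lra)) as [kap [Hkap Hgap]].
  set (C3 := 2 * C' * Cw / blo).
  assert (HC3 : 0 < C3) by (unfold C3; apply Rdiv_lt_0_compat; auto; nra).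
  (* In order, these make C3/h <= kap/2, make |z - 1|^2 <= a0 kap / h, exclude the minus root for k
     = 0, and give C3/h < blo/2 and 2 C' a0 / h <= blo/2. Adding 1 makes the inequalities strict. *)
  set (h2 := Rmax (2 * C3 / kap) (Rmax (2 * Cw ^ 2 / (a0 * kap)) (Rmax ((2 * C' + 1 + C3 / a0) / glo)
     (Rmax (2 * C3 / blo) (4 * a0 * C' / blo))))).
  exists C3, (Rmax h1 (h2 + 1)). split; auto. split; [eapply Rlt_le_trans; [exact Hh1|apply Rmax_l]|].
  intros n s gam h z z' [Htr Hgl] Hh0 [Hz1 Hz2] Hzw [Hz1' Hz2'] Hzw'.
  assert (G0 : h1 <= h) by (eapply Rle_trans; [apply Rmax_l|exact Hh0]).
  assert (G : h2 + 1 <= h) by (eapply Rle_trans; [apply Rmax_r|exact Hh0]).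
  assert (G1' : 2 * C3 / kap <= h2) by apply Rmax_l.
  assert (G2' : Rmax (2 * Cw ^ 2 / (a0 * kap)) (Rmax ((2 * C' + 1 + C3 / a0) / glo)
     (Rmax (2 * C3 / blo) (4 * a0 * C' / blo))) <= h2) by apply Rmax_r.
  clearbody h2. assert (G1 : 2 * C3 / kap < h) by lra. clear G1'.
  assert (G2 : 2 * Cw ^ 2 / (a0 * kap) < h) by (eapply Rle_lt_trans; [eapply Rle_trans; [apply Rmax_l|exact G2']|lra]).
  assert (G3' : Rmax ((2 * C' + 1 + C3 / a0) / glo) (Rmax (2 * C3 / blo) (4 * a0 * C' / blo)) <= h2)
    by (eapply Rle_trans; [apply Rmax_r|exact G2']).
  assert (G3 : (2 * C' + 1 + C3 / a0) / glo < h) by (eapply Rle_lt_trans; [eapply Rle_trans; [apply Rmax_l|exact G3']|lra]).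
  assert (G4' : Rmax (2 * C3 / blo) (4 * a0 * C' / blo) <= h2) by (eapply Rle_trans; [apply Rmax_r|exact G3']).
  assert (G4 : 2 * C3 / blo < h) by (eapply Rle_lt_trans; [eapply Rle_trans; [apply Rmax_l|exact G4']|lra]).
  assert (G5 : 4 * a0 * C' / blo < h) by (eapply Rle_lt_trans; [eapply Rle_trans; [apply Rmax_r|exact G4']|lra]).
  clear G2' G3' G4' G Hh0.
  assert (mulh : forall a b, 0 < b -> a / b < h -> a < h * b).
  { intros a b Hb Hab. apply Rmult_lt_reg_r with (/ b); [apply Rinv_0_lt_compat; auto|].
    rewrite Rmult_assoc, Rinv_r by lra. unfold Rdiv in Hab. lra. }
  apply mulh in G1; auto. apply mulh in G2; [|nra]. apply mulh in G3; auto.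
  apply mulh in G4; auto. apply mulh in G5; auto. clear mulh.
  pose proof Htr as [Hh [Es [En Hg]]].
  set (b := gam * a0 / 2) in *.
  assert (Hb : blo <= b) by (unfold b, blo; nra).
  assert (Hb0 : 0 < b) by lra.
  assert (HbB : b <= bhi) by (unfold b, bhi; pose proof (Rle_abs ghi); nra).
  assert (HD := fun z Hz => Hexp n s gam h z Htr G0 Hz).
  pose proof (loggap_lipschitz p R1 HR1r Hmu n s gam h C' (Cw / h) HD) as Hlip.
  assert (K1 : Cmod (1 - 1) <= Cw / h).
  { unfold Cminus. rewrite Cplus_opp_r, Cmod_0. apply Rdiv_le_0_compat; lra. }
  assert (E1 : quad p gam h (1 - 1) = 0%C) by (unfold quad; ring).
  (* The minus root would give [|z| <= 1] if [k <> 0] and [z = 1] if [k = 0]. *)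
  assert (Near : forall z, zero_at n s z -> Cmod (z - 1) <= Cw / h -> forall k, level n s z k ->
     Cmod (eta h z - (RtoC b + rt b (2 * PI * IZR k))) <= C3 / h).
  { clear z z' Hz1 Hz2 Hzw Hz1' Hz2' Hzw'. intros z [Hz1 Hz2] Hzw k Hk.
    pose proof (Hlip z 1%C Hzw K1) as L. rewrite loggap_at_1 in L by auto. rewrite E1, Hk in L.
    rewrite (quad_eta gam h z Hh) in L. fold b in L.
    set (e := eta h z) in *. set (y := 2 * PI * IZR k) in *. set (q := rt b y).
    assert (Ew : Cmod (z - 1) = a0 / h * Cmod e).
    { rewrite (eta_inv h z Hh), Cmod_mult, Cmod_R, Rabs_pos_eq; auto. left. apply Rdiv_lt_0_compat; auto. }
    assert (Ef : ((e - (b + q)) * (e - (b - q)))%C = ((0, y) - (RtoC (2 * b) * e - e * e) - (0 - 0))%C).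
    { replace ((e - (b + q)) * (e - (b - q)))%C with (e * e - RtoC (2 * b) * e + RtoC b * RtoC b - q * q)%C
        by (rewrite RtoC_mult; ring).
      unfold q. rewrite rt_sq. replace ((0, y) : C) with (RtoC y * Ci)%C
        by (unfold RtoC, Ci, Cmult; simpl; f_equal; ring).
      replace (b ^ 2) with (b * b) by ring. rewrite !RtoC_mult. ring. }
    rewrite <- Ef in L. rewrite Cmod_mult in L.
    assert (HL : 2 * C' * Cmod (z - 1) <= blo * (C3 / h)).
    { apply Rle_trans with (2 * C' * (Cw / h)); [apply Rmult_le_compat_l; lra|]. right. unfold C3. field. lra. }
    set (A := Cmod (e - (b + q))) in *. set (B := Cmod (e - (b - q))) in *.
    assert (HA : 0 <= A) by apply Cmod_ge_0. assert (HB : 0 <= B) by apply Cmod_ge_0.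
    assert (HAB : 2 * b <= A + B).
    { assert (Q : 2 * Cmod q <= A + B).
      { pose proof (Cmod_triangle_minus (e - (b - q)) (e - (b + q))) as T.
        replace (e - (b - q) - (e - (b + q)))%C with (RtoC 2 * q)%C in T by ring.
        rewrite Cmod_mult, Cmod_R, Rabs_pos_eq in T by lra. unfold A, B. lra. }
      pose proof (Cmod_rt_ge b y Hb0). fold q in H. lra. }
    assert (H3 : 0 < C3 / h) by (apply Rdiv_lt_0_compat; auto).
    destruct (Rle_dec A (C3 / h)) as [Good|Bad]; auto. exfalso.
    assert (HB3 : B <= C3 / h).
    { apply Rnot_lt_le. intros N. destruct (Rle_dec A B).
      - assert (b <= B) by lra. nra.
      - assert (b <= A) by lra. nra. }
    assert (C3h : h * (C3 / h) = C3) by (field; lra).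
    destruct (Z.eq_dec k 0) as [K0|K0].
    (* Here the minus root is eta = 0. In the Lipschitz bound against the point 1 both sides contain
       the factor |eta|, nonzero as |z| > 1; cancelling it leaves |2b - eta| = O(1/h), incompatible
       with |eta| <= C3/h. *)
    - assert (Ey : y = 0) by (unfold y; rewrite K0; simpl; ring).
      unfold B, q in HB3. rewrite Ey, rt_0 in HB3 by auto.
      replace (e - (b - b))%C with e in HB3 by ring.
      assert (L2 := Hlip z 1%C Hzw K1). rewrite loggap_at_1 in L2 by auto. rewrite E1 in L2.
      unfold level in Hk. rewrite Hk in L2. fold y in L2. rewrite Ey in L2.
      rewrite (quad_eta gam h z Hh) in L2. fold b in L2. fold e in L2.
      replace ((0, 0) - (RtoC (2 * b) * e - e * e) - (0 - 0))%C with (- (e * (RtoC (2 * b) - e)))%C in L2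
        by (change ((0, 0) : C) with (RtoC 0); ring).
      rewrite Cmod_opp, Cmod_mult, Ew in L2.
      assert (He : 0 < Cmod e).
      { apply Cmod_gt_0. intros Q. rewrite Q, Cmod_0, Rmult_0_r in Ew. apply Cmod_minus_0_eq in Ew.
        rewrite Ew, Cmod_1 in Hz1. lra. }
      assert (L3 : Cmod (RtoC (2 * b) - e) <= 2 * C' * (a0 / h)) by (apply Rmult_le_reg_l with (Cmod e); auto; nra).
      pose proof (Cmod_minus_ge (RtoC (2 * b)) e) as T. rewrite Cmod_R, Rabs_pos_eq in T by lra.
      assert (Q : 2 * blo <= 2 * C' * (a0 / h) + C3 / h) by lra.
      assert (Q2 : 2 * blo * h <= 2 * C' * a0 + C3).
      { apply Rle_trans with ((2 * C' * (a0 / h) + C3 / h) * h); [apply Rmult_le_compat_r; lra|right; field; lra]. }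
      unfold blo in Q2.
      assert (C3 = a0 * (C3 / a0)) by (field; lra). nra.
    (* Near b - q with Re q >= b + kap, eta has real part at most -kap/2, and |z|^2 = 1 + 2 (a0/h)
       Re eta + |z - 1|^2 <= 1 follows. *)
    - assert (Hre : Re e <= - kap / 2).
      { pose proof (re_le_Cmod (e - (b - q))) as Q. fold B in Q. apply Rabs_le_between in Q.
        change (Re (e - (b - q))%C) with (Re e - (b - Re q)) in Q.
        assert (M : Re (rt b 0) + kap <= Re (rt b (2 * PI))) by (apply Hgap; lra).
        rewrite rt_0 in M by auto. change (Re (RtoC b)) with b in M.
        assert (M2 : Re (rt b (2 * PI)) <= Re q).
        { apply Re_rt_mono. unfold y. rewrite (Rabs_mult (2 * PI) (IZR k)), (Rabs_pos_eq (2 * PI)) by lra.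
          rewrite <- (Rmult_1_r (2 * PI)) at 1. apply Rmult_le_compat_l; [lra|].
          rewrite <- abs_IZR. apply (IZR_le 1). lia. }
        assert (C3 / h <= kap / 2); [|lra].
        apply Rmult_le_reg_l with h; auto. rewrite C3h. lra. }
      assert (Em : Cmod z ^ 2 = 1 + 2 * Re (z - 1)%C + Cmod (z - 1) ^ 2).
      { rewrite <- Cmod_one_plus_sq. do 2 f_equal. ring. }
      assert (Er : Re (z - 1)%C = a0 / h * Re e).
      { rewrite (eta_inv h z Hh). fold e. unfold Re, RtoC, Cmult. simpl. ring. }
      assert (Cmod z ^ 2 <= 1).
      { rewrite Em, Er.
        assert (Cmod (z - 1) ^ 2 <= (Cw / h) ^ 2) by (apply pow_incr; split; [apply Cmod_ge_0|auto]).
        assert (0 < a0 / h) by (apply Rdiv_lt_0_compat; auto).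
        assert ((Cw / h) ^ 2 <= a0 / h * kap).
        { replace ((Cw / h) ^ 2) with (Cw ^ 2 / h / h) by (field; lra).
          replace (a0 / h * kap) with (a0 * kap / h) by (field; lra).
          apply Rmult_le_compat_r; [left; apply Rinv_0_lt_compat; auto|].
          apply Rmult_le_reg_r with h; auto. unfold Rdiv. rewrite Rmult_assoc, Rinv_l by lra.
          pose proof (pow2_ge_0 Cw). lra. }
        nra. }
      nra. }
  destruct (HD z Hzw) as [P1 [P2 [P3 P4]]].
  assert (C3h : C3 / h < blo / 2).
  { apply Rmult_lt_reg_r with h; auto. unfold Rdiv at 1. rewrite Rmult_assoc, Rinv_l by lra. lra. }
  split; auto. split; auto.
  assert (Hk : exists k, level n s z k) by (apply Clog_pow_eq; auto).
  split; [|split; [exact Hk|split]].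
  (* In the rescaled variable [logder] is (2h/a0) (b - eta) + O(1), and |eta - b| is close to |q| >=
     b; so it cannot vanish for large h. *)
  - destruct Hk as [k Hk]. intros Q. rewrite Q in P4.
    pose proof (Near z (conj Hz1 Hz2) Hzw k Hk) as N. set (e := eta h z) in *. set (q := rt b (2 * PI * IZR k)) in *.
    fold v mu in P4.
    replace (h ^ 2 * (v / mu)) with (2 * (h ^ 2 * (v / (2 * mu)))) in P4 by (unfold mu; field; lra).
    rewrite a0_sq, (eta_inv h z Hh) in P4. fold e in P4.
    replace (0 - (RtoC (gam * h) - RtoC (2 * (h ^ 2 * / (a0 * a0))) * (RtoC (a0 / h) * e)))%C
      with (RtoC (2 * h / a0) * (e - RtoC b))%C in P4.
    2:{ replace (gam * h) with (2 * h / a0 * b) by (unfold b; field; lra).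
        replace (RtoC (2 * (h ^ 2 * / (a0 * a0))) * (RtoC (a0 / h) * e))%C
          with (RtoC (2 * (h ^ 2 * / (a0 * a0)) * (a0 / h)) * e)%C by (rewrite !RtoC_mult; ring).
        replace (2 * (h ^ 2 * / (a0 * a0)) * (a0 / h)) with (2 * h / a0) by (field; lra).
        rewrite (RtoC_mult (2 * h / a0) b). ring. }
    rewrite Cmod_mult, Cmod_R, Rabs_pos_eq in P4 by (left; apply Rdiv_lt_0_compat; lra).
    assert (M : blo / 2 <= Cmod (e - RtoC b)).
    { pose proof (Cmod_minus_ge q (q - (e - RtoC b))) as T.
      replace (q - (q - (e - RtoC b)))%C with (e - RtoC b)%C in T by ring.
      replace (q - (e - RtoC b))%C with (- (e - (RtoC b + q)))%C in T by ring. rewrite Cmod_opp in T.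
      pose proof (Cmod_rt_ge b (2 * PI * IZR k) Hb0) as T2. fold q in T2. lra. }
    assert (2 * h / a0 * (blo / 2) <= C').
    { eapply Rle_trans; [|exact P4]. apply Rmult_le_compat_l; auto. left. apply Rdiv_lt_0_compat; lra. }
    assert (h * blo <= C' * a0).
    { replace (h * blo) with (2 * h / a0 * (blo / 2) * a0) by (field; lra). apply Rmult_le_compat_r; lra. }
    nra.
  - intros k Hk'. apply (Near z (conj Hz1 Hz2) Hzw k Hk').
  (* The model values differ by -(e - e') (e + e' - 2b), where the last factor is close to 2q. The
     Lipschitz bound is O(1/h) |e - e'|, which forces e = e'. *)
  - intros k Hk1 Hk2.
    pose proof (Near z (conj Hz1 Hz2) Hzw k Hk1) as N1. pose proof (Near z' (conj Hz1' Hz2') Hzw' k Hk2) as N2.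
    pose proof (Hlip z z' Hzw Hzw') as L. unfold level in Hk1, Hk2. rewrite Hk1, Hk2 in L.
    rewrite !(quad_eta gam h _ Hh) in L. fold b in L.
    assert (Ed : Cmod (z - z') = a0 / h * Cmod (eta h z - eta h z')).
    { replace (z - z')%C with ((z - 1) - (z' - 1))%C by ring. rewrite !(eta_inv h _ Hh).
      replace (RtoC (a0 / h) * eta h z - RtoC (a0 / h) * eta h z')%C with (RtoC (a0 / h) * (eta h z - eta h z'))%C by ring.
      rewrite Cmod_mult, Cmod_R, Rabs_pos_eq; auto. left. apply Rdiv_lt_0_compat; auto. }
    set (e := eta h z) in *. set (e' := eta h z') in *. set (q := rt b (2 * PI * IZR k)) in *.
    match type of L with Cmod ?x <= _ => replace x with ((e - e') * (e + e' - RtoC (2 * b)))%C in L by ring end.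
    rewrite Cmod_mult, Ed in L.
    assert (M : blo <= Cmod (e + e' - RtoC (2 * b))).
    { replace (e + e' - RtoC (2 * b))%C with (RtoC 2 * q - (- ((e - (RtoC b + q)) + (e' - (RtoC b + q)))))%C
        by (rewrite RtoC_mult; ring).
      eapply Rle_trans; [|apply Cmod_minus_ge]. rewrite Cmod_opp, Cmod_mult, Cmod_R, Rabs_pos_eq by lra.
      pose proof (Cmod_triangle (e - (RtoC b + q)) (e' - (RtoC b + q))) as T.
      pose proof (Cmod_rt_ge b (2 * PI * IZR k) Hb0) as T2. fold q in T2. lra. }
    assert (S : 2 * C' * (a0 / h) <= blo / 2).
    { apply Rmult_le_reg_r with h; auto. replace (2 * C' * (a0 / h) * h) with (2 * C' * a0) by (field; lra). lra. }
    pose proof (Cmod_ge_0 (e - e')) as Pe.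
    assert (Cmod (e - e') = 0).
    { apply Rle_antisym; auto. apply Rnot_lt_le. intros N.
      assert (Cmod (e - e') * blo <= Cmod (e - e') * (blo / 2)); [|nra].
      apply Rle_trans with (Cmod (e - e') * Cmod (e + e' - RtoC (2 * b))); [apply Rmult_le_compat_l; auto|].
      eapply Rle_trans; [exact L|].
      replace (2 * C' * (a0 / h * Cmod (e - e'))) with (Cmod (e - e') * (2 * C' * (a0 / h))) by ring.
      apply Rmult_le_compat_l; auto. }
    apply Cmod_minus_0_eq. rewrite Ed, H. ring.
Qed.

Lemma Clog_conj (c : C) : Clog (Cconj c) = Cconj (Clog c).
Proof.
  unfold Clog. rewrite re_conj, im_conj. unfold Cconj, fst, snd. f_equal.
  - do 2 f_equal. ring.
  - rewrite <- atan_opp. f_equal. unfold Rdiv. ring.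
Qed.

Lemma level_conj (n s : nat) (z : C) (k : Z) : level n s z k -> level n s (Cconj z) (- k).
Proof.
  unfold level, loggap. intros H. rewrite pgf_conj, !Clog_conj.
  assert (RC : forall x, Cconj (RtoC x) = RtoC x) by (intros; unfold Cconj, RtoC; simpl; f_equal; ring).
  rewrite <- (RC (INR s)), <- (RC (INR n)), <- !Cmult_conj, <- Cminus_conj, H.
  unfold Cconj. simpl. rewrite opp_IZR. f_equal. ring.
Qed.

Lemma zero_at_conj (n s : nat) (z : C) : zero_at n s z -> zero_at n s (Cconj z).
Proof.
  intros [H1 H2]. split; [rewrite Cmod_conj; auto|]. rewrite pgf_conj, <- !Cpow_conj, H2. reflexivity.
Qed.

Lemma level_unique (n s : nat) (z : C) (k k' : Z) : level n s z k -> level n s z k' -> k = k'.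
Proof.
  unfold level. intros H H'. rewrite H in H'. injection H' as E. apply eq_IZR.
  pose proof PI_RGT_0. nra.
Qed.

Lemma rt_gap_uniform (B : R) (M : nat) : 0 < B -> exists del, 0 < del /\ forall m b, (m <= M)%nat -> 0 < b <= B ->
  Re (rt b (2 * PI * INR m)) + del <= Re (rt b (2 * PI * INR (S m))).
Proof.
  intros HB. pose proof PI_RGT_0. induction M as [|M [del [Hd IH]]].
  - destruct (Re_rt_gap B (2 * PI * INR 1) (2 * PI * INR 0) (2 * PI * INR 1) HB) as [del [Hd Hg]]; [simpl; lra|lra|].
    exists del. split; auto. intros m b Hm Hb. replace m with 0%nat by lia. auto.
  - pose proof (pos_INR (S M)).
    destruct (Re_rt_gap B (2 * PI * INR (S (S M))) (2 * PI * INR (S M)) (2 * PI * INR (S (S M))) HB) as [del' [Hd' Hg]];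
      [rewrite (S_INR (S M)); nra|lra|].
    exists (Rmin del del'). split; [apply Rmin_pos; auto|]. intros m b Hm Hb.
    pose proof (Rmin_l del del'). pose proof (Rmin_r del del').
    destruct (Nat.eq_dec m (S M)) as [->|N].
    + specialize (Hg b Hb). lra.
    + specialize (IH m b ltac:(lia) Hb). lra.
Qed.

(** For zeros on the scale 1/h, |z|^2 = 1 + 2 (a0/h) (b + Re rt) + O(1/h^2), and the real parts for
    consecutive levels are separated uniformly. So moduli increase with |k|, and a radius between
    two consecutive levels exists whether or not a zero of the higher level does. *)
Lemma zero_structure (M : nat) (KZ : R) : exists h0, 0 < h0 /\ forall n s gam h (Z : nat -> C),
  heavy n s gam h -> h0 <= h ->
  (forall k, (k <= M)%nat -> zero_at n s (Z k)) ->
  (forall k, (k <= M)%nat ->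
     Cmod (Z k - (1 + RtoC (a0 / h) * (RtoC (gam * a0 / 2) + rt (gam * a0 / 2) (2 * PI * INR k)))) <= KZ / h ^ 2) ->
  (forall k, (k <= M)%nat -> Cmod (Z k) <= R1 /\ pgf p (Z k) <> 0%C /\ logder p n s (Z k) <> 0%C /\ level n s (Z k) (Z.of_nat k)) /\
  Cconj (Z 0%nat) = Z 0%nat /\
  (forall k, (k < M)%nat -> Cmod (Z k) < Cmod (Z (S k))) /\
  (forall m, (m <= M)%nat -> exists R0, Cmod (Z m) < R0 <= R1 /\
     forall z, zero_at n s z -> Cmod z < R0 -> exists k, (k <= m)%nat /\ (z = Z k \/ z = Cconj (Z k))).
Proof.
  pose proof a0_pos as Ha. pose proof PI_RGT_0 as HPI.
  set (bhi := Rabs ghi * a0 / 2 + 1).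
  assert (Hbhi : 0 < bhi) by (unfold bhi; pose proof (Rabs_pos ghi); nra).
  set (Bq := 1 + bhi ^ 2 + 2 * PI * INR (S M)).
  assert (HBq : 0 < Bq) by (unfold Bq; pose proof (pow2_ge_0 bhi); pose proof (pos_INR (S M)); nra).
  destruct (rt_gap_uniform bhi M Hbhi) as [del [Hdel Hgap]].
  (* Chosen so that every radius [R0] used below satisfies R0 <= 1 + C1/h, the range covered by
     [zeros_near_1]. *)
  set (C1 := a0 * (2 * bhi + 2 * Bq)). assert (HC1 : 0 < C1) by (unfold C1; nra).
  destruct (zeros_near_1 p R1 Hp HR1 HR1r Haper Hmu ghi C1 HC1) as [C5 [h5 [Hh5 Hnear]]].
  set (KZ' := Rabs KZ). assert (HKZ : 0 <= KZ') by apply Rabs_pos.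
  set (C7 := a0 * (bhi + Bq) + KZ'). assert (HC7 : 0 < C7) by (unfold C7; nra).
  (* [C7] serves the given zeros, through their asymptotics, and [C5] an arbitrary zero of the disc,
     through [zeros_near_1]; [classify] compares the two kinds. *)
  set (Cw := Rmax C7 C5).
  assert (HCw7 : C7 <= Cw) by apply Rmax_l. assert (HCw5 : C5 <= Cw) by apply Rmax_r.
  assert (HCw : 0 < Cw) by lra. clearbody Cw.
  destruct (classify Cw HCw) as [C3 [h3 [HC3 [Hh3 Hcl]]]].
  set (C6 := 2 * a0 * C3 + Cw ^ 2). assert (HC6 : 0 < C6) by (unfold C6; pose proof (pow2_ge_0 Cw); nra).
  set (C8 := C3 + KZ' / a0). assert (HC8 : 0 < C8).
  { unfold C8. assert (0 <= KZ' / a0) by (apply Rdiv_le_0_compat; auto). lra. }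
  set (h6 := C6 / (a0 * del)). set (h8 := C8 * (2 * Bq + C8) / (2 * PI)). set (h9 := C1 / (R1 - 1)).
  assert (Hh6 : 0 < h6) by (apply Rdiv_lt_0_compat; nra). assert (Hh8 : 0 < h8) by (apply Rdiv_lt_0_compat; nra).
  assert (Hh9 : 0 < h9) by (apply Rdiv_lt_0_compat; lra).
  exists (1 + h5 + h3 + h6 + h8 + h9). split; [lra|].
  intros n s gam h Z Hheavy Hh HZ Hasy.
  pose proof Hheavy as [Htr Hgl]. pose proof Htr as [Hpos [Es [En Hg]]].
  set (b := gam * a0 / 2) in *.
  assert (Hb : 0 < b <= bhi) by (unfold b, bhi; pose proof (Rle_abs ghi); split; nra).
  assert (G6 : C6 < h * (a0 * del)).
  { replace C6 with (h6 * (a0 * del)) by (unfold h6; field; split; lra). apply Rmult_lt_compat_r; nra. }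
  assert (G8 : C8 * (2 * Bq + C8) < h * (2 * PI)).
  { replace (C8 * (2 * Bq + C8)) with (h8 * (2 * PI)) by (unfold h8; field; lra). apply Rmult_lt_compat_r; lra. }
  assert (G9 : C1 < h * (R1 - 1)).
  { replace C1 with (h9 * (R1 - 1)) by (unfold h9; field; lra). apply Rmult_lt_compat_r; lra. }
  assert (G1 : 1 < h) by lra. assert (G3 : h3 <= h) by lra. assert (G5 : h5 <= h) by lra.
  clearbody h6 h8 h9. clear Hh.
  assert (Hih : 0 < / h) by (apply Rinv_0_lt_compat; auto).
  assert (Hrtm : forall m, (m <= S M)%nat -> Cmod (rt b (2 * PI * INR m)) <= Bq).
  { intros m Hm. eapply Rle_trans; [apply Cmod_rt_le|]. unfold Bq.
    assert (b ^ 2 <= bhi ^ 2) by (apply pow_incr; lra).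
    assert (INR m <= INR (S M)) by (apply le_INR; auto). pose proof (pos_INR m).
    rewrite Rabs_pos_eq by nra. nra. }
  assert (Hrtr : forall m, (m <= S M)%nat -> 0 < Re (rt b (2 * PI * INR m)) <= Bq).
  { intros m Hm. pose proof (Re_rt_ge b (2 * PI * INR m) ltac:(lra)).
    pose proof (re_le_Cmod (rt b (2 * PI * INR m))). pose proof (Rle_abs (Re (rt b (2 * PI * INR m)))).
    pose proof (Hrtm m Hm). lra. }
  assert (Wz : forall k, (k <= M)%nat -> Cmod (Z k - 1) <= Cw / h).
  { intros k Hk. apply Rle_trans with (C7 / h); [|apply Rmult_le_compat_r; lra].
    replace (Z k - 1)%C with ((Z k - (1 + RtoC (a0 / h) * (RtoC b + rt b (2 * PI * INR k))))
      + RtoC (a0 / h) * (RtoC b + rt b (2 * PI * INR k)))%C by ring.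
    eapply Rle_trans; [apply Cmod_triangle|]. rewrite Cmod_mult, Cmod_R, (Rabs_pos_eq (a0 / h)) by (left; apply Rdiv_lt_0_compat; lra).
    assert (A1 : Cmod (RtoC b + rt b (2 * PI * INR k)) <= bhi + Bq).
    { eapply Rle_trans; [apply Cmod_triangle|]. rewrite Cmod_R, Rabs_pos_eq by lra.
      pose proof (Hrtm k ltac:(lia)). lra. }
    assert (A2 : KZ / h ^ 2 <= KZ' / h).
    { replace (KZ / h ^ 2) with (KZ / h / h) by (field; lra). apply Rmult_le_compat_r; [lra|].
      pose proof (Rle_abs KZ) as Q. fold KZ' in Q. apply Rmult_le_reg_r with h; auto.
      unfold Rdiv. rewrite Rmult_assoc, Rinv_l by lra. nra. }
    pose proof (Hasy k Hk) as A3.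
    replace (C7 / h) with (KZ' / h + a0 / h * (bhi + Bq)) by (unfold C7; field; lra).
    apply Rplus_le_compat; [lra|]. apply Rmult_le_compat_l; [left; apply Rdiv_lt_0_compat; lra|auto]. }
  assert (Hmod : forall z k, zero_at n s z -> Cmod (z - 1) <= Cw / h -> level n s z k ->
     Rabs (Cmod z ^ 2 - (1 + 2 * (a0 / h) * (b + Re (rt b (2 * PI * IZR k))))) <= C6 / h ^ 2).
  { intros z k Hz Hw Hk. destruct (Hcl n s gam h z z Hheavy G3 Hz Hw Hz Hw) as [_ [_ [_ [_ [N _]]]]].
    specialize (N k Hk). fold b in N.
    assert (Em : Cmod z ^ 2 = 1 + 2 * Re (z - 1)%C + Cmod (z - 1) ^ 2).
    { rewrite <- Cmod_one_plus_sq. do 2 f_equal. ring. }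
    assert (Er : Re (z - 1)%C = a0 / h * Re (eta h z)).
    { rewrite (eta_inv h z Hpos). unfold Re, RtoC, Cmult. simpl. ring. }
    pose proof (re_le_Cmod (eta h z - (RtoC b + rt b (2 * PI * IZR k)))) as Q.
    change (Re (eta h z - (RtoC b + rt b (2 * PI * IZR k)))%C) with (Re (eta h z) - (b + Re (rt b (2 * PI * IZR k)))) in Q.
    rewrite Em, Er.
    replace (1 + 2 * (a0 / h * Re (eta h z)) + Cmod (z - 1) ^ 2 - (1 + 2 * (a0 / h) * (b + Re (rt b (2 * PI * IZR k)))))
      with (2 * (a0 / h) * (Re (eta h z) - (b + Re (rt b (2 * PI * IZR k)))) + Cmod (z - 1) ^ 2) by ring.
    eapply Rle_trans; [apply Rabs_triang|]. rewrite Rabs_mult.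
    assert (P : 0 < a0 / h) by (apply Rdiv_lt_0_compat; lra).
    rewrite (Rabs_pos_eq (2 * (a0 / h))), (Rabs_pos_eq (Cmod (z - 1) ^ 2)) by (try apply pow2_ge_0; lra).
    replace (C6 / h ^ 2) with (2 * (a0 / h) * (C3 / h) + (Cw / h) ^ 2) by (unfold C6; field; lra).
    apply Rplus_le_compat; [apply Rmult_le_compat_l; lra|]. apply pow_incr. split; [apply Cmod_ge_0|auto]. }
  (* The given asymptotics and the classification place eta within O(1/h) of b + q and of b + q'.
     But q'^2 - q^2 = 2 pi i (k - k') has modulus at least 2 pi unless k = k'. *)
  assert (Hlev : forall k, (k <= M)%nat -> level n s (Z k) (Z.of_nat k)).
  { intros k Hk. destruct (Hcl n s gam h (Z k) (Z k) Hheavy G3 (HZ k Hk) (Wz k Hk) (HZ k Hk) (Wz k Hk)) as [_ [_ [_ [[k' Hk'] [N _]]]]].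
    specialize (N k' Hk'). fold b in N.
    replace (Z.of_nat k) with k'; auto.
    set (q := rt b (2 * PI * INR k)) in *. set (q' := rt b (2 * PI * IZR k')) in *.
    assert (N2 : Cmod (eta h (Z k) - (RtoC b + q)) <= KZ' / a0 / h).
    { specialize (Hasy k Hk). fold q in Hasy.
      replace (eta h (Z k) - (RtoC b + q))%C with (RtoC (h / a0) * (Z k - (1 + RtoC (a0 / h) * (RtoC b + q))))%C.
      - rewrite Cmod_mult, Cmod_R, Rabs_pos_eq by (left; apply Rdiv_lt_0_compat; lra).
        apply Rle_trans with (h / a0 * (KZ' / h ^ 2)); [|right; field; lra].
        apply Rmult_le_compat_l; [left; apply Rdiv_lt_0_compat; lra|].
        eapply Rle_trans; [exact Hasy|]. apply Rmult_le_compat_r; [left; apply Rinv_0_lt_compat, pow_lt; auto|apply Rle_abs].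
      - unfold eta.
        replace (RtoC (h / a0) * (Z k - (1 + RtoC (a0 / h) * (RtoC b + q))))%C
          with (RtoC (h / a0) * (Z k - 1) - RtoC (h / a0 * (a0 / h)) * (RtoC b + q))%C by (rewrite RtoC_mult; ring).
        replace (h / a0 * (a0 / h)) with 1 by (field; lra). ring. }
    assert (N3 : Cmod (q' - q) <= C8 / h).
    { replace (q' - q)%C with ((eta h (Z k) - (RtoC b + q)) - (eta h (Z k) - (RtoC b + q')))%C by ring.
      eapply Rle_trans; [apply Cmod_triangle_minus|]. replace (C8 / h) with (KZ' / a0 / h + C3 / h) by (unfold C8; field; lra). lra. }
    assert (N4 : Cmod (q' + q) <= 2 * Bq + C8).
    { replace (q' + q)%C with ((q' - q) + RtoC 2 * q)%C by ring. eapply Rle_trans; [apply Cmod_triangle|].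
      rewrite Cmod_mult, Cmod_R, Rabs_pos_eq by lra. pose proof (Hrtm k ltac:(lia)) as Q. fold q in Q.
      assert (C8 / h <= C8); [|lra]. apply Rmult_le_reg_r with h; auto. unfold Rdiv. rewrite Rmult_assoc, Rinv_l by lra. nra. }
    assert (N5 : Cmod ((q' - q) * (q' + q)) < 2 * PI).
    { rewrite Cmod_mult. apply Rle_lt_trans with (C8 / h * (2 * Bq + C8)).
      - apply Rmult_le_compat; auto; apply Cmod_ge_0.
      - apply Rmult_lt_reg_r with h; auto. replace (C8 / h * (2 * Bq + C8) * h) with (C8 * (2 * Bq + C8)) by (field; lra). lra. }
    replace ((q' - q) * (q' + q))%C with (q' * q' - q * q)%C in N5 by ring.
    unfold q, q' in N5. rewrite !rt_sq in N5.
    replace (RtoC (b ^ 2) - RtoC (2 * PI * IZR k') * Ci - (RtoC (b ^ 2) - RtoC (2 * PI * INR k) * Ci))%C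
      with (RtoC (2 * PI * (INR k - IZR k')) * Ci)%C in N5 by (rewrite !RtoC_mult, RtoC_minus; ring).
    rewrite Cmod_mult, Cmod_Ci, Rmult_1_r, Cmod_R, (Rabs_mult (2 * PI)), (Rabs_pos_eq (2 * PI)) in N5 by lra.
    assert (N6 : Rabs (INR k - IZR k') < 1) by nra.
    rewrite INR_IZR_INZ, <- minus_IZR, <- abs_IZR in N6. apply lt_IZR in N6. lia. }
  (* 1 + x m is the midpoint of the first-order predictions of |z|^2 for the levels m and m + 1; by
     [Gd] the gap beats the error [C6] / h^2. *)
  set (x := fun m => a0 / h * (2 * b + Re (rt b (2 * PI * INR m)) + Re (rt b (2 * PI * INR (S m))))).
  assert (Pah : 0 < a0 / h) by (apply Rdiv_lt_0_compat; lra).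
  assert (Gd : C6 / h ^ 2 < a0 / h * del).
  { apply Rmult_lt_reg_r with (h ^ 2); [apply pow_lt; auto|].
    replace (C6 / h ^ 2 * h ^ 2) with C6 by (field; lra). replace (a0 / h * del * h ^ 2) with (h * (a0 * del)) by (field; lra). auto. }
  assert (Lo : forall m, (m <= M)%nat -> Cmod (Z m) ^ 2 < 1 + x m).
  { intros m Hm. pose proof (Hmod (Z m) _ (HZ m Hm) (Wz m Hm) (Hlev m Hm)) as Q.
    rewrite <- INR_IZR_INZ in Q. apply Rabs_le_between in Q. pose proof (Hgap m b Hm Hb) as G. unfold x.
    assert (a0 / h * del <= a0 / h * (Re (rt b (2 * PI * INR (S m))) - Re (rt b (2 * PI * INR m)))) by (apply Rmult_le_compat_l; lra).
    lra. }
  assert (Hi : forall m z k, (m <= M)%nat -> zero_at n s z -> Cmod (z - 1) <= Cw / h -> level n s z (Z.of_nat k) ->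
     (m < k)%nat -> 1 + x m < Cmod z ^ 2).
  { intros m z k Hm Hz Hw Hk Hmk. pose proof (Hmod z _ Hz Hw Hk) as Q.
    rewrite <- INR_IZR_INZ in Q. apply Rabs_le_between in Q. pose proof (Hgap m b Hm Hb) as G. unfold x.
    assert (Mo : Re (rt b (2 * PI * INR (S m))) <= Re (rt b (2 * PI * INR k))).
    { apply Re_rt_mono. pose proof (le_INR (S m) k ltac:(lia)). pose proof (pos_INR (S m)).
      rewrite !Rabs_pos_eq by nra. nra. }
    assert (a0 / h * del <= a0 / h * (Re (rt b (2 * PI * INR (S m))) - Re (rt b (2 * PI * INR m)))) by (apply Rmult_le_compat_l; lra).
    assert (a0 / h * Re (rt b (2 * PI * INR (S m))) <= a0 / h * Re (rt b (2 * PI * INR k))) by (apply Rmult_le_compat_l; lra).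
    lra. }
  split; [|split; [|split]].
  - intros k Hk. destruct (Hcl n s gam h (Z k) (Z k) Hheavy G3 (HZ k Hk) (Wz k Hk) (HZ k Hk) (Wz k Hk)) as [_ [PX [NL _]]].
    split; [|split; [|split; auto]].
    + pose proof (Cmod_triangle (Z k - 1) 1) as T. replace (Z k - 1 + 1)%C with (Z k) in T by ring.
      rewrite Cmod_1 in T. assert (Q := Lo k Hk). assert (Hx : x k <= C1 / h).
      { unfold x, C1. replace (a0 * (2 * bhi + 2 * Bq) / h) with (a0 / h * (2 * bhi + 2 * Bq)) by (field; lra).
        apply Rmult_le_compat_l; [lra|]. pose proof (Hrtr k ltac:(lia)). pose proof (Hrtr (S k) ltac:(lia)). lra. }
      assert (C1 / h <= R1 - 1).
      { apply Rmult_le_reg_r with h; auto. unfold Rdiv. rewrite Rmult_assoc, Rinv_l by lra. lra. }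
      pose proof (Cmod_ge_0 (Z k)). nra.
    + intros Q. rewrite Q in PX. unfold Re in PX. simpl in PX. lra.
  - assert (H0 := Nat.le_0_l M).
    pose proof (level_conj _ _ _ _ (Hlev 0%nat H0)) as Lc. simpl in Lc.
    assert (Wc : Cmod (Cconj (Z 0%nat) - 1) <= Cw / h).
    { replace (Cconj (Z 0%nat) - 1)%C with (Cconj (Z 0%nat - 1)); [rewrite Cmod_conj; auto|].
      rewrite Cminus_conj. f_equal. unfold Cconj, RtoC. simpl. f_equal. ring. }
    destruct (Hcl n s gam h _ _ Hheavy G3 (zero_at_conj _ _ _ (HZ 0%nat H0)) Wc (HZ 0%nat H0) (Wz 0%nat H0)) as [_ [_ [_ [_ [_ U]]]]].
    exact (U 0%Z Lc (Hlev 0%nat (Nat.le_0_l M))).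
  - intros k Hk. pose proof (Lo k ltac:(lia)) as A.
    pose proof (Hi k (Z (S k)) (S k) ltac:(lia) (HZ (S k) ltac:(lia)) (Wz (S k) ltac:(lia)) (Hlev (S k) ltac:(lia)) ltac:(lia)) as B.
    pose proof (Cmod_ge_0 (Z k)). pose proof (Cmod_ge_0 (Z (S k))). nra.
  - intros m Hm. exists (sqrt (1 + x m)).
    assert (Hx0 : 0 < x m).
    { unfold x. apply Rmult_lt_0_compat; auto. pose proof (Hrtr m ltac:(lia)). pose proof (Hrtr (S m) ltac:(lia)). lra. }
    assert (Hx1 : x m <= C1 / h).
    { unfold x, C1. replace (a0 * (2 * bhi + 2 * Bq) / h) with (a0 / h * (2 * bhi + 2 * Bq)) by (field; lra).
      apply Rmult_le_compat_l; [lra|]. pose proof (Hrtr m ltac:(lia)). pose proof (Hrtr (S m) ltac:(lia)). lra. }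
    assert (C1h : C1 / h <= R1 - 1).
    { apply Rmult_le_reg_r with h; auto. unfold Rdiv. rewrite Rmult_assoc, Rinv_l by lra. lra. }
    pose proof (sqrt_sqrt (1 + x m) ltac:(lra)) as SQ. pose proof (sqrt_pos (1 + x m)) as SP.
    set (R0 := sqrt (1 + x m)) in *.
    assert (HR0 : R0 <= 1 + C1 / h) by nra.
    split; [split; [pose proof (Lo m Hm); pose proof (Cmod_ge_0 (Z m)); nra|lra]|].
    intros z Hz HzR.
    assert (Wzz : Cmod (z - 1) <= Cw / h).
    { apply Rle_trans with (C5 / h); [|apply Rmult_le_compat_r; lra].
      apply (Hnear n s gam h z Htr G5); [destruct Hz; split; lra|apply Hz]. }
    assert (W : forall y k, zero_at n s y -> Cmod (y - 1) <= Cw / h -> Cmod y < R0 -> level n s y (Z.of_nat k) ->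
       (k <= m)%nat /\ y = Z k).
    { intros y k Hy Wy Hyr Hk.
      assert (Hkm : (k <= m)%nat).
      { apply Nat.nlt_ge. intros N. pose proof (Hi m y k Hm Hy Wy Hk N). pose proof (Cmod_ge_0 y). nra. }
      split; auto.
      destruct (Hcl n s gam h y (Z k) Hheavy G3 Hy Wy (HZ k ltac:(lia)) (Wz k ltac:(lia))) as [_ [_ [_ [_ [_ U]]]]].
      apply (U (Z.of_nat k)); auto. apply Hlev. lia. }
    destruct (Hcl n s gam h z z Hheavy G3 Hz Wzz Hz Wzz) as [_ [_ [_ [[k Hk] _]]]].
    (* A zero of negative level is the conjugate of one of positive level, to which uniqueness
       applies. *)
    destruct (Z_le_gt_dec 0 k) as [Hk0|Hk0].
    + destruct (W z (Z.to_nat k) Hz Wzz HzR) as [A B]; [rewrite Z2Nat.id; auto|]. exists (Z.to_nat k). auto.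
    + destruct (W (Cconj z) (Z.to_nat (- k))) as [A B].
      * apply zero_at_conj; auto.
      * replace (Cconj z - 1)%C with (Cconj (z - 1)); [rewrite Cmod_conj; auto|].
        rewrite Cminus_conj. f_equal. unfold Cconj, RtoC. simpl. f_equal. ring.
      * rewrite Cmod_conj. auto.
      * rewrite Z2Nat.id by lia. apply level_conj; auto.
      * exists (Z.to_nat (- k)). split; auto. right. rewrite <- B, Cconj_conj. reflexivity.
Qed.
End Classification.

(** * Poles, residues and the tail of a single model *)

Definition dcharf (p : nat -> R) (n s : nat) (z : C) : C :=
  (INR s * 1 * z ^ pred s - INR n * pgf (PS_derive p) z * pgf p z ^ pred n)%C.

Lemma charf_Cder (p : nat -> R) (n s : nat) (z : C) : Rbar_lt (Cmod z) (CV_radius p) ->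
  Cder (charf p n s) z (dcharf p n s z).
Proof.
  intros H. unfold charf, dcharf. apply Cder_minus.
  - apply (Cder_pow (fun u => u)). apply Cder_id.
  - apply (Cder_pow (pgf p)). apply pgf_Cder. exact H.
Qed.

(** At a zero, X^n in the derivative may be replaced by z^s; thus a nonvanishing [logder] means a
    simple zero. *)
Lemma dcharf_logder (p : nat -> R) (n s : nat) (z : C) : (0 < n)%nat -> (0 < s)%nat ->
  z <> 0%C -> pgf p z <> 0%C -> (z ^ s = pgf p z ^ n)%C ->
  dcharf p n s z = (z ^ s * logder p n s z)%C.
Proof.
  intros Hn Hs Nz NX E. unfold dcharf, logder. destruct n as [|n]; [lia|]. destruct s as [|s]; [lia|].
  change (pred (S n)) with n. change (pred (S s)) with s.
  replace (z ^ S s * (INR (S s) / z - INR (S n) * (pgf (PS_derive p) z / pgf p z)))%C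
    with (z ^ S s * (INR (S s) / z) - z ^ S s * (INR (S n) * (pgf (PS_derive p) z / pgf p z)))%C by ring.
  rewrite E at 2. rewrite !Cpow_S. field. auto.
Qed.

Lemma Cconj_RtoC (x : R) : Cconj (RtoC x) = RtoC x.
Proof. unfold Cconj, RtoC. simpl. f_equal. ring. Qed.

Lemma dcharf_conj (p : nat -> R) (n s : nat) (z : C) : dcharf p n s (Cconj z) = Cconj (dcharf p n s z).
Proof.
  unfold dcharf. rewrite !pgf_conj, Cminus_conj, !Cmult_conj, !Cpow_conj, !Cconj_RtoC. reflexivity.
Qed.

Lemma term_conj (c Z : C) (N : nat) : 1 < Cmod Z -> term (Cconj c) (Cconj Z) N = Cconj (term c Z N).
Proof.
  intros H. destruct (term_neq_0 Z H) as [N1 N2]. unfold term.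
  rewrite Cdiv_conj by (apply Cmult_neq_0; auto; apply Cpow_nz; auto).
  rewrite Cmult_conj, Cminus_conj, Cpow_conj, Cconj_RtoC. reflexivity.
Qed.

(** The pole of index 0 is real and listed once; every other one comes with its conjugate, whose
    residue is the conjugate residue. *)
Fixpoint pole_list (c Z : nat -> C) (m : nat) : list (C * C) :=
  match m with
  | O => (Z 0%nat, c 0%nat) :: nil
  | S m' => (Z m, c m) :: (Cconj (Z m), Cconj (c m)) :: pole_list c Z m'
  end.

Lemma pole_list_in (c Z : nat -> C) (m : nat) (q : C * C) : In q (pole_list c Z m) ->
  exists k, (k <= m)%nat /\ (q = (Z k, c k) \/ q = (Cconj (Z k), Cconj (c k))).
Proof.
  induction m as [|m IH]; simpl.
  - intros [<-|[]]. exists 0%nat. auto.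
  - intros [<-|[<-|H]]; [exists (S m); auto|exists (S m); auto|].
    destruct (IH H) as [k [Hk E]]. exists k. split; [lia|auto].
Qed.

Lemma in_pole_list (c Z : nat -> C) (m k : nat) (z : C) : Cconj (Z 0%nat) = Z 0%nat -> (k <= m)%nat ->
  z = Z k \/ z = Cconj (Z k) -> In z (map fst (pole_list c Z m)).
Proof.
  intros H0 Hk Hz. induction m as [|m IH].
  - replace k with 0%nat in Hz by lia. rewrite H0 in Hz. left. simpl. destruct Hz; auto.
  - destruct (Nat.eq_dec k (S m)) as [->|N].
    + simpl. destruct Hz; auto.
    + right. right. apply IH. lia.
Qed.

(** A conjugate pair contributes twice the real part of one term, the factor 2 of [partial];
    including index m here corresponds to m + 1 summands there. *)
Lemma Re_term_sum_pole_list (c Z : nat -> C) (m N : nat) : (forall k, (k <= m)%nat -> 1 < Cmod (Z k)) ->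
  Re (term_sum (pole_list c Z m) N) = Re (partial c Z (S m) N).
Proof.
  induction m as [|m IH]; intros H.
  - simpl. unfold Re. simpl. ring.
  - change (term_sum (pole_list c Z (S m)) N) with
      (term (c (S m)) (Z (S m)) N + (term (Cconj (c (S m))) (Cconj (Z (S m))) N + term_sum (pole_list c Z m) N))%C.
    change (partial c Z (S (S m)) N) with (partial c Z (S m) N + 2 * term (c (S m)) (Z (S m)) N)%C.
    rewrite term_conj by (apply H; lia).
    transitivity (Re (term (c (S m)) (Z (S m)) N) + (Re (Cconj (term (c (S m)) (Z (S m)) N)) + Re (term_sum (pole_list c Z m) N)));
      [reflexivity|].
    rewrite re_conj, IH by (intros; apply H; lia). unfold Re. simpl. ring.
Qed.

Section OneModel.
Variables (p : nat -> R) (n s : nat) (pi : nat -> R) (V : C -> C) (R1 R0 : R) (Z c : nat -> C) (m : nat).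
Hypothesis Hp : is_pmf p.
Hypothesis Hr : Rbar_lt R1 (CV_radius p).
Hypothesis HR1 : 1 < R1.
Hypothesis Hmu : 0 < pgf_mean p.
Hypothesis Hn : (0 < n)%nat.
Hypothesis Hs : (0 < s)%nat.
Hypothesis Hstab : INR n * pgf_mean p < INR s.
Hypothesis Hpi : stationary (convpow p n) s pi.
Hypothesis HV : forall z, Cmod z < 1 -> V z = pgf pi z.
Hypothesis Hhol : forall z, Rbar_lt (Cmod z) (CV_radius p) -> ~ (1 < Cmod z /\ charf p n s z = 0%C) -> Cdiff V z.
Hypothesis HZ : forall k, (k <= m)%nat -> zero_at p n s (Z k) /\ pgf p (Z k) <> 0%C /\
  logder p n s (Z k) <> 0%C /\ level p n s (Z k) (Z.of_nat k) /\ Cmod (Z k) <= Cmod (Z m).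
Hypothesis HZ0 : Cconj (Z 0%nat) = Z 0%nat.
Hypothesis HR0 : Cmod (Z m) < R0 <= R1.
Hypothesis Hall : forall z, zero_at p n s z -> Cmod z < R0 -> exists k, (k <= m)%nat /\ (z = Z k \/ z = Cconj (Z k)).
Hypothesis Hc : forall k, (k <= m)%nat -> is_residue V (Z k) (c k).

Let b := conv pi (convpow p n).
Let L := pole_list c Z m.

Let Hin (z : C) : Cmod z < R0 -> Rbar_lt (Cmod z) (CV_radius p).
Proof. intros H. eapply Rbar_lt_trans; [|exact Hr]. simpl. lra. Qed.

Let zero_charf (z : C) : charf p n s z = 0%C <-> (z ^ s = pgf p z ^ n)%C.
Proof.
  unfold charf. split; intros H.
  - replace (z ^ s)%C with (z ^ s - pgf p z ^ n + pgf p z ^ n)%C by ring. rewrite H. ring.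
  - rewrite H. ring.
Qed.

Let L_gt1 (q : C * C) : In q L -> 1 < Cmod (fst q) < R0.
Proof.
  intros H. apply pole_list_in in H. destruct H as [k [Hk Hq]].
  destruct (HZ k Hk) as [[A _] [_ [_ [_ B]]]].
  destruct Hq as [-> | ->]; simpl; rewrite ?Cmod_conj; lra.
Qed.

Let S_gt1 (z : C) : In z (map fst L) -> 1 < Cmod z < R0.
Proof. intros H. apply in_map_iff in H. destruct H as [q [<- Hq]]. apply L_gt1; auto. Qed.

(** The listed poles have the distinct levels 0, 1, -1, ..., m, -m, and a point has only one
    level. *)
Lemma pole_list_NoDup : NoDup (map fst L).
Proof.
  unfold L.
  assert (Lv : forall k, (k <= m)%nat -> forall z, In z (map fst (pole_list c Z k)) ->
     exists i, (Z.abs i <= Z.of_nat k)%Z /\ level p n s z i).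
  { intros k Hk z Hz. apply in_map_iff in Hz. destruct Hz as [q [<- Hq]].
    apply pole_list_in in Hq. destruct Hq as [i [Hi Hq]].
    destruct (HZ i ltac:(lia)) as [_ [_ [_ [Li _]]]].
    destruct Hq as [-> | ->]; simpl.
    - exists (Z.of_nat i). split; auto. lia.
    - exists (- Z.of_nat i)%Z. split; [lia|]. apply level_conj; auto. }
  assert (K : forall k, (k <= m)%nat -> NoDup (map fst (pole_list c Z k))).
  { induction k as [|k IH]; intros Hk.
    - simpl. constructor; [intros []|constructor].
    - destruct (HZ (S k) Hk) as [_ [_ [_ [Li _]]]]. simpl. constructor; [|constructor; [|apply IH; lia]].
      + intros [Q|Q].
        * pose proof (level_conj _ _ _ _ _ Li) as Lc. rewrite Q in Lc.
          pose proof (level_unique _ _ _ _ _ _ Li Lc). lia.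
        * destruct (Lv k ltac:(lia) _ Q) as [i [Hi Hl]]. pose proof (level_unique _ _ _ _ _ _ Li Hl). lia.
      + intros Q. destruct (Lv k ltac:(lia) _ Q) as [i [Hi Hl]].
        pose proof (level_unique _ _ _ _ _ _ (level_conj _ _ _ _ _ Li) Hl). lia. }
  apply K. lia.
Qed.

Lemma V_diff (z : C) : Cmod z < R0 -> ~ In z (map fst L) -> Cdiff V z.
Proof.
  intros Hz N. apply Hhol; [apply Hin; auto|]. intros [A B]. apply N.
  destruct (Hall z) as [k [Hk E]]; [split; auto; apply zero_charf; auto|auto|].
  apply (in_pole_list c Z m k z HZ0 Hk E).
Qed.

Lemma numer_identity (z : C) : Cmod z < R0 -> ~ In z (map fst L) -> (V z * charf p n s z = numer b s z)%C.
Proof.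
  intros Hz N.
  assert (E : (V z * charf p n s z - numer b s z)%C = 0%C).
  { apply (identity_punctured_disc (fun z => V z * charf p n s z - numer b s z)%C (map fst L) R0 1); auto; try lra.
    - intros Q. apply S_gt1 in Q. rewrite Cmod_0 in Q. lra.
    - intros u Hu Nu. apply Cdiff_minus; [|apply numer_Cdiff]. apply Cdiff_mult; [apply V_diff; auto|].
      eexists. apply charf_Cder. auto.
    - intros x Hx. rewrite HV by (rewrite Cmod_R; auto).
      unfold b. rewrite <- (functional_equation _ _ _ (convpow_bounds p n Hp) Hpi x Hx).
      rewrite PSeries_convpow by auto. unfold charf. rewrite !pgf_real, <- !RtoC_pow, <- RtoC_minus, <- RtoC_mult.
      ring. }
  replace (V z * charf p n s z)%C with (V z * charf p n s z - numer b s z + numer b s z)%C by ring. rewrite E. ring.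
Qed.

Lemma dcharf_neq_0 (k : nat) : (k <= m)%nat -> dcharf p n s (Z k) <> 0%C.
Proof.
  intros Hk. destruct (HZ k Hk) as [[A B] [NX [NL _]]].
  assert (Nz : Z k <> 0%C) by (apply Cmod_gt_0; lra).
  rewrite dcharf_logder by auto. apply Cmult_neq_0; auto. apply Cpow_nz; auto.
Qed.

Lemma V_pole (z : C) : In z (map fst L) -> zero_at p n s z -> dcharf p n s z <> 0%C ->
  pole_at V z (numer b s z / dcharf p n s z)%C.
Proof.
  intros Hz Hz0 Nd. pose proof (S_gt1 z Hz) as B.
  (* Dropping z from the list gives a ball around z free of the other poles, so [numer_identity]
     holds in it except at z. *)
  destruct (ball_avoids_list (remove Ceq_dec z (map fst L)) z (remove_In Ceq_dec _ _)) as [d [Hd Ha]].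
  apply (quotient_pole V (numer b s) (charf p n s) z (dcharf p n s z) (Rmin d (R0 - Cmod z))); auto.
  - apply Rmin_pos; lra.
  - intros u _. apply numer_Cdiff.
  - intros u Hu. pose proof (Rmin_r d (R0 - Cmod z)). pose proof (Cmod_minus_ge u z).
    eexists. apply charf_Cder. apply Hin. lra.
  - apply zero_charf, Hz0.
  - apply charf_Cder. apply Hin. lra.
  - intros u Hu Nu. pose proof (Rmin_r d (R0 - Cmod z)). pose proof (Rmin_l d (R0 - Cmod z)).
    pose proof (Cmod_minus_ge u z). apply numer_identity; [lra|].
    intros Q. apply (Ha u); [lra|]. apply in_in_remove; auto.
Qed.

Lemma residue_value (k : nat) : (k <= m)%nat -> c k = (numer b s (Z k) / dcharf p n s (Z k))%C.
Proof.
  intros Hk. apply (is_residue_pole V (Z k)); [|apply Hc; auto].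
  apply V_pole; [|apply HZ; auto|apply dcharf_neq_0; auto].
  apply (in_pole_list c Z m k); auto.
Qed.

(** Needed for the ratio estimate, where the term of index m - 1 stands on the larger side. The
    numerator cannot vanish outside the unit disc because some weight is positive. *)
Lemma residue_neq_0 (k : nat) : (k <= m)%nat -> c k <> 0%C.
Proof.
  intros Hk. rewrite residue_value by auto. destruct (HZ k Hk) as [[A _] _].
  apply Cmult_neq_0.
  - apply numer_neq_0; auto.
    + intros i. apply conv_bounds; [apply Hpi|]. apply convpow_bounds; auto.
    + apply (stationary_weight_pos p pi n s); auto.
      eapply Rbar_lt_trans; [|exact Hr]. exact HR1.
  - intros Q. pose proof (dcharf_neq_0 k Hk) as N. apply (Cinv_r _) in N. rewrite Q, Cmult_0_r in N.
    apply RtoC_inj in N. lra.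
Qed.

(** The expansion with all poles of index at most m has error O(rho^-N) with rho > |Z_m|. The term
    of index m, itself of order |Z_m|^-N, is then counted as error. *)
Lemma tail_partial_bound : exists K, forall N,
  Rabs (tailP pi N - Re (partial c Z m N)) <= K * / (Cmod (Z m) ^ N).
Proof.
  assert (Hpol : forall q, In q L -> pole_at V (fst q) (snd q)).
  { intros q Hq. pose proof (in_map fst _ _ Hq) as Hq'. apply pole_list_in in Hq. destruct Hq as [k [Hk Eq]].
    destruct (HZ k Hk) as [Hz _]. pose proof (dcharf_neq_0 k Hk) as Nd.
    destruct Eq as [-> | ->]; simpl in *.
    - rewrite residue_value by auto. apply V_pole; auto.
    - rewrite residue_value by auto. rewrite Cdiv_conj by auto. rewrite <- numer_conj, <- dcharf_conj.
      apply V_pole; auto; [apply zero_at_conj; auto|].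
      rewrite dcharf_conj. intros Q. apply Nd. rewrite <- (Cconj_conj (dcharf _ _ _ _)), Q. apply Cconj_RtoC. }
  destruct (HZ m (Nat.le_refl m)) as [[Zm _] _].
  set (rho := (Cmod (Z m) + R0) / 2).
  destruct (tail_expansion pi V L rho R0) as [K [HK HT]]; auto.
  - apply Hpi.
  - apply pole_list_NoDup.
  - intros q Hq. apply L_gt1; auto.
  - intros z Hz N. apply V_diff; auto.
  - unfold rho. lra.
  - exists (K + 2 * (Cmod (c m) / (Cmod (1 - Z m) * Cmod (Z m)))). intros N. specialize (HT N).
    unfold L in HT. rewrite Re_term_sum_pole_list in HT by (intros k Hk; apply (HZ k Hk)).
    change (partial c Z (S m) N) with (partial c Z m N + (if Nat.eqb m 0 then 1 else 2) * term (c m) (Z m) N)%C in HT.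
    set (t := ((if Nat.eqb m 0 then 1 else 2) * term (c m) (Z m) N)%C) in *.
    change (Re (partial c Z m N + t)%C) with (Re (partial c Z m N) + Re t) in HT.
    assert (Ht : Rabs (Re t) <= 2 * Cmod (term (c m) (Z m) N)).
    { eapply Rle_trans; [apply re_le_Cmod|]. unfold t. rewrite Cmod_mult. apply Rmult_le_compat_r; [apply Cmod_ge_0|].
      destruct (Nat.eqb m 0); rewrite Cmod_R, Rabs_pos_eq; lra. }
    rewrite Cmod_term in Ht by auto.
    assert (HP : / rho ^ N <= / Cmod (Z m) ^ N).
    { apply Rinv_le_contravar; [apply pow_lt; lra|]. apply pow_incr. unfold rho. lra. }
    replace (tailP pi N - Re (partial c Z m N)) with ((tailP pi N - (Re (partial c Z m N) + Re t)) + Re t) by ring.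
    eapply Rle_trans; [apply Rabs_triang|].
    assert (K * / rho ^ N <= K * / Cmod (Z m) ^ N) by (apply Rmult_le_compat_l; auto). lra.
Qed.
End OneModel.

(** * From a single model to the heavy-traffic family *)

Lemma term_ratio_bound (c c' Z Z' : C) : 1 < Cmod Z -> 1 < Cmod Z' -> c <> 0%C ->
  exists K, forall N, Cmod (term c' Z' N) <= K * (Cmod Z / Cmod Z') ^ N * Cmod (term c Z N).
Proof.
  intros H H' Hc. apply Cmod_gt_0 in Hc.
  destruct (term_neq_0 Z H) as [_ N1]. destruct (term_neq_0 Z' H') as [_ N2].
  apply Cmod_gt_0 in N1. apply Cmod_gt_0 in N2.
  exists (Cmod c' / (Cmod (1 - Z') * Cmod Z') * / (Cmod c / (Cmod (1 - Z) * Cmod Z))). intros N.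
  rewrite !Cmod_term by auto. right. unfold Rdiv at 4. rewrite Rpow_mult_distr, pow_inv.
  pose proof (pow_lt (Cmod Z) N ltac:(lra)). pose proof (pow_lt (Cmod Z') N ltac:(lra)).
  field. repeat split; lra.
Qed.

Lemma eventually_le_all (Q : nat -> nat -> Prop) (M : nat) :
  (forall k, exists j0, forall j, (j0 <= j)%nat -> Q k j) ->
  exists j0, forall j, (j0 <= j)%nat -> forall k, (k <= M)%nat -> Q k j.
Proof.
  intros H. induction M as [|M [j1 H1]].
  - destruct (H 0%nat) as [j0 H0]. exists j0. intros j Hj k Hk. replace k with 0%nat by lia. auto.
  - destruct (H (S M)) as [j2 H2]. exists (Nat.max j1 j2). intros j Hj k Hk.
    destruct (Nat.eq_dec k (S M)) as [->|N]; [apply H2; lia|apply H1; lia].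
Qed.

Lemma uniform_const (Q : nat -> R -> Prop) (M : nat) : (forall k a b, a <= b -> Q k a -> Q k b) ->
  (forall k, exists K, Q k K) -> exists K, forall k, (k <= M)%nat -> Q k K.
Proof.
  intros Hm H. induction M as [|M [K1 H1]].
  - destruct (H 0%nat) as [K HK]. exists K. intros k Hk. replace k with 0%nat by lia. auto.
  - destruct (H (S M)) as [K2 H2]. exists (Rmax K1 K2). intros k Hk.
    destruct (Nat.eq_dec k (S M)) as [->|N]; [apply (Hm _ K2); [apply Rmax_r|auto]|].
    apply (Hm _ K1); [apply Rmax_l|apply H1; lia].
Qed.

Theorem theorem5p6
  (* the distribution of X and its PGF data *)
  (p : nat -> R) (r : Rbar)
  (Hp : is_pmf p)
  (Hr : CV_radius p = r) (Hr1 : Rbar_lt 1 r)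
  (Hmu : 0 < pgf_mean p) (Hsig : 0 < pgf_var p)
  (Haper : forall (r1 : R) (z : C), 0 < r1 -> Rbar_lt r1 r ->
      Cmod z = r1 -> z <> RtoC r1 -> Cmod (pgf p z) < Re (pgf p (RtoC r1)))
  (* a heavy-traffic family of parameters (n_j, s_j), j = 0,1,2,... *)
  (n s : nat -> nat)
  (Hn : forall j, (0 < n j)%nat) (Hs : forall j, (0 < s j)%nat)
  (Hsinf : forall K : nat, exists j0, forall j, (j0 <= j)%nat -> (K <= s j)%nat)
  (Hdeg : forall j, exists k, 0 < p k /\ INR (s j) < INR (n j) * INR k)
  (Hstab : forall j, INR (n j) * pgf_mean p < INR (s j))
  (gamma : nat -> R)
  (Hgamma : forall j, INR (n j) * pgf_mean p / INR (s j) = 1 - gamma j / sqrt (INR (s j)))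
  (glo ghi : R) (Hglo : 0 < glo)
  (Hgb : forall j, glo <= gamma j <= ghi)
  (* the zeros Z_k of z^s - A(z) in 1 < |z| < r *)
  (Zk : nat -> Z -> C)
  (HZzero : forall k : Z, exists j0, forall j, (j0 <= j)%nat ->
      1 < Cmod (Zk j k) /\ Rbar_lt (Cmod (Zk j k)) r /\
      charf p (n j) (s j) (Zk j k) = 0%C)
  (HZ0 : forall j, 1 < Cmod (Zk j 0%Z) /\ Rbar_lt (Cmod (Zk j 0%Z)) r /\
      charf p (n j) (s j) (Zk j 0%Z) = 0%C /\
      forall z : C, 1 < Cmod z -> Rbar_lt (Cmod z) r ->
        charf p (n j) (s j) z = 0%C -> Cmod (Zk j 0%Z) <= Cmod z)
  (HZasym : forall k : Z, exists K : R, forall j,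
      let a0 := sqrt (2 * pgf_mean p) / sqrt (pgf_var p) in
      let b0 := gamma j * sqrt (pgf_mean p) / (sqrt (pgf_var p) * sqrt 2) in
      Cmod (Zk j k - (1 + RtoC (a0 / sqrt (INR (s j))) *
              (RtoC b0 + csqrt (RtoC (b0 ^ 2) - RtoC (2 * PI * IZR k) * Ci))))%C
        <= K / INR (s j))
  (* Q: stationary distribution of Q_{k+1} = max(Q_k + A_k - s, 0) *)
  (pi : nat -> nat -> R)
  (Hpi : forall j, stationary (convpow p (n j)) (s j) (pi j))
  (* Q(z): the meromorphic continuation of the PGF of Q to |z| < r *)
  (Qc : nat -> C -> C)
  (HQpgf : forall j z, Cmod z < 1 -> Qc j z = pgf (pi j) z)
  (HQhol : forall j z, Rbar_lt (Cmod z) r ->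
      ~ (1 < Cmod z /\ charf p (n j) (s j) z = 0%C) ->
      @ex_derive C_AbsRing C_NormedModule (Qc j) z)
  (* c_k = Res_{z = Z_k} Q(z) *)
  (c : nat -> nat -> C)
  (Hc : forall j k, 1 < Cmod (Zk j (Z.of_nat k)) ->
      Rbar_lt (Cmod (Zk j (Z.of_nat k))) r -> is_residue (Qc j) (Zk j (Z.of_nat k)) (c j k)) :
  forall M : nat, exists j0 : nat, forall j, (j0 <= j)%nat ->
    (forall k, (k < M)%nat -> Cmod (Zk j (Z.of_nat k)) < Cmod (Zk j (Z.of_nat (S k)))) /\
    forall m, (1 <= m <= M)%nat ->
      (exists K : R, forall N : nat,
         Rabs (tailP (pi j) N
               - Re (partial (c j) (fun k => Zk j (Z.of_nat k)) m N))
         <= K * / (Cmod (Zk j (Z.of_nat m)) ^ N)) /\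
      (exists K : R, forall N : nat,
         Cmod (term (c j m) (Zk j (Z.of_nat m)) N)
         <= K * (Cmod (Zk j (Z.of_nat (m - 1)%nat)) / Cmod (Zk j (Z.of_nat m))) ^ N
              * Cmod (term (c j (m - 1)%nat) (Zk j (Z.of_nat (m - 1)%nat)) N)).
Proof.
  intros M. subst r.
  assert (exists R1, 1 < R1 /\ Rbar_lt R1 (CV_radius p)) as [R1 [HR1 HR1r]].
  { destruct (CV_radius p) as [R0| |]; simpl in Hr1.
    - exists ((1 + R0) / 2). simpl. lra.
    - exists 2. simpl. split; [lra|auto].
    - contradiction. }
  (* Aperiodicity is the case r1 = 1 of the maximum property, with X(1) = 1. *)
  assert (Hap : forall z, Cmod z = 1 -> z <> 1%C -> Cmod (pgf p z) < 1).
  { intros z Hz Nz. pose proof (Haper 1 z ltac:(lra) Hr1 Hz Nz) as H.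
    rewrite pgf_at_1 in H by auto. exact H. }
  set (a0 := sqrt (2 * pgf_mean p) / sqrt (pgf_var p)) in *.
  set (h := fun j => sqrt (INR (s j))).
  assert (Hh : forall j, 0 < h j) by (intros j; apply sqrt_lt_R0, lt_0_INR, Hs).
  assert (Hhs : forall j, INR (s j) = h j ^ 2) by (intros j; unfold h; rewrite pow2_sqrt; auto; apply pos_INR).
  assert (Hheavy : forall j, heavy p glo ghi (n j) (s j) (gamma j) (h j)).
  { intros j. pose proof (Hh j) as P. pose proof (Hgb j). split; [|lra]. split; [auto|]. split; [auto|]. split; [|lra].
    pose proof (Hgamma j) as G. fold (h j) in G. rewrite Hhs in G.
    replace (INR (n j) * pgf_mean p) with (INR (n j) * pgf_mean p / h j ^ 2 * h j ^ 2) by (field; lra).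
    rewrite G. field. lra. }
  assert (Eb : forall j, gamma j * sqrt (pgf_mean p) / (sqrt (pgf_var p) * sqrt 2) = gamma j * a0 / 2).
  { intros j. unfold a0. rewrite sqrt_mult by lra. pose proof (sqrt_lt_R0 2 ltac:(lra)) as S2.
    pose proof (sqrt_lt_R0 _ Hsig) as Sv. pose proof (sqrt_sqrt 2 ltac:(lra)) as SS.
    replace (gamma j * (sqrt 2 * sqrt (pgf_mean p) / sqrt (pgf_var p)) / 2)
      with (gamma j * (sqrt 2 * sqrt (pgf_mean p) / sqrt (pgf_var p)) / (sqrt 2 * sqrt 2)) by (rewrite SS; auto).
    field. lra. }
  (* One asymptotic constant serves all indices up to M and all j, so the threshold [h0] can be
     fixed before j. *)
  destruct (uniform_const (fun k K => forall j,
     Cmod (Zk j (Z.of_nat k) - (1 + RtoC (a0 / h j) * (RtoC (gamma j * a0 / 2) + rt (gamma j * a0 / 2) (2 * PI * INR k)))) <= K / h j ^ 2) M)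
    as [KZ HKZ].
  { intros k a b Hab H j. eapply Rle_trans; [apply H|]. apply Rmult_le_compat_r; auto.
    left. apply Rinv_0_lt_compat, pow_lt, Hh. }
  { intros k. destruct (HZasym (Z.of_nat k)) as [K HK]. exists K. intros j. specialize (HK j). cbv zeta in HK.
    rewrite Eb, <- INR_IZR_INZ, Hhs in HK. unfold rt.
    rewrite <- Hhs in HK at 1. fold (h j) in HK. exact HK. }
  destruct (zero_structure p R1 Hp HR1 HR1r Hap Hmu Hsig glo ghi Hglo M KZ) as [h0 [Hh0 Hstr]].
  (* s_j >= [up (h0 ^ 2)] > h0^2 yields sqrt s_j >= h0. *)
  destruct (Hsinf (Z.to_nat (up (h0 ^ 2)))) as [j1 Hj1].
  destruct (eventually_le_all (fun k j => 1 < Cmod (Zk j (Z.of_nat k)) /\ Rbar_lt (Cmod (Zk j (Z.of_nat k))) (CV_radius p) /\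
      charf p (n j) (s j) (Zk j (Z.of_nat k)) = 0%C) M (fun k => HZzero (Z.of_nat k))) as [j2 Hj2].
  exists (Nat.max j1 j2). intros j Hj.
  assert (Hhj : h0 <= h j).
  { rewrite <- (sqrt_pow2 h0) by lra. unfold h. apply sqrt_le_1_alt.
    pose proof (le_INR _ _ (Hj1 j ltac:(lia))) as Q. destruct (archimed (h0 ^ 2)) as [A _].
    rewrite INR_IZR_INZ in Q. rewrite Z2Nat.id in Q.
    - lra.
    - apply le_IZR. pose proof (pow_lt h0 2 Hh0). lra. }
  assert (Hz : forall k, (k <= M)%nat -> zero_at p (n j) (s j) (Zk j (Z.of_nat k))).
  { intros k Hk. destruct (Hj2 j ltac:(lia) k Hk) as [A [_ B]]. split; auto. unfold charf in B.
    replace (Zk j (Z.of_nat k) ^ s j)%C with (Zk j (Z.of_nat k) ^ s j - pgf p (Zk j (Z.of_nat k)) ^ n j + pgf p (Zk j (Z.of_nat k)) ^ n j)%C by ring.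
    rewrite B. ring. }
  destruct (Hstr (n j) (s j) (gamma j) (h j) (fun k => Zk j (Z.of_nat k)) (Hheavy j) Hhj Hz (fun k Hk => HKZ k Hk j))
    as [S1 [S2 [S3 S4]]].
  split; [exact S3|]. intros m Hm.
  assert (Hmono : forall m k, (k <= m)%nat -> (m <= M)%nat -> Cmod (Zk j (Z.of_nat k)) <= Cmod (Zk j (Z.of_nat m))).
  { clear m Hm. intros m k Hk. induction Hk as [|m Hk IH]; intros HM; [lra|].
    specialize (IH ltac:(lia)). pose proof (S3 m ltac:(lia)) as Q. cbv beta in Q. lra. }
  destruct (S4 m ltac:(lia)) as [R0 [HR0 Hall]].
  assert (HZm : forall k, (k <= m)%nat -> zero_at p (n j) (s j) (Zk j (Z.of_nat k)) /\ pgf p (Zk j (Z.of_nat k)) <> 0%C /\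
     logder p (n j) (s j) (Zk j (Z.of_nat k)) <> 0%C /\ level p (n j) (s j) (Zk j (Z.of_nat k)) (Z.of_nat k) /\
     Cmod (Zk j (Z.of_nat k)) <= Cmod (Zk j (Z.of_nat m))).
  { intros k Hk. destruct (S1 k ltac:(lia)) as [_ [A [B D]]]. split; [apply Hz; lia|]. repeat split; auto. apply Hmono; lia. }
  assert (Hres : forall k, (k <= m)%nat -> is_residue (Qc j) (Zk j (Z.of_nat k)) (c j k)).
  { intros k Hk. destruct (Hj2 j ltac:(lia) k ltac:(lia)) as [A [B _]]. apply Hc; auto. }
  assert (Hhol : forall z, Rbar_lt (Cmod z) (CV_radius p) -> ~ (1 < Cmod z /\ charf p (n j) (s j) z = 0%C) -> Cdiff (Qc j) z).
  { intros z A B. apply ex_derive_Cdiff. apply HQhol; auto. }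
  split.
  - exact (tail_partial_bound p (n j) (s j) (pi j) (Qc j) R1 R0 (fun k => Zk j (Z.of_nat k)) (c j) m
      Hp HR1r (Hn j) (Hs j) (Hpi j) (HQpgf j) Hhol HZm S2 HR0 Hall Hres).
  - apply term_ratio_bound; [apply Hz; lia|apply Hz; lia|].
    apply (residue_neq_0 p (n j) (s j) (pi j) (Qc j) R1 R0 (fun k => Zk j (Z.of_nat k)) (c j) m); auto. lia.
Qed.
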